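(* Consider the Cramér–Lundberg model with exponential claims, $F(x)=1-e^{-\mu x}$, with $k\ge1$ and $P>-\frac cq$ (in (4) the case $P=-\frac cq$ is also allowed). Then the following hold. (1) For all $a\ge0$, $b\ge 0$, $$J_0^{a,b}=\frac{1-C'(b)\big(k\,m(a)+P\,\overline F(a)\big)}{\overline F(a)\,C'(b)+q\,W_q(b)}=\frac{\gamma(b)-k\,m(a)-P\,\overline F(a)}{q\,\theta(b)+\overline F(a)} .$$ (2) Put $j(b):=\frac{\gamma'(b)}{q\,\theta'(b)}$. For fixed $a\ge0$, the optimality equation $\frac{\partial}{\partial b}J_0^{a,b}=0$ may be written as $J_0^{a,b}=j(b)$. (3) For fixed $k\ge1$ and $b\ge 0$, at critical points $a(b)=a^{(k,P)}(b)\neq0$ satisfying $\frac{\partial}{\partial a}J_0^{a,b}=0$ at $a=a(b)$, one must have $\big[J_0^{a,b}-(ka-P)\big]_{a=a(b)}=0$. Explicitly, $\eta(b,a(b))=0$, where $$\eta(b,a):=\frac{\gamma(b)}{\theta(b)}-\frac{k}{\mu\,\theta(b)}F(a)-q\,(ka-P).$$ (4) When $P\ge-\frac cq$ and $b\ge0$ is fixed, the solution $a=a(b)$ of $\eta(b,a)=0$ may be expressed in terms of the principal branch $L_0$ of the Lambert-W function: $$(0,\infty)\ni a(b)=\mu^{-1}\Big(-h(b)+L_0\Big(\frac{e^{h(b)}}{q\,\theta(b)}\Big)\Big),\qquad h(b)=h(b,P)=\frac1{q\,\theta(b)}-\frac{\mu}{k}\Big(\frac{\gamma(b)}{q\,\theta(b)}+P\Big).$$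 It follows that $$J_0^{a(b),b}=\frac k\mu\Big(-h(b)+L_0\Big(\frac{1}{q\,\theta(b)}e^{h(b)}\Big)\Big)-P.$$ (5) In the special case $b=0$, with $\tilde c:=c+qP>0$, the equation $\eta(0,a)=0$ implies that $a=a^{(k,P)}=a^{(k,P)}(0)$ satisfies the simpler equation $$0=\delta_{k,P}(a):=\eta(0,a)=\tilde c-k\Big(aq+\frac{\lambda}{\mu}\big(1-e^{-\mu a}\big)\Big),$$ with solution $$\mu\,a^{(k,P)}=-g+L_0\Big(\frac{\lambda}{q}e^{g}\Big)>0,\qquad g=h(0)=\frac{\lambda}{q}-\frac{\mu}{kq}\,\tilde c .$$ (6) At a critical point $(a^*,b^* )$ of $(a,b)\mapsto J_0^{a,b}$ with $a^*>0$, $b^*>0$, one must have $J_0^{a^*,b^*}=j(b^* )=k a^*-P$. Hence $a^*=s(b^* )$ with $s(b):=\frac{j(b)+P}{k}$, and $\eta(b^* )=0$, where $$\eta(b):=\eta(b,s(b))=\frac{\gamma(b)}{\theta(b)}-q\,j(b)-\frac{k}{\mu\,\theta(b)}F\Big(\frac{j(b)+P}{k}\Big).$$ (7) The equation $\eta(b)=0$ may be solved explicitly for $P$, yielding $$P=-\frac k\mu\log\Big[1+\frac{q\,\theta(b)\,j(b)-\gamma(b)}{k/\mu}\Big]-j(b).$$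
   Context: Model: $X_t=x+ct-\sum_{i=1}^{N_t}\xi_i$, where $c>0$, $N$ is a Poisson process of intensity $\lambda>0$, and $(\xi_i)$ are i.i.d., independent of $N$, exponential with rate $\mu>0$. There is no Brownian component. Let $q>0$ be the discount rate, $k\ge1$ the proportional cost of capital injections, $P$ the penalty paid at bankruptcy. For $a\ge0$, $b\ge0$, the $(-a,0,b)$ policy is the following. Dividends are paid so as to keep the controlled reserve at or below $b$ (reflection at the upper barrier $b$). When a claim would bring the reserve below $0$ but not below $-a$, capital is injected to bring the reserve back to $0$. At the first time $T_{-a}$ when a claim would bring the reserve below $-a$, bankruptcy is declared and the penalty $P$ is paid. With $D_t$, $I_t$ the cumulative dividends and capital injections under this policy, $$J_0^{a,b}=\mathbb E_0\Big[\int_0^{T_{-a}}e^{-qt}(dD_t-k\,dI_t)-Pe^{-qT_{-a}}\Big].$$ Notation. $F(x)=1-e^{-\mu x}$ (this formula is used for every real argument) and $\overline F=1-F$. Also $$m(a)=\int_0^a y\,\mu e^{-\mu y}\,dy=\frac{1-e^{-\mu a}}{\mu}-ae^{-\mu a}.$$ The $q$-scale function $W_q$ on $[0,\infty)$ is the continuous function with Laplace transform $\frac{1}{\kappa(s)-q}$ for large $s$, where $\kappa(s)=s\big(c-\frac{\lambda}{\mu+s}\big)$. Further, $$C(x)=\lambda\int_0^xW_q(x-y)e^{-\mu y}\,dy=cW_q(x)-Z_q(x),\qquad Z_q(x)=1+q\int_0^xW_q(y)\,dy,$$ $$\gamma(b)=\frac1{C'(b)},\qquad \theta(b)=\frac{W_q(b)}{C'(b)}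 .$$ Derivatives at $0$ are right derivatives. $L_0:[-e^{-1},\infty)\to[-1,\infty)$ is the principal branch of the Lambert-W function, i.e. the inverse of $z\mapsto ze^z$ on $[-1,\infty)$.
   Formalization: In (4), a(b)>0 fails for some P<0 (b=0, P=-c/q gives a=0; b large with -c/q<P<0 gives a<0); instead the formula is proved to be the unique real root, positive iff P>-γ(b)/(qθ(b)), and the formula for J_0^{a(b),b} is stated when a(b)≥0. *)

(* Defs.v *)
(* MathComp + MathComp-Analysis *)
From mathcomp Require Import all_boot all_order all_algebra.
From mathcomp Require Import all_classical all_reals all_analysis ring.

Set Implicit Arguments.
Unset Strict Implicit.
Unset Printing Implicit Defensive.

Import Order.TTheory GRing.Theory Num.Theory.
Import numFieldNormedType.Exports.

Local Open Scope classical_set_scope.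
Local Open Scope ring_scope.

(* Difference quotients are restricted to [0, +oo[: an ordinary derivative
   at x > 0, a right derivative at x = 0. *)
Section derivatives_on_half_line.
Context {R : realType}.
Implicit Types (f : R -> R) (x l : R).

Definition is_hderiv f x l : Prop :=
  (f (x + h) - f x) / h @[h --> within [set h | 0 <= x + h] 0^'] --> l.

Definition hderiv f x : R :=
  lim ((f (x + h) - f x) / h @[h --> within [set h | 0 <= x + h] 0^']).

End derivatives_on_half_line.

(* The principal branch: the z in [-1, +oo[ such that z e^z = y, for y at
   least -e^-1, and an irrelevant value otherwise. *)
Definition lambertW0 {R : realType} (y : R) : R :=
  xget 0 [set z | -1 <= z /\ z * expR z = y].

Section scale_functions.
Context {R : realType} (c lam mu q : R).

Definition kappa (s : R) : R := s * (c - lam / (mu + s)).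

(* Values of W on ]-oo, 0[ are unconstrained and never used. *)
Definition is_scale_function (W : R -> R) : Prop :=
  {within `[0, +oo[, continuous W} /\
  \forall s \near +oo,
    (@lebesgue_measure R).-integrable `[0, +oo[
       (fun x => (expR (- (s * x)) * W x)%:E) /\
    \int[@lebesgue_measure R]_(x in `[0, +oo[) (expR (- (s * x)) * W x)
      = (kappa s - q)^-1.

Context (W : R -> R).

Definition Cfun (x : R) : R :=
  lam * \int[@lebesgue_measure R]_(y in `[0, x]) (W (x - y) * expR (- (mu * y))).

Definition gammaf (b : R) : R := 1 / hderiv Cfun b.

Definition thetaf (b : R) : R := W b / hderiv Cfun b.

Definition jf (b : R) : R := hderiv gammaf b / (q * hderiv thetaf b).

Definition Fexp (x : R) : R := 1 - expR (- (mu * x)).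

Definition Fbar (x : R) : R := 1 - Fexp x.

Definition partial_mean (a : R) : R :=
  \int[@lebesgue_measure R]_(y in `[0, a]) (y * (mu * expR (- (mu * y)))).

Context (k pen : R).

Definition etaf (b a : R) : R :=
  gammaf b / thetaf b - k / (mu * thetaf b) * Fexp a - q * (k * a - pen).

Definition hfun (b : R) : R :=
  1 / (q * thetaf b) - mu / k * (gammaf b / (q * thetaf b) + pen).

Definition threshold (b : R) : R := (jf b + pen) / k.

End scale_functions.

(* Stated for f : R -> R so that paths need not be bundled with a proof that
   they are nondecreasing and right-continuous. *)
Definition stieltjes {R : realType} (f : R -> R) :
    set (measurableTypeR R) -> \bar R :=
  mu_ext (wlength f).

Lemma stieltjesE {R : realType} (f : cumulative R R) :
  stieltjes f = lebesgue_stieltjes_measure f.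
Proof. by []. Qed.

(* Used for t in [0, +oo] only, with e^(- q oo) = 0. *)
Definition discount {R : realType} (q : R) (t : \bar R) : R :=
  if t is r%:E then expR (- (q * r)) else 0.

Section independence.
Context {d : measure_display} {T : measurableType d} {R : realType}.

Definition mutually_independent (Pr : probability T R) (I : eqType)
    (Z : I -> T -> R) : Prop :=
  forall (s : seq I) (B : I -> set R), uniq s ->
    (forall i, measurable (B i)) ->
    (Pr (\bigcap_(i in [set` s]) (Z i @^-1` B i))
     = \prod_(i <- s) Pr (Z i @^-1` B i))%E.

End independence.

Section cramer_lundberg.
Context {d : measure_display} {T : measurableType d} {R : realType}.
Context (Pr : probability T R).
Implicit Types (tau xi : nat -> {RV Pr >-> R}) (N : R -> T -> nat).

(* tau n is the time between claims n and n + 1; arrival n is the date of the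
   n-th claim, with arrival 0 = 0. *)
Definition arrival tau (n : nat) (w : T) : R := \sum_(i < n) tau i w.

(* N counts the points of a renewal process with exponential gaps. *)
Record poisson_process (lam : R) tau N : Prop := PoissonProcess {
  gap_gt0 : forall n w, 0 < tau n w ;
  gap_law : forall n A, measurable A ->
    distribution Pr (tau n) A = exponential_prob lam A ;
  gap_indep : mutually_independent Pr (fun n => tau n : T -> R) ;
  countE : forall t w n, 0 <= t -> (n <= N t w)%N = (arrival tau n w <= t) }.

Definition gaps_and_claims tau xi (i : nat + nat) : T -> R :=
  match i with inl n => tau n | inr n => xi n end.

(* N and tau generate the same sigma-algebra, so the last field says that the
   claims are independent of one another and of N. *)
Record cramer_lundberg (lam mu : R) tau xi N : Prop := CramerLundberg {
  claim_count : poisson_process lam tau N ;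
  claim_law : forall n A, measurable A ->
    distribution Pr (xi n) A = exponential_prob mu A ;
  claim_indep : mutually_independent Pr (gaps_and_claims tau xi) }.

Context (c : R) (tau xi : nat -> {RV Pr >-> R}) (N : R -> T -> nat).

Definition surplus (x t : R) (w : T) : R := x + c * t - \sum_(i < N t w) xi i w.

(* The (-a, 0, b) policy started from the reserve 0. The paths below are
   continued past bankruptcy as if the reserve had been brought back to 0
   without any injection; what happens there is never used. *)

(* The reserve right after the n-th claim and the injection it triggers. *)
Fixpoint reserve_after (b : R) (n : nat) (w : T) : R :=
  if n is m.+1 then
    Num.max 0 (Num.min b (reserve_after b m w + c * tau m w) - xi m w)
  else 0.

(* The level to which claim n.+1 brings the reserve, before any injection. *)
Definition level_at_claim (b : R) (n : nat) (w : T) : R :=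
  Num.min b (reserve_after b n w + c * tau n w) - xi n w.

Definition bankrupting (a b : R) (n : nat) (w : T) : bool :=
  level_at_claim b n w < - a.

Definition bankruptcy_time (a b : R) (w : T) : \bar R :=
  ereal_inf [set (arrival tau n.+1 w)%:E | n in [set n | bankrupting a b n w]].

(* Dividends paid during the s units of time following the n-th claim. *)
Definition overflow (b : R) (n : nat) (s : R) (w : T) : R :=
  Num.max 0 (reserve_after b n w + c * s - b).

Definition dividends (b : R) (w : T) (t : R) : R :=
  if t < 0 then 0 else
  \sum_(n < N t w) overflow b n (tau n w) w
    + overflow b (N t w) (t - arrival tau (N t w) w) w.

Definition injections (a b : R) (w : T) (t : R) : R :=
  if t < 0 then 0 else
  \sum_(n < N t w | ~~ bankrupting a b n w) Num.max 0 (- level_at_claim b n w).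

Definition reserve (a b t : R) (w : T) : R :=
  surplus 0 t w - dividends b w t + injections a b w t.

Lemma reserve_before_bankruptcy (a b t : R) (w : T) :
  0 <= t -> (forall n, (n < N t w)%N -> ~~ bankrupting a b n w) ->
  reserve a b t w
    = Num.min b (reserve_after b (N t w) w + c * (t - arrival tau (N t w) w)).
Proof.
move=> t0 alive.
have minE (u v : R) : Num.min u v = v - Num.max 0 (v - u).
  rewrite minEle maxEle subr_ge0.
  by case: ifP => _; rewrite ?subr0 // opprB addrC subrK.
have maxE (x : R) : Num.max 0 x = x + Num.max 0 (- x).
  rewrite !maxEle oppr_ge0.
  by case: (ltgtP 0 x) => [||<-]; rewrite ?addr0 ?subrr ?oppr0 ?addr0.
have balance n : reserve_after b n w = c * arrival tau n w - \sum_(i < n) xi i w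
    - \sum_(i < n) overflow b i (tau i w) w
    + \sum_(i < n) Num.max 0 (- level_at_claim b i w).
  elim: n => [|n IHn]; first by rewrite /arrival !big_ord0 mulr0 !subr0 addr0.
  rewrite [arrival _ _ _]big_ord_recr /= -/(arrival tau n w) !big_ord_recr /=.
  rewrite -/(level_at_claim b n w) maxE {1}/level_at_claim minE.
  by rewrite -/(overflow b n (tau n w) w) IHn; ring.
rewrite /reserve /surplus /dividends /injections ltNge t0 /=.
rewrite [X in _ + X = _](eq_bigl xpredT) => [|i]; last by rewrite alive.
by rewrite minE -/(overflow b (N t w) (t - arrival tau (N t w) w) w) balance; ring.
Qed.

Definition payoff (q k pen a b : R) (w : T) : \bar R :=
  let dates := [set t : R | 0 < t /\ (t%:E <= bankruptcy_time a b w)%E] in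
  (\int[stieltjes (dividends b w)]_(t in dates) (discount q t%:E)%:E
   - k%:E * \int[stieltjes (injections a b w)]_(t in dates) (discount q t%:E)%:E
   - (pen * discount q (bankruptcy_time a b w))%:E)%E.

Definition policy_value_ereal (q k pen a b : R) : \bar R :=
  (\int[Pr]_w payoff q k pen a b w)%E.

Definition policy_value (q k pen a b : R) : R :=
  fine (policy_value_ereal q k pen a b).

End cramer_lundberg.

(* Main.v *)
From HB Require Import structures.
Require Import Defs.
From mathcomp Require Import all_boot all_order all_algebra.
From mathcomp Require Import all_classical all_reals all_analysis.
From mathcomp Require Import measurable_realfun ring lra.

Set Implicit Arguments.
Unset Strict Implicit.
Unset Printing Implicit Defensive.

Import Order.TTheory GRing.Theory Num.Theory.
Import numFieldNormedType.Exports.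

Local Open Scope classical_set_scope.
Local Open Scope ring_scope.

(** Let r2 < 0 < r1 be the two roots of kappa(s) = q; they satisfy -mu < r2.
Expanding 1/(kappa(s) - q) into partial fractions and using the uniqueness of
continuous functions with a given Laplace transform
([laplace_transform_inj], [scale_function_unique]), W is an explicit
combination of e^(r1 x) and e^(r2 x), hence so are C and its derivatives.
In particular theta is positive with a positive derivative, because the
Wronskian W' C' - W C'' is a positive multiple of e^((r1 + r2) x)
([is_derive_theta_sol]).

The formula for the value of the policy is the verification of a candidate.
Let J be the right-hand side of the formula, let K be the expected
value after a claim that strikes at reserve 0 when J is the value of going on
from 0, and put v(x) = c J W(x) - K C(x).  This v is again a combination of the
two exponentials; it satisfies v(0) = J and v'(b) = 1, and the root equations
give
(lam + q) v - c v' = lam E(value after a claim) on [0, b]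
([claim_expectation]).  Integrating this equation over one exponential gap,
with the boundary term v'(b) = 1 accounting for the dividends at the barrier,
gives the dynamic programming identity
v(r) = E(discounted reward of one period + discounted v at its end)
([period_expectation]).

To pass from one period to the whole path, the state (discount factor times
survival indicator, reserve) after the n-th claim, say (z_n, r_n), is followed
along the claim dates.  It is a function of the past gaps and claims, so
independence lets the identity be used at each date ([independent_adjoin],
[integral_adjoin]), and telescoping
yields E(first m rewards) + E(z_m v(r_m)) = v(0) = J for every m.  The second
term is at most sup |v| (lam / (lam + q))^m.  On the other hand the payoff
of almost every path, given by Stieltjes integrals, is the sum of the series of
its rewards: between two claims dividends are flat and then affine, and injections
jump only at the second claim ([cvg_payoff]).  Dominated convergence, with
dominating function a multiple of the sum of the discount factors of all the
claim dates, gives J as expected payoff ([policy_value_fixpoint],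
[policy_value_sol]).

What remains is calculus on J = (gamma - k m(a) - P E) / (q theta + E), with
E = e^(-mu a).  One has dJ/db = (gamma' - J q theta') / (q theta + E) and
dJ/da = mu E (J - (k a - P)) / (q theta + E), while
J - (k a - P) = theta eta(b, a) / (q theta + E) ([policy_ratio_eta]).  Lastly
eta(b, a) = 0 says that z = mu a + h(b) solves z e^z = e^h(b) / (q theta(b)),
and the right-hand side is positive, so that this has exactly one real
solution ([eta_num_lambert]).  At a root a of eta(b, .) the sign of a is that
of eta(b, 0), because eta(b, .) is decreasing. *)

(** * Calculus with exponentials *)

Section exponential_calculus.
Context {R : realType}.
Implicit Types (f F : R -> R) (r s x a K l : R).
Local Notation leb := (@lebesgue_measure R).

(** Derivation rules for functions written pointwise: such functions compose
by plain application of the rules, whereas the generic ones are about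
pointwise operations on functions. *)
Lemma derive_eq f x df dg : is_derive x 1 f df -> df = dg -> is_derive x 1 f dg.
Proof. by move=> ? <-. Qed.

Lemma derive_D f F x df dF : is_derive x 1 f df -> is_derive x 1 F dF ->
  is_derive x 1 (fun y => f y + F y) (df + dF).
Proof. by move=> ? ?; exact: is_deriveD. Qed.

Lemma derive_B f F x df dF : is_derive x 1 f df -> is_derive x 1 F dF ->
  is_derive x 1 (fun y => f y - F y) (df - dF).
Proof. by move=> ? ?; exact: is_deriveB. Qed.

Lemma derive_N f x df : is_derive x 1 f df -> is_derive x 1 (fun y => - f y) (- df).
Proof. by move=> ?; exact: is_deriveN. Qed.

Lemma derive_Z f r x df : is_derive x 1 f df ->
  is_derive x 1 (fun y => r * f y) (r * df).
Proof. by move=> ?; exact: is_deriveZ. Qed.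

Lemma derive_M f F x df dF : is_derive x 1 f df -> is_derive x 1 F dF ->
  is_derive x 1 (fun y => f y * F y) (df * F x + f x * dF).
Proof.
move=> hf hF; have := is_deriveM hf hF.
by rewrite /GRing.scale/= addrC (mulrC (F x)).
Qed.

Lemma derive_div f F x df dF : is_derive x 1 f df -> is_derive x 1 F dF ->
  F x != 0 ->
  is_derive x 1 (fun y => f y / F y) ((df * F x - f x * dF) / F x ^+ 2).
Proof.
move=> hf hF Fx0.
have hV : is_derive x 1 (fun y => (F y)^-1) (- (F x) ^- 2 * dF).
  by have := is_deriveV Fx0 hF; rewrite /GRing.scale/=.
by apply: derive_eq (derive_M hf hV) _; field.
Qed.

Lemma derive_comp f F x df dF : is_derive (F x) 1 f df -> is_derive x 1 F dF ->
  is_derive x 1 (fun y => f (F y)) (df * dF).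
Proof. by move=> ? ?; exact: is_derive1_comp. Qed.

Lemma derive_cst r x : is_derive x 1 (fun=> r) (0 : R).
Proof. exact: is_derive_cst. Qed.

Lemma derive_id1 x : is_derive x 1 (fun y => y) (1 : R).
Proof. exact: is_derive_id. Qed.

Lemma is_derive_expRM r x :
  is_derive x 1 (fun y => expR (r * y)) (r * expR (r * x)).
Proof.
have := derive_comp (is_derive_expR (r * x)) (derive_Z r (derive_id1 x)).
by rewrite mulr1 mulrC.
Qed.

Lemma is_derive_expRNM s x :
  is_derive x 1 (fun y => expR (- (s * y))) (- (s * expR (- (s * x)))).
Proof.
by have := is_derive_expRM (- s) x; under eq_fun do rewrite mulNr; rewrite !mulNr.
Qed.

Lemma cvg_expRNM s : 0 < s -> expR (- (s * x)) @[x --> +oo] --> (0 : R).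
Proof.
move=> s0.
apply: (@cvg_comp _ _ _ (fun x => s * x) (fun x => expR (- x)) _ (pinfty_nbhs R)).
  exact: gt0_cvgMry.
exact: cvgr_expR.
Qed.

Lemma continuous_expRM r : continuous (fun x => expR (r * x)).
Proof.
move=> x; apply: continuous_comp; last exact: continuous_expR.
by apply: cvgM; [exact: cvg_cst|exact: cvg_id].
Qed.

Lemma continuous_expRNM s : continuous (fun x => expR (- (s * x))).
Proof.
by under eq_fun do rewrite -mulNr; exact: continuous_expRM.
Qed.

Lemma continuous_halflineW f a : continuous f -> {within `[a, +oo[, continuous f}.
Proof. exact: continuous_subspaceT. Qed.

(** For integrands of any sign.  Adding K e^(-s x) makes the integrand
nonnegative, which is the case where the fundamental theorem on a half line
follows from monotone convergence. *)
Lemma halfline_FTC f F a K s l : 0 < s ->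
  (forall x, a <= x -> `|f x| <= K * expR (- (s * x))) ->
  {within `[a, +oo[, continuous f} ->
  F x @[x --> +oo] --> l ->
  (forall x, a < x -> is_derive x 1 F (f x)) -> F x @[x --> a^'+] --> F a ->
  leb.-integrable `[a, +oo[ (EFin \o f) /\
  (\int[leb]_(x in `[a, +oo[) (f x)%:E = (l - F a)%:E)%E.
Proof.
move=> s0 fK cf Fl dF Fa.
pose e x := K * expR (- (s * x)).
pose E x := - (K / s) * expR (- (s * x)).
have dE x : is_derive x 1 E (e x).
  apply: derive_eq (derive_Z _ (is_derive_expRNM s x)) _.
  by rewrite /e; field; rewrite gt_eqF.
have ce : continuous e.
  move=> x; apply: cvgM; first exact: cvg_cst.
  exact: continuous_expRNM.
have El : E x @[x --> +oo] --> 0.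
  rewrite -[X in _ --> X](mulr0 (- (K / s))); apply: cvgM; first exact: cvg_cst.
  exact: cvg_expRNM.
have Ea : E x @[x --> a^'+] --> E a.
  apply: cvg_at_right_filter; apply: cvgM; first exact: cvg_cst.
  exact: continuous_expRNM.
have e0 x : a <= x -> 0 <= e x by move=> /fK; apply: le_trans.
have Ie : (\int[leb]_(x in `[a, +oo[) (e x)%:E = 0%:E - (E a)%:E)%E.
  apply: (ge0_continuous_FTC2y e0 (continuous_halflineW ce) El _ Ea).
    by move=> x _; exact: ex_derive.
  by move=> x _; rewrite derive1E derive_val.
have Ife : (\int[leb]_(x in `[a, +oo[) (f x + e x)%:E = (l + 0)%:E - (F a + E a)%:E)%E.
  apply: (@ge0_continuous_FTC2y R (fun x => f x + e x) (fun x => F x + E x)).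
  - by move=> x /fK; rewrite ler_norml -/(e x) => /andP[+ _]; rewrite -subr_ge0 opprK addrC.
  - by move=> x; apply: cvgD; [exact: cf|exact: continuous_halflineW].
  - exact: cvgD.
  - by move=> x ax; have h1 := dF _ ax; exact: ex_derive.
  - exact: cvgD.
  - move=> x; rewrite in_itv/= andbT => ax; have h1 := dF _ ax.
    by rewrite derive1E; apply: derive_val.
have mf : measurable_fun `[a, +oo[ f.
  exact: subspace_continuous_measurable_fun.
have me : measurable_fun `[a, +oo[ e.
  exact: measurable_funTS (continuous_measurable_fun ce).
have ie : leb.-integrable `[a, +oo[ (EFin \o e).
  apply/integrableP; split; first exact/measurable_EFinP.
  under eq_integral => x xa.
    rewrite /= ger0_norm; last by apply: e0; move: xa; rewrite inE/= in_itv/= andbT.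
    over.
  by rewrite Ie ltry.
have if_ : leb.-integrable `[a, +oo[ (EFin \o f).
  apply: le_integrable ie => //; first exact/measurable_EFinP.
  move=> x; rewrite /= in_itv/= andbT => ax.
  by rewrite lee_fin (le_trans (fK _ ax))// ler_norm.
split => //.
have := Ife; under eq_integral do rewrite EFinD.
rewrite (integralD (mu:=leb) _ if_ ie)//= Ie => h.
have fi : (\int[leb]_(x in `[a, +oo[) (f x)%:E)%E \is a fin_num.
  exact: integrable_fin_num if_.
move: h; rewrite -(fineK fi) -!EFinB -!EFinD => -[] h.
by congr EFin; move: h; rewrite addr0; lra.
Qed.

End exponential_calculus.

(** * Uniqueness of the Laplace transform *)

Section integrability.
Context d (T : measurableType d) (R : realType).
Variables (nu : {measure set T -> \bar R}) (D : set T) (mD : measurable D).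

Lemma integrable_mul_bounded (f g : T -> R) (K : R) :
  nu.-integrable D (EFin \o f) -> measurable_fun D g ->
  (forall x, D x -> `|g x| <= K) ->
  nu.-integrable D (EFin \o (fun x => g x * f x)).
Proof.
move=> fi mg gK.
have mf : measurable_fun D f by apply/measurable_EFinP; exact: measurable_int fi.
have : nu.-integrable D (EFin \o (fun x => K * f x)).
  by have := integrableZl mD K fi; apply: eq_integrable.
apply: le_integrable => //; first by apply/measurable_EFinP; exact: measurable_funM.
move=> x Dx /=; rewrite lee_fin !normrM ler_wpM2r//.
by rewrite (le_trans (gK _ Dx))// ler_norm.
Qed.

End integrability.

Section laplace_uniqueness.
Context {R : realType}.
Local Notation leb := (@lebesgue_measure R).
Local Notation E := (`[0, +oo[%classic : set R).

Lemma measurable_expRNM (s : R) (D : set (measurableTypeR R)) :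
  measurable_fun D (fun x => expR (- (s * x))).
Proof.
by apply: measurable_funTS; apply: continuous_measurable_fun; exact: continuous_expRNM.
Qed.

(* The two Bernoulli inequalities show that (1 - y^n)^(2^n) tends to 1 if
   2 y < 1 and to 0 if 2 y > 1. *)
Let bernoulli_le (z : R) n : 0 <= z <= 1 -> 1 - n%:R * z <= (1 - z) ^+ n.
Proof.
move=> /andP[z0 z1]; elim: n => [|n IH]; first by rewrite mul0r subr0 expr0.
rewrite exprS (le_trans _ (ler_wpM2l _ IH)) ?subr_ge0// -natr1.
have : 0 <= n%:R * (z * z) by rewrite !mulr_ge0.
by nra.
Qed.

Let bernoulli_ge (z : R) n : 0 <= z <= 1 -> (1 - z) ^+ n * (n%:R * z) <= 1.
Proof.
move=> /andP[z0 z1].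
have : (1 - z) ^+ n * (1 + z) ^+ n <= 1.
  rewrite -exprMn exprn_ile1//; first by rewrite mulr_ge0 ?subr_ge0// addr_ge0.
  by nra.
apply: le_trans; rewrite ler_wpM2l ?exprn_ge0 ?subr_ge0//.
suff : 1 + n%:R * z <= (1 + z) ^+ n by apply: le_trans; rewrite lerDr.
elim: n => [|n IH]; first by rewrite mul0r expr0 addr0.
rewrite exprS -natr1 (le_trans _ (ler_wpM2l _ IH))// ?addr_ge0//.
have : 0 <= n%:R * (z * z) by rewrite !mulr_ge0.
by nra.
Qed.

Section vanishing_transform.
Variable w : R -> R.
Hypothesis iw : leb.-integrable E (EFin \o w).
Hypothesis w0 : forall s, 0 <= s ->
  (\int[leb]_(x in E) (expR (- (s * x)) * w x)%:E = 0)%E.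

Let expR_le1N (s x : R) : 0 <= s -> E x -> `|expR (- (s * x))| <= 1.
Proof.
rewrite /= in_itv/= andbT => s0 x0.
by rewrite ger0_norm ?expR_ge0// expR_le1 oppr_le0 mulr_ge0.
Qed.

Let vanish_poly (p : {poly R}) (s : R) : 0 <= s ->
  (\int[leb]_(x in E) (p.[expR (- (s * x))] * w x)%:E = 0)%E.
Proof.
move=> s0.
have polyE x : (p.[expR (- (s * x))] * w x)%:E =
    (\sum_(i < size p) (p`_i)%:E * (expR (- (i%:R * s * x)) * w x)%:E)%E.
  rewrite horner_coef mulr_suml -sumEFin; apply: eq_bigr => i _.
  by rewrite -EFinM mulrA -expRM_natl mulrN mulrA.
under eq_integral do rewrite polyE.
have ii (i : 'I_(size p)) : leb.-integrable E
    (fun x => (expR (- (i%:R * s * x)) * w x)%:E).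
  apply: (@integrable_mul_bounded _ _ _ _ _ _ _ _ 1) => //.
    exact: measurable_expRNM.
  by move=> x; apply: expR_le1N; rewrite mulr_ge0.
rewrite integral_sum//=; last by move=> i; exact: integrableZl.
rewrite big1// => i _; rewrite integralZl//= w0 ?mule0//.
by rewrite mulr_ge0.
Qed.

(* A polynomial in e^(-s x), with s = ln 2 / t chosen so that e^(-s t) = 1/2;
   as n grows it tends to the indicator function of ]t, +oo[ off t. *)
Let cutoff (t : R) n (x : R) : R :=
  (1 - expR (- (ln 2 / t * x)) ^+ n) ^+ (2 ^ n).

Let cvg_cutoff (t x : R) : 0 < t -> 0 <= x -> x != t ->
  cutoff t n x @[n --> \oo] --> ((t < x)%R%:R : R).
Proof.
move=> t0 x0 xt; rewrite /cutoff; set y := expR _.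
have y01 : 0 <= y <= 1.
  by rewrite expR_ge0 expR_le1 oppr_le0 mulr_ge0// divr_ge0 ?ln_ge0 ?ler1n// ltW.
have yn01 n : 0 <= y ^+ n <= 1.
  by case/andP: y01 => y0 y1; rewrite exprn_ge0// exprn_ile1.
have yE : 2 * y = expR (ln 2 * ((t - x) / t)).
  rewrite -[X in X * _](@lnK R 2) ?posrE// /y -expRD; congr expR.
  by field; rewrite gt_eqF.
have ln20 : 0 < ln 2 :> R by rewrite ln_gt0// ltr1n.
have [tx|tx] := ltP t x.
  have y2 : `|2 * y| < 1.
    rewrite yE ger0_norm ?expR_ge0// expR_lt1 pmulr_rlt0// pmulr_llt0 ?invr_gt0//.
    by rewrite subr_lt0.
  have g0 : (2 * y) ^+ n @[n --> \oo] --> (0 : R) by exact: cvg_expr.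
  apply: (@squeeze_cvgr _ _ _ _ (fun n => 1 - (2 * y) ^+ n) (fun=> 1)).
  - apply: nearW => n; apply/andP; split.
      by rewrite exprMn -natrX bernoulli_le.
    by case/andP: (yn01 n) => ? ?; rewrite exprn_ile1 ?subr_ge0// gerBl.
  - by rewrite -[X in _ --> X]subr0; apply: cvgB => //; exact: cvg_cst.
  - exact: cvg_cst.
have {}tx : x < t by rewrite lt_neqAle xt tx.
have y0 : 0 < 2 * y by rewrite mulr_gt0// expR_gt0.
have y2 : `|(2 * y)^-1| < 1.
  rewrite ger0_norm ?invr_ge0 ?(ltW y0)// invf_lt1// yE expR_gt1.
  by rewrite mulr_gt0// divr_gt0// subr_gt0.
apply: (@squeeze_cvgr _ _ _ _ (fun=> 0) (fun n => (2 * y)^-1 ^+ n)).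
- apply: nearW => n; apply/andP; split.
    by case/andP: (yn01 n) => ? ?; rewrite exprn_ge0// subr_ge0.
  rewrite exprVn -[X in _ <= X]mul1r ler_pdivlMr ?exprn_gt0//.
  by rewrite exprMn -natrX bernoulli_ge.
- exact: cvg_cst.
- exact: cvg_expr.
Qed.

(* The cutoffs are polynomials in an exponential, so their integrals against w
   vanish; they are bounded by 1. *)
Let vanish_tail (t : R) : 0 < t ->
  (\int[leb]_(x in `]t, +oo[) (w x)%:E = 0)%E.
Proof.
move=> t0.
have lt0 : 0 <= ln 2 / t by rewrite divr_ge0 ?ln_ge0 ?ler1n// ltW.
have cut01 n x : E x -> `|cutoff t n x| <= 1.
  move=> Ex; have := expR_le1N lt0 Ex; rewrite /cutoff.
  rewrite ger0_norm ?expR_ge0// => e1.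
  have e2 := exprn_ile1 n (expR_ge0 _) e1.
  have e3 := exprn_ge0 n (expR_ge0 (- (ln 2 / t * x))).
  by rewrite ger0_norm ?exprn_ge0 ?subr_ge0// exprn_ile1 ?subr_ge0// gerBl.
have mcut n : measurable_fun E (cutoff t n).
  apply: measurable_funTS; apply: measurable_funX; apply: measurable_funB => //.
  by apply: measurable_funX; exact: measurable_expRNM.
have mw : measurable_fun E w by apply/measurable_EFinP; exact: measurable_int iw.
pose W := (EFin \o w) \_ `]t, +oo[.
have WE x : W x = ((t < x)%R%:R * w x)%:E.
  rewrite /W patchE mem_setE in_itv/= andbT.
  by case: ltP; rewrite ?mul1r ?mul0r.
have sub : E `&` `]t, +oo[%classic = `]t, +oo[%classic.
  apply/seteqP; split=> [x []//|x /=]; rewrite !in_itv/= !andbT => tx.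
  by split => //; exact/ltW/(lt_trans t0).
have mW : measurable_fun E W.
  apply/(measurable_restrict _ _ _) => //; rewrite sub.
  by apply/measurable_EFinP; apply: measurable_funS mw => //; rewrite -sub; exact: subIsetl.
rewrite -sub integral_mkcondr.
have := @dominated_convergence _ _ _ leb E (measurable_itv _)
  (fun n x => (cutoff t n x * w x)%:E) W (fun x => `|w x|%:E) _ mW.
case.
- by move=> n; apply/measurable_EFinP; exact: (measurable_funM (mcut n) mw).
- exists [set t]; split => //; first exact: lebesgue_measure_set1.
  move=> x /=; apply: contra_notP => /eqP xt; rewrite in_itv/= andbT => x0.
  by rewrite WE; apply: cvg_EFin; [exact: nearW|apply: cvgM; [exact: cvg_cutoff|exact: cvg_cst]].
- exact: (integrable_norm iw).
- apply: aeW => x n Ex; rewrite /= lee_fin normrM.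
  by rewrite -[X in _ <= X]mul1r ler_wpM2r// cut01.
move=> _ _ cW.
have c0 : (fun n => \int[leb]_(x in E) (cutoff t n x * w x)%:E)%E = cst 0%E.
  apply/funext => n /=.
  have := vanish_poly ((1 - 'X^n) ^+ (2 ^ n)) lt0.
  by under eq_integral do rewrite !hornerE.
move: cW; rewrite c0 => /cvg_lim <- //.
exact: lim_cst.
Qed.

Let vanish_pos (x : R) : {within E, continuous w} -> 0 < x -> w x = 0.
Proof.
move=> cw x0.
have x1 : x < x + 1 by rewrite ltrDl.
have iw1 (y : R) : leb.-integrable `[0, y] (EFin \o w).
  by apply: integrableS iw => //; exact: subset_itvl.
have cwx : {for x, continuous w}.
  by have [+ _] := (continuous_within_itvcyP _ _).1 cw; apply; rewrite in_itv/= x0.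
have [dG <-] := continuous_FTC1_closed x1 (iw1 _) x0 cwx.
have G0 y : 0 < y -> \int[leb]_(t in `[0, y]) w t = 0.
  move=> y0.
  have := @Rintegral_itvB _ w (BLeft 0) (BInfty _ false) y iw.
  rewrite /Rintegral vanish_tail//= => h.
  have := w0 (lexx 0).
  under eq_integral do rewrite mul0r oppr0 expR0 mul1r.
  move=> h0; move: h; rewrite h0/= sub0r => h.
  by apply/eqP; rewrite -oppr_eq0 h ?bnd_simp// ltW.
rewrite derive1E (@near_eq_derive _ _ _ _ (cst 0)) ?oner_eq0//; last first.
  near=> y; apply: G0; near: y; exact: lt_nbhsr.
exact: derive_val.
Unshelve. all: by end_near. Qed.

(** The integrals of w over all half lines ]t, +oo[ vanish, so the primitive
of w is constant. *)
Lemma vanishing_laplace_transform : {within E, continuous w} ->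
  forall x, 0 <= x -> w x = 0.
Proof.
move=> cw x; rewrite le_eqVlt => /predU1P[<-|]; last exact: vanish_pos.
have [_ c0] := (continuous_within_itvcyP _ _).1 cw.
have : w y @[y --> 0^'+] --> 0.
  apply: cvg_near_cst; near=> y; apply: vanish_pos => //.
by move/(cvg_unique _ c0); apply.
Unshelve. all: by end_near. Qed.

End vanishing_transform.

(** Multiplying f - g by e^(-s x) for one large s gives an integrable function
whose Laplace transform vanishes on [0, +oo[. *)
Lemma laplace_transform_inj (f g : R -> R) :
  {within E, continuous f} -> {within E, continuous g} ->
  (\forall s \near +oo,
    [/\ leb.-integrable E (fun x => (expR (- (s * x)) * f x)%:E),
        leb.-integrable E (fun x => (expR (- (s * x)) * g x)%:E) &
        \int[leb]_(x in E) (expR (- (s * x)) * f x) =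
        \int[leb]_(x in E) (expR (- (s * x)) * g x)]) ->
  forall x, 0 <= x -> f x = g x.
Proof.
move=> cf cg [s0 [_ fgs]].
pose s1 := s0 + 1.
pose w x := expR (- (s1 * x)) * (f x - g x).
have ce : continuous (fun x : R => expR (- (s1 * x))) by exact: continuous_expRNM.
suff w0 : forall x, 0 <= x -> w x = 0.
  move=> x /w0 /eqP; rewrite mulf_eq0 expR_eq0/= subr_eq0 => /eqP //.
have wE s x : (expR (- (s * x)) * w x)%:E =
    ((expR (- ((s1 + s) * x)) * f x)%:E - (expR (- ((s1 + s) * x)) * g x)%:E)%E.
  rewrite /w -EFinB; congr EFin.
  by rewrite mulrA -expRD mulrBr; congr (expR _ * _ - expR _ * _); ring.
have H s : 0 <= s -> s0 < s1 + s by rewrite /s1 => ?; rewrite -addrA ltrDl ltr_pwDl.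
apply: vanishing_laplace_transform.
- have [i1 i2 _] := fgs _ (H _ (lexx 0)).
  have /(_ (measurable_itv _)) := integrableB _ i1 i2.
  apply: eq_integrable => // x _ /=.
  by rewrite -wE mul0r oppr0 expR0 mul1r.
- move=> s /H/fgs[i1 i2 i12].
  under eq_integral do rewrite wE.
  rewrite integralB//=.
  have /(_ (measurable_itv _)) := integrable_fin_num _ i1.
  have /(_ (measurable_itv _)) := integrable_fin_num _ i2.
  move: i12; rewrite /Rintegral => i12 /fineK <- /fineK <-.
  by rewrite i12 subee.
- by move=> x; apply: cvgM; [exact: continuous_halflineW|apply: cvgB; [exact: cf|exact: cg]].
Qed.

End laplace_uniqueness.

(** * Derivatives on the half line and integrals over segments *)

Section half_line_derivatives.
Context {R : realType}.
Implicit Types (f g : R -> R) (x l : R).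

Let half_line_filter (x : R) : set_system R := within [set h : R | 0 <= x + h] 0^'.

Let half_line_filter_proper x : 0 <= x -> ProperFilter (half_line_filter x).
Proof.
move=> x0; apply: Build_ProperFilter_ex => P.
rewrite /half_line_filter /within /= => /nbhs_ballP[e /= e0 eP].
exists (e / 2); apply: eP => //=.
- rewrite -ball_normE /= sub0r normrN ger0_norm ?divr_ge0 ?(ltW e0)//.
  by rewrite ltr_pdivrMr// ltr_pMr// ltr1n.
- by rewrite mulf_neq0 ?gt_eqF// invr_gt0.
- by rewrite addr_ge0// divr_ge0// ltW.
Qed.

Lemma hderiv_val f x l : 0 <= x -> is_hderiv f x l -> hderiv f x = l.
Proof.
by move=> /half_line_filter_proper ? fxl; apply: cvg_lim => //; exact: norm_hausdorff.
Qed.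

Lemma is_hderiv_derive f g x l : 0 <= x -> (forall y, 0 <= y -> f y = g y) ->
  is_derive x 1 g l -> is_hderiv f x l.
Proof.
move=> x0 fg dg.
have : (fun h => h^-1 *: ((g \o shift x) (h *: 1) - g x)) h @[h --> 0^'] --> l.
  by rewrite -(@derive_val _ _ _ _ _ _ _ dg); exact: (@ex_derive _ _ _ _ _ _ _ dg).
move=> /(@cvg_within_filter _ _ _ _ _ _ [set h : R | 0 <= x + h]) /=.
rewrite /is_hderiv; apply: cvg_trans; apply: near_eq_cvg.
rewrite near_withinE; apply: nearW => h /= xh.
by rewrite !fg// /GRing.scale/= mulr1 mulrC (addrC h).
Qed.

End half_line_derivatives.

Section segment.
Context {R : realType}.
Local Notation leb := (@lebesgue_measure R).

Lemma segment_FTC (f F : R -> R) (a b : R) : a <= b -> continuous f ->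
  (forall x : R, is_derive x 1 F (f x)) ->
  (\int[leb]_(x in `[a, b]) (f x)%:E = (F b - F a)%:E)%E.
Proof.
rewrite le_eqVlt => /predU1P[->|ab] cf dF.
  by rewrite set_itv1 integral_set1 subrr.
have cF (x : R) : {for x, continuous F}.
  by apply/differentiable_continuous/derivable1_diffP; exact: ex_derive.
apply: continuous_FTC2 => //.
- exact: continuous_subspaceT.
- by split; [move=> x _; exact: ex_derive|exact/cvg_at_right_filter/cF|exact/cvg_at_left_filter/cF].
- by move=> x _; rewrite derive1E; exact: derive_val.
Qed.

Lemma Rsegment_FTC (f F : R -> R) (a b : R) : a <= b -> continuous f ->
  (forall x : R, is_derive x 1 F (f x)) ->
  \int[leb]_(x in `[a, b]) (f x) = F b - F a.
Proof. by move=> ab cf dF; rewrite /Rintegral (segment_FTC ab cf dF). Qed.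

End segment.

(** * The scale function in closed form *)

Section scale_function_roots.
Context {R : realType}.
Variables c lam mu q : R.
Hypotheses (c0 : 0 < c) (lam0 : 0 < lam) (mu0 : 0 < mu) (q0 : 0 < q).

(** The last two conditions are Vieta's formulas for the equation
kappa(s) = q, cleared of its denominator. *)
Definition is_root_pair (r1 r2 : R) : Prop :=
  [/\ - mu < r2, r2 < 0, 0 < r1,
      c * (r1 + r2) = lam + q - c * mu & c * (r1 * r2) = - (q * mu)].

Lemma root_pair_exists : exists r1 r2, is_root_pair r1 r2.
Proof.
pose p := lam + q - c * mu.
pose D := Num.sqrt (p ^+ 2 + 4 * c * (q * mu)).
have D2 : D ^+ 2 = p ^+ 2 + 4 * c * (q * mu).
  by rewrite sqr_sqrtr// addr_ge0 ?sqr_ge0// !mulr_ge0// ltW.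
have D0 : 0 <= D by exact: sqrtr_ge0.
have cqm : 0 < 4 * c * (q * mu) by rewrite !mulr_gt0.
have pD : `|p| < D.
  by rewrite -(@ltr_pXn2r _ 2) ?nnegrE// D2 real_normK ?num_real// ltrDl.
move: pD; rewrite ltr_norml => /andP[pD1 pD2].
have c2 : 0 < 2 * c by rewrite mulr_gt0.
exists ((p + D) / (2 * c)), ((p - D) / (2 * c)); split.
- rewrite ltr_pdivlMr// mulNr ltrNl opprB.
  have : D ^+ 2 < (p + 2 * c * mu) ^+ 2.
    rewrite D2 /p; have : 0 < c * mu * lam by rewrite !mulr_gt0.
    by nra.
  have s0 : 0 <= p + 2 * c * mu.
    have -> : p + 2 * c * mu = lam + q + c * mu by rewrite /p; ring.
    by rewrite !addr_ge0// ltW// mulr_gt0.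
  by rewrite ltr_pXn2r ?nnegrE// ltrBlDl mulrC.
- by rewrite pmulr_llt0 ?invr_gt0// subr_lt0.
- by rewrite divr_gt0//; lra.
- by rewrite -/p; field; rewrite gt_eqF.
- apply: (mulfI (_ : 4 * c != 0)); first by rewrite gt_eqF// mulr_gt0.
  have -> : 4 * c * (c * ((p + D) / (2 * c) * ((p - D) / (2 * c)))) = p ^+ 2 - D ^+ 2.
    by field; rewrite gt_eqF.
  by rewrite D2; ring.
Qed.

Section root_pair.
Variables r1 r2 : R.
Hypothesis hr : is_root_pair r1 r2.

Let r2mu : - mu < r2. Proof. by case: hr. Qed.
Let r20 : r2 < 0. Proof. by case: hr. Qed.
Let r10 : 0 < r1. Proof. by case: hr. Qed.
Let rD : c * (r1 + r2) = lam + q - c * mu. Proof. by case: hr. Qed.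
Let rM : c * (r1 * r2) = - (q * mu). Proof. by case: hr. Qed.
Let mr2 : 0 < mu + r2. Proof. by rewrite -ltrBlDl sub0r. Qed.
Let r12 : 0 < r1 - r2. Proof. by rewrite subr_gt0 (lt_trans r20). Qed.
Let cr0 : c * (r1 - r2) != 0. Proof. by rewrite gt_eqF// mulr_gt0. Qed.

(** The inverse Laplace transform of
1/(kappa(s) - q) = (mu + s) / (c (s - r1) (s - r2)). *)
Definition scale_sol (x : R) : R :=
  ((mu + r1) * expR (r1 * x) - (mu + r2) * expR (r2 * x)) / (c * (r1 - r2)).

Definition C_sol (x : R) : R :=
  lam * (expR (r1 * x) - expR (r2 * x)) / (c * (r1 - r2)).

Lemma continuous_scale_sol : continuous scale_sol.
Proof.
move=> x; apply: cvgM; last exact: cvg_cst.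
by apply: cvgB; apply: cvgM => //; [exact: cvg_cst|exact: continuous_expRM|
  exact: cvg_cst|exact: continuous_expRM].
Qed.

Lemma kappa_factor s : mu + s != 0 ->
  kappa c lam mu s - q = c * (s - r1) * (s - r2) / (mu + s).
Proof.
move=> ms; rewrite /kappa.
have -> : c * (s - r1) * (s - r2) = c * s ^+ 2 - (c * (r1 + r2)) * s + c * (r1 * r2).
  by ring.
by rewrite rD rM; field.
Qed.

(** Both exponentials are integrable against e^(-s x) as soon as r1 < s, and
partial fractions recombine their transforms. *)
Lemma laplace_scale_sol s : r1 < s ->
  (@lebesgue_measure R).-integrable `[0, +oo[
     (fun x => (expR (- (s * x)) * scale_sol x)%:E) /\
  \int[@lebesgue_measure R]_(x in `[0, +oo[) (expR (- (s * x)) * scale_sol x)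
    = (kappa c lam mu s - q)^-1.
Proof.
move=> r1s.
have s10 : 0 < s - r1 by rewrite subr_gt0.
have s20 : 0 < s - r2 by rewrite subr_gt0 (lt_trans r20)// (lt_trans r10).
pose A := (mu + r1) / (c * (r1 - r2)); pose B := (mu + r2) / (c * (r1 - r2)).
have A0 : 0 < A by rewrite divr_gt0 ?addr_gt0// mulr_gt0.
have B0 : 0 < B by rewrite divr_gt0 ?mulr_gt0.
pose f (x : R) : R := A * expR (- ((s - r1) * x)) - B * expR (- ((s - r2) * x)).
pose F (x : R) : R := - (A / (s - r1)) * expR (- ((s - r1) * x))
  + B / (s - r2) * expR (- ((s - r2) * x)).
have fE x : expR (- (s * x)) * scale_sol x = f x.
  rewrite /scale_sol /f /A /B.
  have -> : - ((s - r1) * x) = - (s * x) + r1 * x by ring.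
  have -> : - ((s - r2) * x) = - (s * x) + r2 * x by ring.
  by rewrite !expRD; field; case/andP: (conj c0 r12) => *; rewrite !gt_eqF.
have dF (x : R) : is_derive x 1 F (f x).
  apply: derive_eq (derive_D (derive_Z _ (is_derive_expRNM _ _))
    (derive_Z _ (is_derive_expRNM _ _))) _.
  by rewrite /f; field; rewrite !gt_eqF.
have cF (x : R) : {for x, continuous F}.
  by apply/differentiable_continuous/derivable1_diffP; exact: ex_derive.
have [if_ If] : (@lebesgue_measure R).-integrable `[0, +oo[ (EFin \o f) /\
  (\int[@lebesgue_measure R]_(x in `[0%R, +oo[) (f x)%:E = (0 - F 0)%:E)%E.
  apply: (@halfline_FTC _ _ _ _ (A + B) (s - r1)) => //.
  - move=> x x0; rewrite /f (le_trans (ler_normB _ _))// (normrM A) (normrM B).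
    rewrite (ger0_norm (ltW A0)) (ger0_norm (ltW B0)).
    rewrite !ger0_norm ?expR_ge0// [leRHS]mulrDl lerD2l.
    rewrite ler_wpM2l ?(ltW B0)// ler_expR lerN2 ler_wpM2r//.
    by rewrite lerD2l lerN2 ltW// (lt_trans r20).
  - apply: continuous_halflineW => x.
    by apply: cvgB; apply: cvgM => //; [exact: cvg_cst|exact: continuous_expRNM|
      exact: cvg_cst|exact: continuous_expRNM].
  - rewrite -[X in _ --> X](addr0 0); apply: cvgD.
      by rewrite -[X in _ --> X](mulr0 (- (A / (s - r1)))); apply: cvgM;
        [exact: cvg_cst|exact: cvg_expRNM].
    by rewrite -[X in _ --> X](mulr0 (B / (s - r2))); apply: cvgM;
        [exact: cvg_cst|exact: cvg_expRNM].
  - exact/cvg_at_right_filter/cF.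
split.
  by apply: eq_integrable if_ => // x _ /=; rewrite fE.
under eq_Rintegral do rewrite fE.
rewrite /Rintegral If/= /F !mulr0 !oppr0 !expR0 !mulr1 kappa_factor; last first.
  by rewrite gt_eqF// addr_gt0// (lt_trans r10).
rewrite /A /B; field.
by rewrite !gt_eqF// addr_gt0// (lt_trans r10).
Qed.

Lemma scale_function_unique W : is_scale_function c lam mu q W ->
  forall x, 0 <= x -> W x = scale_sol x.
Proof.
move=> [cW [s0 [_ hs]]]; apply: laplace_transform_inj => //.
  exact/continuous_halflineW/continuous_scale_sol.
exists (Num.max s0 r1); split; first by rewrite num_real.
move=> s; rewrite /= gt_max => /andP[s0s r1s].
have [i1 e1] := hs _ s0s; have [i2 e2] := laplace_scale_sol r1s.
by split => //; rewrite e1 e2.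
Qed.

(** In the convolution of W with e^(-mu y), the factor mu + r of each
exponential of W is cancelled by integration, and the two terms in e^(-mu x)
compensate. *)
Lemma Cfun_sol W : (forall x, 0 <= x -> W x = scale_sol x) ->
  forall x, 0 <= x -> Cfun lam mu W x = C_sol x.
Proof.
move=> WE x x0; rewrite /Cfun /C_sol -mulrA; congr (_ * _).
pose f (y : R) : R := scale_sol (x - y) * expR (- (mu * y)).
pose F (y : R) : R := - (expR (r1 * (x - y)) - expR (r2 * (x - y))) *
  expR (- (mu * y)) / (c * (r1 - r2)).
have dF (y : R) : is_derive y 1 F (f y).
  pose G (y : R) : R := (c * (r1 - r2))^-1 *
    (expR (r2 * x) * expR (- ((mu + r2) * y)) - expR (r1 * x) * expR (- ((mu + r1) * y))).
  have -> : F = G.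
    apply/funext => z; rewrite /F /G.
    have -> : r1 * (x - z) = r1 * x + - (r1 * z) by ring.
    have -> : r2 * (x - z) = r2 * x + - (r2 * z) by ring.
    have -> : - ((mu + r1) * z) = - (mu * z) - r1 * z by ring.
    have -> : - ((mu + r2) * z) = - (mu * z) - r2 * z by ring.
    by rewrite !expRD; ring.
  apply: derive_eq (derive_Z _ (derive_B (derive_Z _ (is_derive_expRNM _ _))
    (derive_Z _ (is_derive_expRNM _ _)))) _.
  rewrite /f /scale_sol.
  have -> : r1 * (x - y) = r1 * x + - (r1 * y) by ring.
  have -> : r2 * (x - y) = r2 * x + - (r2 * y) by ring.
  have -> : - ((mu + r1) * y) = - (mu * y) - r1 * y by ring.
  have -> : - ((mu + r2) * y) = - (mu * y) - r2 * y by ring.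
  by rewrite !expRD; ring.
transitivity (\int[@lebesgue_measure R]_(y in `[0, x]) f y).
  apply: eq_Rintegral => y; rewrite inE/= in_itv/= => /andP[y0 yx].
  by rewrite /f WE// subr_ge0.
rewrite (Rsegment_FTC x0 _ dF).
  have -> : F x = 0 by rewrite /F subrr !mulr0 subrr oppr0 !mul0r.
  by rewrite /F subr0 mulr0 oppr0 expR0 mulr1 mulNr sub0r opprK.
move=> y; apply: cvgM; last exact: continuous_expRNM.
apply: (@continuous_comp _ _ _ (fun y => x - y) scale_sol).
  by apply: cvgB; [exact: cvg_cst|exact: cvg_id].
exact: continuous_scale_sol.
Qed.

Definition C_sol' (x : R) : R :=
  lam * (r1 * expR (r1 * x) - r2 * expR (r2 * x)) / (c * (r1 - r2)).

Lemma is_derive_C_sol (x : R) : is_derive x 1 C_sol (C_sol' x).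
Proof.
have -> : C_sol = fun x => lam / (c * (r1 - r2)) * (expR (r1 * x) - expR (r2 * x)).
  by apply/funext => y; rewrite /C_sol mulrAC.
apply: derive_eq (derive_Z _ (derive_B (is_derive_expRM _ _) (is_derive_expRM _ _))) _.
by rewrite /C_sol' mulrAC.
Qed.

Lemma C_sol'_gt0 x : 0 < C_sol' x.
Proof.
rewrite /C_sol' divr_gt0 ?mulr_gt0// subr_gt0 (@lt_trans _ _ 0)//.
  by rewrite nmulr_rlt0// expR_gt0.
by rewrite mulr_gt0// expR_gt0.
Qed.

Lemma scale_sol_gt0 x : 0 <= x -> 0 < scale_sol x.
Proof.
move=> x0; rewrite divr_gt0 ?mulr_gt0// subr_gt0.
apply: (@lt_le_trans _ _ ((mu + r1) * expR (r2 * x))).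
  by rewrite ltr_pM2r ?expR_gt0// ltrD2l -subr_gt0.
by rewrite ler_wpM2l ?ler_expR ?addr_ge0 ?(ltW mu0) ?(ltW r10)// ler_wpM2r// -subr_ge0 ltW.
Qed.

Definition gamma_sol (x : R) : R := 1 / C_sol' x.
Definition theta_sol (x : R) : R := scale_sol x / C_sol' x.

Lemma theta_sol_gt0 x : 0 <= x -> 0 < theta_sol x.
Proof. by move=> x0; rewrite divr_gt0 ?C_sol'_gt0 ?scale_sol_gt0. Qed.

Let C_sol'' (x : R) : R :=
  lam * (r1 ^+ 2 * expR (r1 * x) - r2 ^+ 2 * expR (r2 * x)) / (c * (r1 - r2)).

Let is_derive_C_sol' (x : R) : is_derive x 1 C_sol' (C_sol'' x).
Proof.
have -> : C_sol' = fun x => lam / (c * (r1 - r2)) * (r1 * expR (r1 * x) - r2 * expR (r2 * x)).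
  by apply/funext => y; rewrite /C_sol' mulrAC.
apply: derive_eq (derive_Z _ (derive_B (derive_Z _ (is_derive_expRM _ _))
  (derive_Z _ (is_derive_expRM _ _)))) _.
by rewrite /C_sol'' mulrAC !mulrA -!expr2.
Qed.

Lemma is_derive_gamma_sol (x : R) :
  is_derive x 1 gamma_sol (- C_sol'' x / C_sol' x ^+ 2).
Proof.
apply: derive_eq (derive_div (derive_cst 1 x) (is_derive_C_sol' x) _) _.
  by rewrite gt_eqF// C_sol'_gt0.
by rewrite mul0r mul1r sub0r.
Qed.

(** In W' C' - W C'' the squares of the exponentials cancel, and only a
positive multiple of e^((r1 + r2) x) is left. *)
Lemma is_derive_theta_sol (x : R) : exists2 l, 0 < l & is_derive x 1 theta_sol l.
Proof.
pose W' := ((mu + r1) * (r1 * expR (r1 * x)) - (mu + r2) * (r2 * expR (r2 * x)))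
  / (c * (r1 - r2)).
have dW : is_derive x 1 scale_sol W'.
  have -> : scale_sol = fun x => (c * (r1 - r2))^-1 *
      ((mu + r1) * expR (r1 * x) - (mu + r2) * expR (r2 * x)).
    by apply/funext => y; rewrite /scale_sol mulrC.
  apply: derive_eq (derive_Z _ (derive_B (derive_Z _ (is_derive_expRM _ _))
    (derive_Z _ (is_derive_expRM _ _)))) _.
  by rewrite /W' mulrC.
have Cx := C_sol'_gt0 x.
exists ((W' * C_sol' x - scale_sol x * C_sol'' x) / C_sol' x ^+ 2); last first.
  by apply: derive_eq (derive_div dW (is_derive_C_sol' x) _) _; rewrite ?gt_eqF.
rewrite divr_gt0 ?exprn_gt0//.
have -> : W' * C_sol' x - scale_sol x * C_sol'' x =
    lam * mu * expR (r1 * x) * expR (r2 * x) / c ^+ 2.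
  rewrite /W' /C_sol' /C_sol'' /scale_sol; field.
  by rewrite !gt_eqF.
by rewrite divr_gt0 ?exprn_gt0// !mulr_gt0 ?expR_gt0.
Qed.

End root_pair.
End scale_function_roots.

(** * Discounted Stieltjes integrals *)

Section stieltjes_discounting.
Context {R : realType}.
Local Notation leb := (@lebesgue_measure R).

Lemma stieltjes_itv (f : cumulative R R) (s t : R) : s <= t ->
  stieltjes f `]s, t] = (f t - f s)%:E.
Proof.
move=> st; rewrite stieltjesE /lebesgue_stieltjes_measure /measure_extension.
by rewrite measurable_mu_extE/= ?wlength_itv_bnd//; exact: is_ocitv.
Qed.

Lemma cumulative_of (f : R -> R) : {homo f : x y / x <= y} -> right_continuous f ->
  exists g : cumulative R R, g = f :> (R -> R).
Proof.
by move=> nd rc; exists (HB.pack_for (cumulative R R) f (isCumulative.Build R _ R f nd rc)).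
Qed.

(* Tonelli's theorem on the triangle s < u <= x <= t. *)
Let by_parts_cumulative (g : cumulative R R) (q s t : R) : 0 < q -> s <= t ->
  (\int[lebesgue_stieltjes_measure g]_(u in `]s, t]) (expR (- (q * u)))%:E =
   (expR (- (q * t)) * (g t - g s))%:E +
   \int[leb]_(x in `[s, t]) (q * expR (- (q * x)) * (g x - g s))%:E)%E.
Proof.
move=> q0 st.
pose nu : {sigma_finite_measure set (measurableTypeR R) -> \bar R} :=
  lebesgue_stieltjes_measure g.
rewrite -[lebesgue_stieltjes_measure g]/(nu : set (measurableTypeR R) -> \bar R).
pose A : set (measurableTypeR R * measurableTypeR R) :=
  [set p | [&& s < p.1, p.1 <= p.2 & p.2 <= t]].
have mA : measurable A.
  have : measurable_fun [set: measurableTypeR R * measurableTypeR R]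
    (fun p : measurableTypeR R * measurableTypeR R => [&& s < p.1, p.1 <= p.2 & p.2 <= t]).
    by apply: measurable_and; [exact: measurable_fun_ltr|
      apply: measurable_and; exact: measurable_fun_ler].
  by move=> /(_ measurableT [set true]); rewrite setTI; apply.
have AE p : (p \in A) = [&& s < p.1, p.1 <= p.2 & p.2 <= t].
  by apply/idP/idP => [/set_mem|?]; [|apply/mem_set].
pose e (x : R) : R := q * expR (- (q * x)).
have e0 x : 0 <= e x by rewrite mulr_ge0 ?expR_ge0 ?ltW.
have ce : continuous e by move=> x; apply: cvgM; [exact: cvg_cst|exact: continuous_expRNM].
have me (D : set (measurableTypeR R)) : measurable_fun D e.
  by apply: measurable_funTS; exact: continuous_measurable_fun.
pose G (p : measurableTypeR R * measurableTypeR R) : \bar R := (\1_A p * e p.2)%:E.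
have mG : measurable_fun setT G.
  apply/measurable_EFinP; apply: measurable_funM; first exact: measurable_indic.
  exact: (measurableT_comp (me setT)).
have G0 p : (0 <= G p)%E by rewrite lee_fin mulr_ge0// indicE.
have Gu (u : R) : (\int[leb]_x G (u, x) =
    (if s < u <= t then expR (- (q * u)) - expR (- (q * t)) else 0)%:E)%E.
  have [/andP[su ut]|nsut] := boolP (s < u <= t); last first.
    apply: integral0_eq => x _; rewrite /G indicE memNset ?mul0r// /A/=.
    move=> /and3P[su ux xt]; move: nsut; rewrite su/=.
    by rewrite (le_trans ux xt).
  transitivity (\int[leb]_(x in `[u, t]) (e x)%:E)%E.
    rewrite [RHS]integral_mkcond; apply: eq_integral => x _.
    rewrite /G indicE AE patchE mem_setE in_itv/= su/=.
    by case: ifP => _; rewrite ?mul1r ?mul0r.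
  have de (x : R) : is_derive x 1 (fun x => - expR (- (q * x))) (e x).
    by apply: derive_eq (derive_N (is_derive_expRNM q x)) _; rewrite opprK.
  by rewrite (segment_FTC ut ce de) opprK addrC.
have nuE (x : R) : s <= x -> nu `]s, x]%classic = (g x - g s)%:E by exact: stieltjes_itv.
have Gx (x : R) : (\int[nu]_u G (u, x) =
    (if s <= x <= t then q * expR (- (q * x)) * (g x - g s) else 0)%:E)%E.
  have [/andP[sx xt]|nsx] := boolP (s <= x <= t); last first.
    apply: integral0_eq => u _; rewrite /G indicE memNset ?mul0r// /A/=.
    move=> /and3P[su ux xt]; move: nsx; rewrite xt andbT.
    by rewrite (le_trans (ltW su) ux).
  transitivity (\int[nu]_(u in `]s, x]) (e x)%:E)%E.
    rewrite [RHS]integral_mkcond; apply: eq_integral => u _.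
    rewrite /G indicE AE patchE mem_setE in_itv/= xt andbT.
    by case: ifP => _; rewrite ?mul1r ?mul0r.
  by rewrite integral_cst//= nuE.
have FT : (\int[nu]_u \int[leb]_x G (u, x) = \int[leb]_x \int[nu]_u G (u, x))%E.
  exact: (@fubini_tonelli _ _ _ _ _ nu leb G mG G0).
have -> : (\int[leb]_(x in `[s, t]) (q * expR (- (q * x)) * (g x - g s))%:E)%E =
    (\int[leb]_x \int[nu]_u G (u, x))%E.
  rewrite integral_mkcond; apply: eq_integral => x _.
  by rewrite Gx patchE mem_setE in_itv/=; case: ifP.
rewrite -FT.
transitivity (\int[nu]_(u in `]s, t]) ((expR (- (q * t)))%:E +
    \int[leb]_x G (u, x)))%E.
  apply: eq_integral => u; rewrite inE/= in_itv/= => ust.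
  by rewrite Gu ust -EFinD addrC subrK.
have mGx : measurable_fun `]s, t] (fun u => \int[leb]_x G (u, x))%E.
  by apply: measurable_funTS; exact: (@measurable_fun_fubini_tonelli_F _ _ _ _ _ leb G mG G0).
have G0x (u : R) : `]s, t]%classic u -> (0 <= \int[leb]_x G (u, x))%E.
  by move=> _; exact: integral_ge0.
have E0 (u : R) : `]s, t]%classic u -> (0 <= (expR (- (q * t)))%:E)%E.
  by rewrite lee_fin expR_ge0.
rewrite (ge0_integralD nu (measurable_itv _) E0 (measurable_cst _) G0x mGx).
congr (_ + _)%E.
  by rewrite (integral_cst nu (measurable_itv _)) EFinM; congr (_ * _)%E; exact: nuE.
rewrite integral_mkcond; apply: eq_integral => u _.
have uE : (u \in [set` `]s, t]]) = (s < u <= t) by rewrite mem_setE in_itv.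
by rewrite patchE uE; case: ifP => // ust; rewrite Gu ust.
Qed.

(** Integration by parts: e^(-qu) is e^(-qt) plus the integral of q e^(-qx)
over [u, t], and the two integrals can be exchanged. *)
Lemma stieltjes_by_parts (f : R -> R) (q s t : R) : 0 < q -> s <= t ->
  {homo f : x y / x <= y} -> right_continuous f ->
  (\int[stieltjes f]_(u in `]s, t]) (expR (- (q * u)))%:E =
   (expR (- (q * t)) * (f t - f s))%:E +
   \int[leb]_(x in `[s, t]) (q * expR (- (q * x)) * (f x - f s))%:E)%E.
Proof.
move=> q0 st nd rc; have [g <-] := cumulative_of nd rc.
exact: by_parts_cumulative.
Qed.

End stieltjes_discounting.

Section discounted_increments.
Context {R : realType}.
Local Notation leb := (@lebesgue_measure R).
Variables (f : R -> R) (q : R).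
Hypotheses (q0 : 0 < q) (nd : {homo f : x y / x <= y}) (rc : right_continuous f).

Lemma stieltjes_flat (s t : R) : s <= t -> (forall x, s <= x < t -> f x = f s) ->
  (\int[stieltjes f]_(u in `]s, t]) (expR (- (q * u)))%:E =
   (expR (- (q * t)) * (f t - f s))%:E)%E.
Proof.
move=> st fs; rewrite (stieltjes_by_parts q0 st nd rc).
have zero : {in [set` `[s, t[], (fun x => (q * expR (- (q * x)) * (f x - f s))%:E) =1 cst 0%E}.
  by move=> x; rewrite mem_setE in_itv/= => /fs ->; rewrite subrr mulr0.
rewrite -integral_itv_bndo_bndc.
  rewrite (eq_integral (cst 0%E)); first by rewrite integral0 adde0.
  by move=> x xst; exact: zero.
apply: (eq_measurable_fun (cst 0%E)) => [x xst|//].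
by rewrite zero.
Qed.

Lemma stieltjes_affine (c s t : R) : s <= t ->
  (forall x, s <= x <= t -> f x = f s + c * (x - s)) ->
  (\int[stieltjes f]_(u in `]s, t]) (expR (- (q * u)))%:E =
   (c / q * (expR (- (q * s)) - expR (- (q * t))))%:E)%E.
Proof.
move=> st fs; rewrite (stieltjes_by_parts q0 st nd rc).
have fE (x : R) : s <= x <= t -> f x - f s = c * (x - s).
  by move=> /fs ->; rewrite addrC addKr.
pose e (x : R) : R := q * expR (- (q * x)) * (c * (x - s)).
pose E (x : R) : R := (- expR (- (q * x))) * (c * (x - s) + c / q).
have dE (x : R) : is_derive x 1 E (e x).
  apply: derive_eq (derive_M (derive_N (is_derive_expRNM q x))
    (derive_D (derive_Z c (derive_B (derive_id1 x) (derive_cst s x))) (derive_cst (c / q) x))) _.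
  by rewrite /e; field; rewrite gt_eqF.
have ce : continuous e.
  move=> x; apply: cvgM.
    by apply: cvgM; [exact: cvg_cst|exact: continuous_expRNM].
  by apply: cvgM; [exact: cvg_cst|apply: cvgB; [exact: cvg_id|exact: cvg_cst]].
have -> : (\int[leb]_(x in `[s, t]) (q * expR (- (q * x)) * (f x - f s))%:E =
    \int[leb]_(x in `[s, t]) (e x)%:E)%E.
  by apply: eq_integral => x; rewrite mem_setE in_itv/= => /fE ->.
rewrite (segment_FTC st ce dE) -EFinD; congr EFin.
rewrite fE ?st ?lexx// /E subrr mulr0 add0r; field.
by rewrite gt_eqF.
Qed.

Lemma stieltjes_integral_bigcup (F : (set (measurableTypeR R))^nat) :
  (forall n, measurable (F n)) -> trivIset setT F ->
  (\int[stieltjes f]_(u in \bigcup_n F n) (expR (- (q * u)))%:E =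
   \sum_(n <oo) \int[stieltjes f]_(u in F n) (expR (- (q * u)))%:E)%E.
Proof.
move=> mF tF; have [g gf] := cumulative_of nd rc.
rewrite -gf stieltjesE; apply: ge0_integral_bigcup => //.
by apply/measurable_EFinP; exact: measurable_expRNM.
Qed.

Lemma stieltjes_integral_split (s m t : R) : s <= m -> m <= t ->
  (\int[stieltjes f]_(u in `]s, t]) (expR (- (q * u)))%:E =
   \int[stieltjes f]_(u in `]s, m]) (expR (- (q * u)))%:E +
   \int[stieltjes f]_(u in `]m, t]) (expR (- (q * u)))%:E)%E.
Proof.
move=> sm mt; have [g gf] := cumulative_of nd rc.
have U : `]s, t]%classic = `]s, m]%classic `|` `]m, t]%classic :> set R.
  by rewrite -itv_bndbnd_setU ?bnd_simp.
rewrite -gf stieltjesE U; apply: ge0_integral_setU => //.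
- by apply/measurable_EFinP; exact: measurable_expRNM.
- apply/disj_setPS => x [] /=; rewrite !in_itv/= => /andP[_ xm] /andP[mx _].
  by move: (le_lt_trans xm mx); rewrite ltxx.
Qed.

End discounted_increments.

(** * The payoff of a path as a series of rewards *)

Section period_reward.
Context {R : realType}.
Variables (c q k pen a b : R).

(** With reserve r at the start of a gap of length t, the barrier is reached
after (b - r) / c, if at all, and dividends then flow at rate c; their value is
discounted to the start of the gap. *)
Definition period_dividends (r t : R) : R :=
  c / q * (expR (- (q * ((b - r) / c))) - expR (- (q * Num.max ((b - r) / c) t))).

Definition period_level (r t x : R) : R := Num.min b (r + c * t) - x.

Definition period_reward (r t x : R) : R :=
  period_dividends r t - expR (- (q * t)) *
  (if period_level r t x < - a then pen else k * Num.max 0 (- period_level r t x)).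

End period_reward.

Section clamped_functions.
Context {R : realType}.

Lemma continuous_max0 (f : R -> R) : continuous f ->
  continuous (fun x => Num.max 0 (f x)).
Proof. by move=> cf x; apply: (@continuous_max R R (cst 0) f x _ (cf x)); exact: cst_continuous. Qed.

Lemma continuous_minr (f : R -> R) (r : R) : continuous f ->
  continuous (fun x => Num.min (f x) r).
Proof. by move=> cf x; apply: (@continuous_min R R f (cst r) x (cf x)); exact: cst_continuous. Qed.

End clamped_functions.

(* Dividends and injections are, on bounded intervals, finite sums of one
   term per claim; regularity is then checked term by term. *)

Section locally_finite_sums.
Context {R : realType}.
Variables (f : R -> R) (S : nat -> R) (g : nat -> R -> R).
Hypotheses (Sy : forall t, exists m, t < S m)
  (fE : forall m t, t < S m -> f t = \sum_(i < m) g i t).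

Lemma locally_finite_sum_homo : (forall i, {homo g i : x y / x <= y}) ->
  {homo f : x y / x <= y}.
Proof.
move=> gi x y xy; have [m ym] := Sy y.
by rewrite (fE ym) (fE (le_lt_trans xy ym)); apply: ler_sum => i _; exact: gi.
Qed.

Lemma locally_finite_sum_right_continuous : (forall i, right_continuous (g i)) ->
  right_continuous f.
Proof.
move=> gi x; have [m xm] := Sy x.
rewrite (fE xm).
apply: (@cvg_trans _ ((fun t => \sum_(i < m) g i t) @ x^'+)).
  apply: near_eq_cvg; near=> t; apply/esym/fE.
  by near: t; exact: nbhs_right_lt.
elim: m {xm} => [|m IH].
  rewrite big_ord0 (_ : (fun t => \sum_(i < 0) g i t) = cst 0); first exact: cvg_cst.
  by apply/funext => t; rewrite big_ord0.
rewrite big_ord_recr/= (_ : (fun t => \sum_(i < m.+1) g i t) =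
  (fun t => \sum_(i < m) g i t + g m t)); last first.
  by apply/funext => t; rewrite big_ord_recr.
by apply: cvgD; [exact: IH|exact: gi].
Unshelve. all: by end_near. Qed.

End locally_finite_sums.

Section path.
Context {d : measure_display} {T : measurableType d} {R : realType}.
Context {Pr : probability T R}.
Variables (tau xi : nat -> {RV Pr >-> R}) (N : R -> T -> nat).
Variables (c q k pen a b : R) (w : T).
Hypotheses (c0 : 0 < c) (q0 : 0 < q) (a0 : 0 <= a) (b0 : 0 <= b).
Hypothesis gap0 : forall n, 0 < tau n w.
Hypothesis NE : forall t n, 0 <= t -> (n <= N t w)%N = (arrival tau n w <= t).
Hypothesis claim0 : forall n, 0 <= xi n w.

Local Notation S n := (arrival tau n w).
Local Notation ov := (overflow c tau xi b).
Local Notation level n := (level_at_claim c tau xi b n w).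
Local Notation bank n := (bankrupting c tau xi a b n w).
Local Notation r n := (reserve_after c tau xi b n w).

Lemma arrivalS n : S n.+1 = S n + tau n w.
Proof. by rewrite /arrival big_ord_recr. Qed.

Lemma arrival0 : S 0%N = 0.
Proof. by rewrite /arrival big_ord0. Qed.

Lemma arrival_le m n : (m <= n)%N -> S m <= S n.
Proof.
elim: n => [|n IH]; first by rewrite leqn0 => /eqP ->.
rewrite leq_eqVlt => /predU1P[->//|/IH mn].
by rewrite arrivalS (le_trans mn)// lerDl ltW.
Qed.

Lemma arrival_lt m n : (m < n)%N -> S m < S n.
Proof. by move=> /arrival_le; apply: lt_le_trans; rewrite arrivalS ltrDl. Qed.

Lemma arrival_ge0 n : 0 <= S n.
Proof. by rewrite -arrival0; exact: arrival_le. Qed.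

Lemma arrival_unbounded t : exists m, t < S m.
Proof.
have [t0|t0] := ltP t 0; first by exists 0%N; rewrite arrival0.
by exists (N t w).+1; rewrite ltNge -NE// ltnn.
Qed.

Lemma reserve_after_itv n : 0 <= r n <= b.
Proof.
case: n => [|n]; first by rewrite lexx.
rewrite /= le_max lexx/= ge_max b0/=.
by rewrite lerBlDr ge_min lerDl claim0.
Qed.

(* The time elapsed at date t within the n-th gap, between 0 and its length. *)
Let clamp n (t : R) : R := Num.max 0 (Num.min (t - S n) (tau n w)).

Let overflow0 n : ov n 0 w = 0.
Proof.
rewrite /overflow mulr0 addr0; apply/max_idPl; rewrite subr_le0.
by have /andP[] := reserve_after_itv n.
Qed.

Let sum_around n m (g : nat -> R) : (n < m)%N ->
  (forall i, (n < i)%N -> g i = 0) ->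
  \sum_(i < m) g i = \sum_(i < n) g i + g n.
Proof.
move=> nm g0; rewrite -!(big_mkord xpredT g) (big_cat_nat (leq0n n) (ltnW nm))/=.
congr (_ + _); rewrite big_ltn//= big_nat big1 ?addr0// => i /andP[ni _]; exact: g0.
Qed.

Lemma dividends_locally m t : t < S m ->
  dividends c tau xi N b w t = \sum_(i < m) ov i (clamp i t) w.
Proof.
move=> tm; rewrite /dividends; have [t0|t0] := ltP t 0.
  rewrite big1// => i _; rewrite (_ : clamp i t = 0) ?overflow0//.
  apply/max_idPl; rewrite ge_min subr_le0.
  by rewrite (le_trans (ltW t0))// arrival_ge0.
have nm : (N t w < m)%N by rewrite ltnNge NE// -ltNge.
rewrite (sum_around (g := fun i => ov i (clamp i t) w) nm) => [|i Ni]; last first.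
  rewrite (_ : clamp i t = 0) ?overflow0//.
  apply/max_idPl; rewrite ge_min subr_le0 ltW//.
  by rewrite ltNge -NE// -ltnNge.
congr (_ + _).
  apply: eq_bigr => i _; congr (ov _ _ _); rewrite /clamp.
  have : S i.+1 <= t by rewrite -NE.
  by rewrite arrivalS -lerBrDl => /min_idPr ->; rewrite (max_idPr (ltW _)).
congr (ov _ _ _); rewrite /clamp.
have SN : S (N t w) <= t by rewrite -NE.
have NS : t < S (N t w).+1 by rewrite ltNge -NE// ltnn.
rewrite (min_idPl _); last by rewrite lerBlDl -arrivalS ltW.
by rewrite (max_idPr _)// subr_ge0.
Qed.

Lemma injections_locally m t : t < S m ->
  injections c tau xi N a b w t =
  \sum_(i < m) (if (S i.+1 <= t) && ~~ bank i then Num.max 0 (- level i) else 0).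
Proof.
move=> tm; rewrite /injections; have [t0|t0] := ltP t 0.
  rewrite big1// => i _; rewrite ifF// leNgt (lt_le_trans t0)//.
  exact: arrival_ge0.
have nm : (N t w < m)%N by rewrite ltnNge NE// -ltNge.
pose g i := if (S i.+1 <= t) && ~~ bank i then Num.max 0 (- level i) else 0.
rewrite (sum_around (g := g) nm) /g; last first.
  by move=> i Ni; rewrite -NE// ltnNge (ltnW Ni).
rewrite -NE// ltnn addr0 big_mkcond/=; apply: eq_bigr => i _.
by rewrite -NE// ltn_ord/=.
Qed.

Lemma dividends_homo : {homo dividends c tau xi N b w : x y / x <= y}.
Proof.
apply: (locally_finite_sum_homo (g := fun i t => ov i (clamp i t) w)
  arrival_unbounded dividends_locally) => i x y xy.
have le_clamp : clamp i x <= clamp i y.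
  rewrite /clamp ge_max !le_max lexx/=; apply/orP; right.
  by rewrite le_min !ge_min lexx orbT andbT lerD2r xy.
rewrite /overflow ge_max !le_max lexx/=; apply/orP; right.
by rewrite lerD2r lerD2l ler_wpM2l// ltW.
Qed.

Lemma dividends_right_continuous : right_continuous (dividends c tau xi N b w).
Proof.
apply: (locally_finite_sum_right_continuous (g := fun i t => ov i (clamp i t) w)
  arrival_unbounded dividends_locally) => i.
apply: right_continuousW; rewrite /overflow /clamp.
apply: continuous_max0 => x; apply: cvgB; last exact: cvg_cst.
apply: cvgD; first exact: cvg_cst.
apply: cvgM; first exact: cvg_cst.
apply: continuous_max0 x; apply: continuous_minr => x.
by apply: cvgB; [exact: cvg_id|exact: cvg_cst].
Qed.

Lemma injections_homo : {homo injections c tau xi N a b w : x y / x <= y}.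
Proof.
apply: (locally_finite_sum_homo (g := fun i t =>
  if (S i.+1 <= t) && ~~ bank i then Num.max 0 (- level i) else 0)
  arrival_unbounded injections_locally) => i x y xy.
case: (boolP (bank i)) => _; rewrite ?andbF ?andbT//.
case: ifPn => [Sx|_]; first by rewrite (le_trans Sx).
by case: ifP => // _; rewrite le_max lexx.
Qed.

Lemma injections_right_continuous : right_continuous (injections c tau xi N a b w).
Proof.
apply: (locally_finite_sum_right_continuous (g := fun i t =>
  if (S i.+1 <= t) && ~~ bank i then Num.max 0 (- level i) else 0)
  arrival_unbounded injections_locally) => i x.
apply: cvg_near_cst; have [Sx|xS] := leP (S i.+1) x.
  near=> t; rewrite (_ : S i.+1 <= t)//.
  by apply: (le_trans Sx); near: t; exact: nbhs_right_ge.
near=> t; rewrite (_ : S i.+1 <= t = false)//.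
by apply/negbTE; rewrite -ltNge; near: t; exact: nbhs_right_lt.
Unshelve. all: by end_near. Qed.

(* Within one gap only the term of that gap moves; the cutoff at the claim
   after the next covers the right end of the gap. *)
Let dividends_period n x : S n <= x <= S n.+1 ->
  dividends c tau xi N b w x =
  dividends c tau xi N b w (S n) + ov n (x - S n) w.
Proof.
move=> /andP[Sx xS].
have xS2 : x < S n.+2 by rewrite (le_lt_trans xS)// arrival_lt.
rewrite (dividends_locally xS2) (dividends_locally (le_lt_trans Sx xS2)).
rewrite !big_ord_recr/=.
have clamp_lt i y : (i < n)%N -> S n <= y -> clamp i y = tau i w.
  move=> iN Sy; rewrite /clamp (min_idPr _); last first.
    by rewrite lerBrDl -arrivalS (le_trans _ Sy)// arrival_le.
  by apply/max_idPr/ltW.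
have clamp_gt i y : y <= S i -> clamp i y = 0.
  by move=> yS; apply/max_idPl; rewrite ge_min subr_le0 yS.
rewrite (clamp_gt n.+1 x)// (clamp_gt n.+1 (S n)) ?arrival_le// (clamp_gt n (S n))//.
rewrite !overflow0 !addr0.
have -> : clamp n x = x - S n.
  rewrite /clamp (min_idPl _) ?lerBlDl -?arrivalS//.
  by apply/max_idPr; rewrite subr_ge0.
by congr (_ + _); apply: eq_bigr => i _; rewrite !clamp_lt.
Qed.

Let injections_period n x : S n <= x <= S n.+1 ->
  injections c tau xi N a b w x =
  injections c tau xi N a b w (S n) +
  (if (x == S n.+1) && ~~ bank n then Num.max 0 (- level n) else 0).
Proof.
move=> /andP[Sx xS].
have xS2 : x < S n.+2 by rewrite (le_lt_trans xS)// arrival_lt.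
rewrite (injections_locally xS2) (injections_locally (le_lt_trans Sx xS2)).
rewrite !big_ord_recr/=.
have S2N y : y < S n.+2 -> (S n.+2 <= y) = false by move=> h; rewrite leNgt h.
have S1N : (S n.+1 <= S n) = false by rewrite leNgt arrival_lt.
rewrite !S2N// ?arrival_lt ?ltnS ?leqW// S1N/= !addr0.
congr (_ + _); last by rewrite (eq_le x) xS.
apply: eq_bigr => i _; have Si : S i.+1 <= S n by exact: arrival_le.
by rewrite Si (le_trans Si Sx).
Qed.

(** Dividends are flat until the barrier is reached and grow at rate c
afterwards; if the gap is too short they are flat throughout. *)
Lemma period_dividends_integral n :
  (\int[stieltjes (dividends c tau xi N b w)]_(u in `]S n, S n.+1])
      (expR (- (q * u)))%:E =
   (expR (- (q * S n)) * period_dividends c q b (r n) (tau n w))%:E)%E.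
Proof.
set D := dividends c tau xi N b w.
have hD := dividends_homo; have rD := dividends_right_continuous.
have /andP[rn0 rnb] := reserve_after_itv n.
pose u0 := (b - r n) / c.
have u00 : 0 <= u0 by rewrite divr_ge0 ?subr_ge0// ltW.
have flat x : S n <= x -> x <= S n + u0 -> x <= S n.+1 -> D x = D (S n).
  move=> Sx xu xS; rewrite /D (@dividends_period n) ?Sx//.
  rewrite (_ : ov _ _ _ = 0) ?addr0//; apply/max_idPl.
  rewrite subr_le0 -lerBrDl mulrC -ler_pdivlMr// -/u0.
  by rewrite lerBlDl.
have SS : S n <= S n.+1 by exact: arrival_le.
rewrite /period_dividends -/u0; have [tu|ut] := leP (tau n w) u0.
  rewrite (stieltjes_flat q0 hD rD) => //; last first.
    move=> x /andP[Sx /ltW xS]; rewrite -/D; apply: flat => //.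
    by rewrite (le_trans xS)// arrivalS lerD2l.
  rewrite -/D (flat (S n.+1)) ?subrr ?mulr0 ?mul0r//.
  by rewrite arrivalS lerD2l.
have mS : S n + u0 <= S n.+1 by rewrite arrivalS lerD2l ltW.
have Sm : S n <= S n + u0 by rewrite lerDl.
rewrite (stieltjes_integral_split q hD rD Sm mS).
rewrite (stieltjes_flat q0 hD rD) => //; last first.
  by move=> x /andP[Sx /ltW xS]; rewrite -/D; apply: flat => //; rewrite (le_trans xS).
rewrite -/D (flat (S n + u0))// subrr mulr0 add0e.
rewrite (stieltjes_affine q0 hD rD mS (c := c)) => [|x /andP[ux xS]].
  rewrite arrivalS !(mulrDr q) !opprD !expRD; congr (_%:E).
  by ring.
rewrite -/D (flat (S n + u0))// /D (@dividends_period n) ?xS ?(le_trans Sm)//.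
congr (_ + _); rewrite /overflow (max_idPr _).
  by rewrite /u0; field; rewrite gt_eqF.
rewrite subr_ge0 -lerBlDl mulrC -ler_pdivrMr// -/u0.
by rewrite lerBrDl.
Qed.

Lemma period_injections_integral n :
  (\int[stieltjes (injections c tau xi N a b w)]_(u in `]S n, S n.+1])
      (expR (- (q * u)))%:E =
   (expR (- (q * S n.+1)) * (if bank n then 0 else Num.max 0 (- level n)))%:E)%E.
Proof.
have SS : S n <= S n.+1 by exact: arrival_le.
rewrite (stieltjes_flat q0 injections_homo injections_right_continuous) => //.
  rewrite (@injections_period n) ?SS ?lexx// eqxx/= addrC addKr.
  by case: (bank n).
move=> x /andP[Sx xS]; rewrite (@injections_period n) ?Sx ?ltW//.
by rewrite (lt_eqF xS)/= addr0.
Qed.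

Fixpoint alive n := if n is m.+1 then alive m && ~~ bank m else true.

Lemma aliveP n : reflect (forall i, (i < n)%N -> ~~ bank i) (alive n).
Proof.
elim: n => [|n IH] /=; first exact: ReflectT.
apply: (iffP andP) => [[/IH al bn] i|al]; last first.
  by split; [apply/IH => i iN; apply: al; rewrite ltnW|exact: al].
by rewrite ltnS leq_eqVlt => /predU1P[->//|]; exact: al.
Qed.

Let T_ := bankruptcy_time c tau xi a b w.

Lemma bankruptcy_time_le n : bank n -> (T_ <= (S n.+1)%:E)%E.
Proof. by move=> bn; apply: ereal_inf_lbound; exists n. Qed.

Lemma bankruptcy_time_ge n : alive n -> ((S n.+1)%:E <= T_)%E.
Proof.
move=> /aliveP al; apply: le_ereal_inf_tmp => _ [m bm <-].
by rewrite lee_fin arrival_le// ltnS leqNgt; apply/negP => /al; rewrite bm.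
Qed.

Let dates := [set t : R | 0 < t /\ (t%:E <= T_)%E].
Let alive_period n : set R := if alive n then `]S n, S n.+1]%classic else set0.

Lemma period_of (t : R) : 0 < t -> exists n, S n < t <= S n.+1.
Proof.
move=> t0; have [m tm] := arrival_unbounded t.
have ex : exists m, t <= S m by exists m; exact: ltW.
case: (ex_minnP ex) => -[|n] tn minn; first by move: tn; rewrite arrival0 leNgt t0.
exists n; rewrite tn andbT ltNge; apply/negP => /minn.
by rewrite ltnn.
Qed.

(** Dates up to bankruptcy, the bankruptcy date included, are those of the
gaps that start before bankruptcy. *)
Lemma dates_bigcup : dates = \bigcup_n alive_period n.
Proof.
apply/seteqP; split => [t [t0 tT]|t [n _]].
  have [n /andP[Sn tS]] := period_of t0.
  exists n => //; rewrite /alive_period ifT; first by rewrite /= in_itv/= Sn.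
  apply/aliveP => i iN; apply/negP => /bankruptcy_time_le TS.
  have := le_trans tT TS; rewrite lee_fin leNgt => /negP; apply.
  by rewrite (le_lt_trans _ Sn)// arrival_le.
rewrite /alive_period; case: ifPn => // al; rewrite /= in_itv/= => /andP[St tS].
split; first exact: (le_lt_trans (arrival_ge0 n)).
by apply: le_trans (bankruptcy_time_ge al); rewrite lee_fin.
Qed.

Lemma measurable_alive_period n : measurable (alive_period n : set (measurableTypeR R)).
Proof. by rewrite /alive_period; case: ifP. Qed.

Lemma trivIset_alive_period : trivIset setT alive_period.
Proof.
apply: ltn_trivIset => m n mn; apply/seteqP; split => // t [].
rewrite /alive_period; case: ifP => // _; case: ifP => // _.
rewrite /= !in_itv/= => /andP[_ tS] /andP[Sm _].
have : t < t by rewrite (le_lt_trans tS)// (le_lt_trans _ Sm)// arrival_le.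
by rewrite ltxx.
Qed.

(** The discount factor at the n-th claim, set to 0 from bankruptcy on; with
it the payoff becomes a series over all claims. *)
Definition weight n : R := expR (- (q * S n)) * (alive n)%:R.

Definition discounted_reward n : R :=
  weight n * period_reward c q k pen a b (r n) (tau n w) (xi n w).

(* The three parts of a reward: dividends, injections, penalty. *)
Let div n : R := weight n * period_dividends c q b (r n) (tau n w).
Let inj n : R := expR (- (q * S n.+1)) *
  (if alive n.+1 then Num.max 0 (- level n) else 0).
Let ruin n : R := expR (- (q * S n.+1)) * (alive n && bank n)%:R.

Let discounted_rewardE n : discounted_reward n = div n - k * inj n - pen * ruin n.
Proof.
rewrite /discounted_reward /div /inj /ruin /period_reward /weight.
rewrite -/(period_level c b (r n) (tau n w) (xi n w)).
have -> : period_level c b (r n) (tau n w) (xi n w) = level n by [].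
have -> : expR (- (q * S n.+1)) = expR (- (q * S n)) * expR (- (q * tau n w)).
  by rewrite arrivalS mulrDr opprD expRD.
rewrite -/(bank n) /=.
by case: (alive n); case: (bank n) => /=; ring.
Qed.

Let integral_dates (f : R -> R) (z : nat -> R) :
  {homo f : x y / x <= y} -> right_continuous f ->
  (forall n, \int[stieltjes f]_(u in `]S n, S n.+1]) (expR (- (q * u)))%:E = (z n)%:E)%E ->
  (\int[stieltjes f]_(u in dates) (expR (- (q * u)))%:E =
   \sum_(n <oo) ((alive n)%:R * z n)%:E)%E.
Proof.
move=> hf rf fz; rewrite dates_bigcup stieltjes_integral_bigcup//.
- apply: eq_eseriesr => n _; rewrite /alive_period.
  case: (alive n) => /=; first by rewrite fz mul1r.
  by have [g <-] := cumulative_of hf rf; rewrite stieltjesE integral_set0 mul0r.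
- exact: measurable_alive_period.
- exact: trivIset_alive_period.
Qed.

Let dividends_integral :
  (\int[stieltjes (dividends c tau xi N b w)]_(u in dates) (expR (- (q * u)))%:E =
   \sum_(n <oo) (div n)%:E)%E.
Proof.
rewrite (integral_dates dividends_homo dividends_right_continuous period_dividends_integral).
by apply: eq_eseriesr => n _; rewrite /div /weight mulrA [_ * expR _]mulrC.
Qed.

Let injections_integral :
  (\int[stieltjes (injections c tau xi N a b w)]_(u in dates) (expR (- (q * u)))%:E =
   \sum_(n <oo) (inj n)%:E)%E.
Proof.
rewrite (integral_dates injections_homo injections_right_continuous period_injections_integral).
apply: eq_eseriesr => n _; rewrite /inj /=.
by case: (alive n); case: (bank n); rewrite /= ?mul1r ?mul0r ?mulr0.
Qed.

(* At most one term of the series is not 0, that of the claim causing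
   bankruptcy. *)
Let cvg_ruin : \sum_(n < m) ruin n @[m --> \oo] --> discount q T_.
Proof.
have [[n bn]|nb] := pselect (exists n, bank n); last first.
  have nbank n : bank n = false by apply/negP => bn; apply: nb; exists n.
  have -> : T_ = +oo%E.
    by apply/ereal_inf_pinfty => t [n bn]; exfalso; apply: nb; exists n.
  apply: cvg_near_cst; apply: nearW => m; apply: big1 => n _.
  by rewrite /ruin nbank andbF mulr0.
have ex : exists n, bank n by exists n.
case: (ex_minnP ex) => {bn}n0 bn0 minn.
have al : alive n0.
  by apply/aliveP => i iN; apply/negP => /minn; rewrite leqNgt iN.
have -> : T_ = (S n0.+1)%:E.
  by apply/eqP; rewrite eq_le bankruptcy_time_le// bankruptcy_time_ge.
apply: cvg_near_cst; exists n0.+1 => // m /= nm.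
rewrite (sum_around (g := ruin) nm) => [|i ni].
  rewrite big1 ?add0r => [|i _]; first by rewrite /ruin al bn0 mulr1.
  rewrite /ruin; case: (boolP (bank i)) => [/minn|]; last by rewrite andbF mulr0.
  by rewrite leqNgt ltn_ord.
rewrite /ruin (_ : alive i = false) ?mulr0//.
by apply/negbTE/negP => /aliveP /(_ _ ni); rewrite bn0.
Qed.

(* Holds on almost every path; it makes the series of dividends and of
   injections finite, so that they can be subtracted. *)
Hypothesis finS : (\sum_(n <oo) (expR (- (q * S n)))%:E < +oo)%E.

Let weight_le n : 0 <= weight n <= expR (- (q * S n)).
Proof.
rewrite /weight; case: (alive n); rewrite ?mulr1 ?mulr0 ?expR_ge0 ?lexx//.
Qed.

Let finite_series (z : nat -> R) (M : R) :
  (forall n, 0 <= z n <= M * expR (- (q * S n))) -> 0 <= M ->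
  (\sum_(n <oo) (z n)%:E)%E \is a fin_num /\
  (fun m => (\sum_(n < m) z n)%:E) @ \oo --> (\sum_(n <oo) (z n)%:E)%E.
Proof.
move=> zM M0; have z0 n : (0 <= (z n)%:E)%E by rewrite lee_fin; case/andP: (zM n).
split.
  rewrite ge0_fin_numE; last exact: nneseries_ge0.
  apply: (@le_lt_trans _ _ (\sum_(n <oo) M%:E * (expR (- (q * S n)))%:E)%E).
    apply: lee_nneseries => // n _; rewrite -EFinM lee_fin.
    by case/andP: (zM n).
  by rewrite nneseriesZl// lte_mul_pinfty.
have := @is_cvg_ereal_nneg_natsum R (fun n => (z n)%:E) 0 (fun n _ => z0 n).
apply: cvg_trans; apply: near_eq_cvg; apply: nearW => m.
by rewrite big_mkord sumEFin.
Qed.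

Lemma period_dividends_itv (rr t : R) : 0 <= rr <= b -> 0 <= t ->
  0 <= period_dividends c q b rr t <= c / q.
Proof.
move=> /andP[rr0 rb] t0; rewrite /period_dividends.
have cq : 0 < c / q by rewrite divr_gt0.
have u00 : 0 <= (b - rr) / c by rewrite divr_ge0 ?subr_ge0// ltW.
rewrite pmulr_rge0// subr_ge0 ler_expR lerN2 ler_wpM2l ?(ltW q0) ?le_max ?lexx//=.
rewrite ger_pMr// lerBlDr (@le_trans _ _ 1)// ?lerDl ?expR_ge0//.
by rewrite expR_le1 oppr_le0 mulr_ge0// ltW.
Qed.

Theorem cvg_payoff :
  (\sum_(n < m) discounted_reward n)%:E @[m --> \oo] -->
  payoff c tau xi N q k pen a b w.
Proof.
have wle := weight_le.
have [fd cd] : (\sum_(n <oo) (div n)%:E)%E \is a fin_num /\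
    (fun m => (\sum_(n < m) div n)%:E) @ \oo --> (\sum_(n <oo) (div n)%:E)%E.
  apply: (@finite_series _ (c / q)); last by rewrite divr_ge0 ?ltW.
  move=> n; have /andP[p0 p1] := period_dividends_itv (reserve_after_itv n) (ltW (gap0 n)).
  have /andP[w0 w1] := wle n.
  by rewrite /div mulr_ge0//= [leRHS]mulrC ler_pM.
have [fi ci] : (\sum_(n <oo) (inj n)%:E)%E \is a fin_num /\
    (fun m => (\sum_(n < m) inj n)%:E) @ \oo --> (\sum_(n <oo) (inj n)%:E)%E.
  apply: (@finite_series _ a) => // n; rewrite /inj mulr_ge0 ?expR_ge0//=; last first.
    by case: ifP => // _; rewrite le_max lexx.
  rewrite [leRHS]mulrC ler_pM ?expR_ge0//.
  - by case: ifP => // _; rewrite le_max lexx.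
  - by rewrite ler_expR lerN2 ler_wpM2l ?(ltW q0)// arrival_le.
  - case: ifP => // /andP[_]; rewrite /bankrupting -leNgt => la.
    by rewrite ge_max a0 lerNl.
rewrite /payoff -/T_ -/dates.
rewrite (_ : (fun t => _) = (fun t : R => (expR (- (q * t)))%:E))//.
rewrite dividends_integral injections_integral.
rewrite (_ : (fun m => _) = (fun m => (\sum_(n < m) div n)%:E - k%:E * (\sum_(n < m) inj n)%:E
  - (pen * \sum_(n < m) ruin n)%:E)%E); last first.
  apply/funext => m; rewrite -EFinM -!EFinB; congr EFin.
  rewrite !mulr_sumr -!sumrB; apply: eq_bigr => n _.
  by rewrite discounted_rewardE.
rewrite -(fineK fd) -(fineK fi).
apply: cvgeB => //.
  apply: cvgeB => //; first by rewrite fineK.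
  by apply: cvgeZl => //; rewrite fineK.
by apply: cvg_EFin; [exact: nearW|apply: cvgM; [exact: cvg_cst|exact: cvg_ruin]].
Qed.

End path.

(** * Independence of past and future *)

Lemma bounded_integrable d (T : measurableType d) (R : realType)
    (nu : {measure set T -> \bar R}) (f : T -> R) (K : R) : (nu setT < +oo)%E ->
  measurable_fun setT f -> (forall x, `|f x| <= K) -> nu.-integrable setT (EFin \o f).
Proof.
move=> nuoo mf fK; have K0 : 0 <= K by rewrite (le_trans _ (fK point)).
apply: (@le_integrable _ _ _ _ _ measurableT _ (cst K%:E)).
- exact/measurable_EFinP.
- by move=> x _; rewrite /= lee_fin (ger0_norm K0).
- apply/integrableP; split => //.
  under eq_integral do rewrite /= (ger0_norm K0).
  by rewrite integral_cst//= lte_mul_pinfty.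
Qed.

Lemma bounded_integrable_prob d (T : measurableType d) (R : realType)
    (P : probability T R) (f : T -> R) (K : R) :
  measurable_fun setT f -> (forall x, `|f x| <= K) -> P.-integrable setT (EFin \o f).
Proof.
by move=> mf fK; apply: bounded_integrable mf fK => /=; rewrite (@probability_setT _ _ _ P) ltry.
Qed.

Section fresh_variables.
Context {d : measure_display} {T : measurableType d} {R : realType}.
Variable Pr : probability T R.
Variables (I : eqType) (Y : I -> {RV Pr >-> R}).
Hypothesis indepY : mutually_independent Pr (fun i => Y i : T -> R).

Local Notation event s B := (\bigcap_(i in [set` s]) (Y i @^-1` B i)).

(** Z is independent of the family of the Y i with J i.  A finite conjunction
of events of that family is the form in which mutual independence is used. *)
Definition independent_of (J : pred I) d' (X : measurableType d') (Z : T -> X) : Prop :=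
  measurable_fun setT Z /\
  forall (A : set X) (s : seq I) (B : I -> set R), measurable A -> uniq s -> all J s ->
    (forall i, measurable (B i)) ->
    (Pr (Z @^-1` A `&` event s B) =
     Pr (Z @^-1` A) * \prod_(i <- s) Pr (Y i @^-1` B i))%E.

Let measurable_preY i (B : set R) : measurable B -> measurable (Y i @^-1` B).
Proof. by move=> mB; rewrite -[_ @^-1` _]setTI; exact: measurable_funP. Qed.

Let event_cons j (s : seq I) (B : I -> set R) : event (j :: s) B = Y j @^-1` B j `&` event s B.
Proof.
apply/seteqP; split=> [x ex|x [xj ex] i /=].
  by split=> [|i /= si]; apply: ex; rewrite /= in_cons ?eqxx// si orbT.
by rewrite in_cons => /predU1P[->//|]; exact: ex.
Qed.

Let measurable_event (s : seq I) (B : I -> set R) : (forall i, measurable (B i)) -> measurable (event s B).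
Proof.
move=> mB; elim: s => [|j s IH].
  by rewrite (_ : event _ _ = setT)//; apply/seteqP; split.
by rewrite event_cons; apply: measurableI => //; exact: measurable_preY.
Qed.

Lemma independent_cst (J : pred I) d' (X : measurableType d') (x : X) :
  independent_of J (fun=> x).
Proof.
split; first exact: measurable_cst.
move=> A s B mA us Js mB.
have [xA|xA] := pselect (A x).
  rewrite (_ : (fun=> x) @^-1` A = setT); last by apply/seteqP; split.
  by rewrite setTI probability_setT mul1e indepY.
rewrite (_ : (fun=> x) @^-1` A = set0); last by apply/seteqP; split.
by rewrite set0I measure0 mul0e.
Qed.

Lemma independent_comp (J : pred I) d' (X : measurableType d') d'' (X' : measurableType d'')
    (Z : T -> X) (f : X -> X') : measurable_fun setT f ->
  independent_of J Z -> independent_of J (f \o Z).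
Proof.
move=> mf [mZ iZ]; split; first exact: measurableT_comp.
move=> A s B mA us Js mB; rewrite comp_preimage; apply: iZ => //.
by rewrite -[_ @^-1` _]setTI; exact: mf.
Qed.

Lemma independent_sub (J J' : pred I) d' (X : measurableType d') (Z : T -> X) :
  {subset J' <= J} -> independent_of J Z -> independent_of J' Z.
Proof.
move=> JJ [mZ iZ]; split=> // A s B mA us Js mB; apply: iZ => //.
by apply: sub_all Js; exact: JJ.
Qed.

(* One variable Y j of the family is moved to the side of Z. *)

Section adjoin.
Context d' (X : measurableType d').
Variables (J : pred I) (j : I) (Z : T -> X).
Hypotheses (iZ : independent_of J Z) (Jj : J j).

Let V (w : T) : X * R := (Z w, Y j w).

Let mZ : measurable_fun setT Z. Proof. by case: iZ. Qed.

Let mV : measurable_fun setT V.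
Proof. by apply: measurable_fun_pair. Qed.

Let rectangles : set (set (X * R)) :=
  [set A `*` B | A in measurable & B in measurable].

Let rectangles_measurable : (measurable : set (set (X * R))) = <<s rectangles >>.
Proof. exact: measurable_prod_measurableType. Qed.

Let rectanglesI : setI_closed rectangles.
Proof.
move=> _ _ [A mA [B mB <-]] [A' mA' [B' mB' <-]].
exists (A `&` A'); first exact: measurableI.
exists (B `&` B'); first exact: measurableI.
by rewrite setXI.
Qed.

Let law1 (A : set X) (B : set R) : measurable A -> measurable B ->
  (Pr (V @^-1` (A `*` B)) = Pr (Z @^-1` A) * Pr (Y j @^-1` B))%E.
Proof.
move=> mA mB; have := iZ.2 A [:: j] (fun=> B) mA isT _ (fun=> mB).
rewrite /= Jj => /(_ isT); rewrite big_seq1 => <-; congr (Pr _).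
apply/seteqP; split=> [w [Zw Yw]|w [Zw Yw]].
  by split => // i; rewrite /= inE => /eqP ->.
by split => //; apply: Yw; rewrite /= inE.
Qed.

Let lawF (A : set X) (B : set R) (s : seq I) (B' : I -> set R) :
  measurable A -> measurable B -> uniq s -> all (fun i => J i && (i != j)) s ->
  (forall i, measurable (B' i)) ->
  (Pr (V @^-1` (A `*` B) `&` event s B') =
   Pr (V @^-1` (A `*` B)) * \prod_(i <- s) Pr (Y i @^-1` B' i))%E.
Proof.
move=> mA mB us Js mB'; rewrite law1//.
pose B'' i := if i == j then B else B' i.
have sj : j \notin s by apply/negP => /(allP Js); rewrite eqxx andbF.
have Bs i : i \in s -> B'' i = B' i.
  by move=> si; rewrite /B''; case: eqP sj => // <-; rewrite si.
have := iZ.2 A (j :: s) B'' mA.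
rewrite /= sj us Jj => /(_ isT).
rewrite (_ : all J s) => [|]; last by apply: sub_all Js => i /andP[].
move=> /(_ isT) h.
have mB'' i : measurable (B'' i) by rewrite /B''; case: ifP.
have Bj : B'' j = B by rewrite /B'' eqxx.
move: (h mB''); rewrite big_cons Bj muleA.
rewrite (eq_big_seq (fun i => Pr (Y i @^-1` B' i))) => [<-|i si]; last by rewrite Bs.
congr (Pr _); rewrite event_cons Bj setIA; congr (_ `&` _).
apply/seteqP; split=> w ew i /= si; have := ew i si; by rewrite Bs.
Qed.

Let restricted_law (F : set T) (mF : measurable F) : {measure set (X * R) -> \bar R}.
Proof. by refine (pushforward (mrestr Pr mF) V). Defined.

Let restricted_lawE (F : set T) (mF : measurable F) E :
  restricted_law mF E = Pr (V @^-1` E `&` F).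
Proof. by []. Qed.

(** For a fixed event F of the remaining variables, E |-> Pr(V in E and F) and
E |-> Pr(V in E) Pr(F) are finite measures that agree on rectangles. *)
Lemma independent_adjoin : independent_of (fun i => J i && (i != j)) V.
Proof.
split=> // E s B mE us Js mB.
pose p := (\prod_(i <- s) Pr (Y i @^-1` B i))%E.
have p0 : (0 <= p)%E.
  by apply: (big_ind (fun x => (0 <= x)%E)) => // *; rewrite mule_ge0.
have p1 : (p \is a fin_num)%E.
  apply: (big_ind (fun x : \bar R => x \is a fin_num)) => // [x y|i _].
    exact: fin_numM.
  by rewrite fin_num_measure//; exact: measurable_preY.
pose pn : {nonneg R} := NngNum (fine_ge0 p0).
have mF := measurable_event s mB.
rewrite -/p -(fineK p1) muleC.
rewrite -restricted_lawE -[V @^-1` E]setIT -(restricted_lawE measurableT).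
change (restricted_law mF E = mscale pn (restricted_law measurableT) E).
apply: (@measure_unique _ _ _ rectangles (fun=> setT)) => //.
- by move=> _; exists setT => //; exists setT => //; rewrite setXTT.
- by rewrite bigcup_const//; exists 0%N.
- move=> _ [A mA [A' mA' <-]].
  transitivity ((fine p)%:E * Pr (V @^-1` (A `*` A')))%E.
    by rewrite [LHS]restricted_lawE lawF// -/p -{1}(fineK p1) muleC.
  by rewrite -[V @^-1` _]setIT.
- move=> k; rewrite restricted_lawE preimage_setT setTI.
  by rewrite (le_lt_trans (probability_le1 _ _))// ltry.
Qed.

(** Fubini's theorem: Z and Y j are independent, so the law of the pair is the
product of their laws. *)
Lemma integral_adjoin (f : X * R -> R) (K : R) :
  measurable_fun setT f -> (forall z, `|f z| <= K) ->
  (\int[Pr]_w (f (Z w, Y j w))%:E =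
   \int[Pr]_w \int[distribution Pr (Y j)]_y (f (Z w, y))%:E)%E.
Proof.
move=> mf fK.
have [Z' Z'Z] : exists Z' : {mfun T >-> X}, Z' = Z :> (T -> X).
  by exists (HB.pack_for {mfun T >-> X} Z (isMeasurableFun.Build _ _ _ _ Z mZ)).
have [V' V'V] : exists V' : {mfun T >-> (X * R)%type}, V' = V :> (T -> X * R).
  by exists (HB.pack_for {mfun T >-> (X * R)%type} V (isMeasurableFun.Build _ _ _ _ V mV)).
have mEf : measurable_fun setT (EFin \o f) by exact/measurable_EFinP.
have fi : (distribution Pr Z' \x distribution Pr (Y j))%E.-integrable setT (EFin \o f).
  apply: bounded_integrable fK; last exact: mf.
  have e : (distribution Pr Z' \x distribution Pr (Y j))%E [set: X * R] = 1%E.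
    rewrite -setXTT product_measure1E//=.
    rewrite (@probability_setT _ _ _ (distribution Pr Z')).
    by rewrite (@probability_setT _ _ _ (distribution Pr (Y j))) mule1.
  by rewrite /= e ltry.
transitivity (\int[distribution Pr V']_z (f z)%:E)%E.
  rewrite integral_distribution ?V'V//.
  have := @bounded_integrable_prob _ _ _ Pr _ _ (measurableT_comp mf mV) (fun w => fK (V w)).
  exact.
transitivity (\int[(distribution Pr Z' \x distribution Pr (Y j))]_z (f z)%:E)%E.
  apply: eq_measure_integral => E mE _; apply/esym.
  apply: (product_measure_unique (m' := distribution Pr V')) => // A B mA mB.
  by have := law1 mA mB; rewrite -V'V -Z'Z.
rewrite -(integral12_prod_meas1 fi).
have mF := measurable_fubini_F fi.
rewrite integral_distribution ?Z'Z//.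
have fF (x : X) : fubini_F (distribution Pr (Y j)) (EFin \o f) x =
    (\int[distribution Pr (Y j)]_y (f (x, y))%:E)%E by [].
apply: (@le_integrable _ _ _ Pr _ measurableT _ (cst K%:E)).
- exact: measurableT_comp.
- move=> w _; rewrite /= fF.
  have mfw : measurable_fun setT (fun y => f (Z w, y)).
    by apply: measurableT_comp mf _; exact: measurable_pair1.
  apply: le_trans (le_abse_integral _ measurableT _) _; first exact/measurable_EFinP.
  apply: (@le_trans _ _ (\int[distribution Pr (Y j)]_y K%:E)%E).
    apply: ge0_le_integral => //.
    + by apply/measurable_EFinP; exact: measurableT_comp.
    + by move=> y _; rewrite lee_fin.
  by rewrite integral_cst//= probability_setT mule1 lee_fin ler_norm.
- by apply: (@bounded_integrable_prob _ _ _ Pr (cst K) K) => // x; rewrite ger0_norm// (le_trans _ (fK (point, point))).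
Qed.

End adjoin.
End fresh_variables.

Section exponential_expectation.
Context {d : measure_display} {T : measurableType d} {R : realType}.
Variable Pr : probability T R.
Local Notation leb := (@lebesgue_measure R).

(** The density g is the Radon-Nikodym derivative of the law of X, up to a
null set. *)
Lemma integral_density (X : {RV Pr >-> R}) (g : R -> R) (f : R -> R) (K : R) :
  leb.-integrable setT (EFin \o g) ->
  (forall A, measurable A -> distribution Pr X A = (\int[leb]_(x in A) (g x)%:E)%E) ->
  measurable_fun setT f -> (forall x, `|f x| <= K) ->
  (\int[distribution Pr X]_x (f x)%:E = \int[leb]_x (f x * g x)%:E)%E.
Proof.
move=> ig Xg mf fK.
have mX : measurable_fun setT (X : T -> measurableTypeR R) by exact: (measurable_funPT X).
pose X' : {mfun T >-> measurableTypeR R} :=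
  HB.pack_for {mfun T >-> measurableTypeR R} (X : T -> measurableTypeR R)
    (isMeasurableFun.Build _ _ _ _ (X : T -> measurableTypeR R) mX).
have ifX : Pr.-integrable setT (EFin \o (f \o X)).
  exact: (@bounded_integrable_prob _ _ _ Pr (f \o X) K
    (measurableT_comp mf (measurable_funPT X)) (fun w => fK (X w))).
rewrite integral_distribution//; last exact/measurable_EFinP.
have mf' : measurable_fun setT (EFin \o (f : measurableTypeR R -> R)).
  by apply/measurable_EFinP; exact: mf.
transitivity (\int[distribution Pr X']_x (f x)%:E)%E.
  by rewrite integral_distribution.
pose nu : probability (measurableTypeR R) R := distribution Pr X'.
change (\int[nu]_x (f x)%:E = \int[leb]_x (f x * g x)%:E)%E.
have mg : measurable_fun setT (EFin \o g) by exact: measurable_int ig.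
have dom : nu `<< leb.
  apply/null_content_dominatesP => A mA A0.
  rewrite [LHS](_ : _ = distribution Pr X A)// Xg//.
  by apply: null_set_integral => //; exact: measurable_funTS.
have inu : nu.-integrable setT (EFin \o f).
  exact: (@bounded_integrable_prob _ _ _ nu _ _ mf fK).
rewrite -(Radon_Nikodym_change_of_variables dom measurableT inu).
have dom' : charge_of_finite_measure nu `<< leb by [].
have iRN := Radon_Nikodym_integrable dom'.
apply: ae_eq_integral => //.
- by apply: emeasurable_funM; [exact/measurable_EFinP|exact: measurable_int iRN].
- by apply/measurable_EFinP; apply: measurable_funM => //; exact/measurable_EFinP.
suff : ae_eq leb setT (Radon_Nikodym (charge_of_finite_measure nu) leb) (EFin \o g).
  exact: ae_eqe_mul2l.
apply: integral_ae_eq => // E _ mE.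
by rewrite -(Radon_Nikodym_integral dom' mE) -Xg.
Qed.

Lemma integral_exponential (X : {RV Pr >-> R}) (rate : R) (f : R -> R) (K : R) :
  0 < rate ->
  (forall A, measurable A -> distribution Pr X A = exponential_prob rate A) ->
  measurable_fun setT f -> (forall x, `|f x| <= K) ->
  (\int[distribution Pr X]_x (f x)%:E =
   \int[leb]_(x in `[0%R, +oo[) (f x * (rate * expR (- (rate * x))))%:E)%E.
Proof.
move=> rate0 Xe mf fK.
rewrite (integral_density (integrable_exponential_pdf rate0) Xe mf fK).
rewrite [RHS]integral_mkcond; apply: eq_integral => x _.
rewrite /exponential_pdf !patchE; case: ifP => _; last by rewrite mulr0.
by rewrite mulNr.
Qed.

End exponential_expectation.

(** * Dynamic programming over one period *)

Section interval_splitting.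
Context {R : realType}.
Local Notation leb := (@lebesgue_measure R).

Lemma integral_split (f : R -> R) (a s : R) (y : itv_bound R) :
  a <= s -> (BRight s <= y)%O -> measurable_fun [set: measurableTypeR R] f ->
  (\int[leb]_(x in [set` Interval (BLeft a) y]) (f x)%:E =
   \int[leb]_(x in `[a, s]) (f x)%:E +
   \int[leb]_(x in [set` Interval (BLeft s) y]) (f x)%:E)%E.
Proof.
move=> as_ sy mf.
have mEf : measurable_fun [set: measurableTypeR R] (EFin \o f) by exact/measurable_EFinP.
rewrite -[X in (_ = _ + X)%E]integral_itv_obnd_cbnd; last exact: measurable_funTS.
rewrite (@itv_bndbnd_setU _ _ _ (BRight s)) ?bnd_simp// integral_setU//.
- exact: measurable_funTS.
- apply/disj_setPS => x [] /=; rewrite in_itv/= itv_boundlr => /andP[_ xs] /andP[sx _].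
  by move: sx; rewrite bnd_simp ltNge xs.
Qed.

End interval_splitting.

Section post_claim.
Context {R : realType}.
Variables (k pen a b : R) (v : R -> R).

(** What a claim bringing the reserve to z is worth when v is the value of
going on.  The inner clamp at b changes nothing at the levels that occur, and
makes the function bounded on the whole line. *)
Definition post_claim (z : R) : R :=
  if z < - a then - pen
  else v (Num.max 0 (Num.min b z)) - k * Num.max 0 (- z).

Lemma measurable_post_claim : continuous v ->
  measurable_fun [set: measurableTypeR R] post_claim.
Proof.
move=> cv.
apply: measurable_fun_ifT.
- exact: measurable_fun_ltr.
- exact: measurable_cst.
- apply: measurable_funB.
    apply: measurableT_comp; first exact: (continuous_measurable_fun cv).
    by apply: measurable_maxr => //; apply: measurable_minr.
  by apply: measurable_funM => //; apply: measurable_maxr.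
Qed.

Lemma post_claim_bounded (M : R) : 0 <= a -> 0 <= b -> 0 <= k ->
  (forall x, 0 <= x <= b -> `|v x| <= M) ->
  forall z, `|post_claim z| <= `|pen| + M + k * a.
Proof.
move=> a0 b0 k0 vM z.
have M0 : 0 <= M by rewrite (le_trans _ (vM 0 _)) ?lexx.
rewrite /post_claim; case: ltP => za.
  by rewrite normrN -addrA lerDl addr_ge0// mulr_ge0.
rewrite (le_trans (ler_normB _ _))// lerD//.
  rewrite (le_trans (vM _ _)) ?lerDr//.
  by rewrite le_max lexx/= ge_max b0 ge_min lexx.
rewrite normrM (ger0_norm k0) ler_wpM2l// ger0_norm ?le_max ?lexx//.
by rewrite ge_max a0/= lerNl.
Qed.

End post_claim.

Lemma continuous_itv_bounded {R : realType} (f : R -> R) (b : R) : 0 <= b ->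
  continuous f -> exists M, forall x, 0 <= x <= b -> `|f x| <= M.
Proof.
move=> b0 cf.
have cn : {within `[0, b], continuous (fun x => `|f x|)}.
  apply: continuous_subspaceT => x.
  by apply: (@continuous_comp _ _ _ f (fun y => `|y|)); [exact: cf|exact: norm_continuous].
have [x0 _ fx0] := EVT_max b0 cn.
by exists `|f x0| => x xb; apply: fx0; rewrite in_itv.
Qed.

Section one_period.
Context {R : realType}.
Local Notation leb := (@lebesgue_measure R).
Variables (c lam mu q k pen a b r1 r2 A1 A2 K : R).
Hypotheses (c0 : 0 < c) (lam0 : 0 < lam) (mu0 : 0 < mu) (q0 : 0 < q).
Hypotheses (a0 : 0 <= a) (b0 : 0 <= b).
Hypotheses (mr1 : 0 < mu + r1) (mr2 : 0 < mu + r2).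
Hypotheses (root1 : lam * mu / (mu + r1) = lam + q - c * r1)
  (root2 : lam * mu / (mu + r2) = lam + q - c * r2).

Definition value (x : R) : R := A1 * expR (r1 * x) + A2 * expR (r2 * x).
Definition value' (x : R) : R := A1 * (r1 * expR (r1 * x)) + A2 * (r2 * expR (r2 * x)).

(* K is the expected value after a claim striking at reserve 0; the condition
   says that for x > 0 no term in e^(-mu x) is left in the expectation. *)
Hypothesis fluctuation0 : A1 * (mu / (mu + r1)) + A2 * (mu / (mu + r2)) = K.
Hypothesis KE : K = (1 - expR (- (mu * a))) * value 0
  - k * ((1 - expR (- (mu * a))) / mu - a * expR (- (mu * a))) - pen * expR (- (mu * a)).
Hypothesis slope1 : value' b = 1.

Lemma is_derive_value (x : R) : is_derive x 1 value (value' x).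
Proof.
exact: derive_D (derive_Z _ (is_derive_expRM _ _)) (derive_Z _ (is_derive_expRM _ _)).
Qed.

Lemma continuous_value : continuous value.
Proof.
by move=> x; apply: cvgD; apply: cvgM => //;
  [exact: cvg_cst|exact: continuous_expRM|exact: cvg_cst|exact: continuous_expRM].
Qed.

Lemma continuous_value' : continuous value'.
Proof.
have h A r : continuous (fun x : R => A * (r * expR (r * x))).
  move=> x; apply: cvgM; first exact: cvg_cst.
  by apply: cvgM; [exact: cvg_cst|exact: continuous_expRM].
by move=> x; apply: cvgD; exact: h.
Qed.

Local Notation post := (post_claim k pen a b value).

(** The expected value after a claim striking at reserve x, as it must be for
v to solve lam (E v(after the claim) - v) - q v + c v' = 0. *)
Definition pre_claim (x : R) : R := ((lam + q) * value x - c * value' x) / lam.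

Lemma continuous_pre_claim : continuous pre_claim.
Proof.
move=> x; apply: cvgM; last exact: cvg_cst.
apply: cvgB; apply: cvgM; try exact: cvg_cst; [exact: continuous_value|exact: continuous_value'].
Qed.

(** The claim y falls in one of three ranges: below x there is no injection,
between x and x + a the reserve goes back to 0, beyond x + a there is
bankruptcy.  By the choice of K the terms in e^(-mu x) add up to 0, and the
root equations turn lam mu / (mu + r) into lam + q - c r. *)
Lemma claim_expectation (x : R) : 0 <= x <= b ->
  (\int[leb]_(y in `[0%R, +oo[) (post (x - y) * (mu * expR (- (mu * y))))%:E =
   (pre_claim x)%:E)%E.
Proof.
move=> /andP[x0 xb].
pose e (y : R) : R := mu * expR (- (mu * y)).
have ce : continuous e by move=> y; apply: cvgM; [exact: cvg_cst|exact: continuous_expRNM].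
have mf : measurable_fun [set: measurableTypeR R] (fun y => post (x - y) * e y).
  apply: measurable_funM; last exact: continuous_measurable_fun.
  by apply: measurableT_comp; [exact: (measurable_post_claim _ _ _ _ continuous_value)|exact: measurable_funB].
have xa : x <= x + a by rewrite lerDl.
rewrite (integral_split x0 _ mf)// (integral_split xa _ mf)//.
pose E (y : R) : R := expR (- (mu * y)).
have dE (y : R) : is_derive y 1 E (- e y) by exact: is_derive_expRNM.
(* claims below x: no injection *)
pose F1 (y : R) : R := - ((A1 * (mu / (mu + r1))) * (expR (r1 * x) * expR (- ((mu + r1) * y)))
  + (A2 * (mu / (mu + r2))) * (expR (r2 * x) * expR (- ((mu + r2) * y)))).
have dF1 (y : R) : is_derive y 1 F1 (value (x - y) * e y).
  apply: derive_eq (derive_N (derive_D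
    (derive_Z _ (derive_Z _ (is_derive_expRNM _ _)))
    (derive_Z _ (derive_Z _ (is_derive_expRNM _ _))))) _.
  rewrite /value /e.
  have -> : r1 * (x - y) = r1 * x + - (r1 * y) by ring.
  have -> : r2 * (x - y) = r2 * x + - (r2 * y) by ring.
  have -> : - ((mu + r1) * y) = - (mu * y) - r1 * y by ring.
  have -> : - ((mu + r2) * y) = - (mu * y) - r2 * y by ring.
  by rewrite !expRD; field; rewrite !gt_eqF.
have I1 : (\int[leb]_(y in `[0%R, x]) (post (x - y) * e y)%:E = (F1 x - F1 0)%:E)%E.
  rewrite -(segment_FTC x0 _ dF1); last first.
    move=> y; apply: cvgM; last exact: ce.
    apply: (@continuous_comp _ _ _ (fun y => x - y) value); last exact: continuous_value.
    by apply: cvgB; [exact: cvg_cst|exact: cvg_id].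
  apply: eq_integral => y; rewrite mem_setE in_itv/= => /andP[y0 yx].
  rewrite /post_claim ifF; last by rewrite ltNge (le_trans (_ : - a <= 0))// ?oppr_le0// subr_ge0.
  have -> : Num.max 0 (- (x - y)) = 0 by apply/max_idPl; rewrite oppr_le0 subr_ge0.
  have -> : Num.min b (x - y) = x - y.
    by apply/min_idPr; rewrite (le_trans _ xb)// gerBl.
  have -> : Num.max 0 (x - y) = x - y by apply/max_idPr; rewrite subr_ge0.
  by rewrite mulr0 subr0.
(* claims between x and x + a: the reserve is brought back to 0 *)
pose F2 (y : R) : R := - E y * (value 0 + k * (x - y) - k / mu).
have dF2 (y : R) : is_derive y 1 F2 ((value 0 + k * (x - y)) * e y).
  apply: derive_eq (derive_M (derive_N (dE y)) (derive_B (derive_D (derive_cst (value 0) y)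
     (derive_Z k (derive_B (derive_cst x y) (derive_id1 y)))) (derive_cst (k / mu) y))) _.
  by rewrite /e /E; field; rewrite gt_eqF.
have I2 : (\int[leb]_(y in `[x, (x + a)%R]) (post (x - y) * e y)%:E =
    (F2 (x + a) - F2 x)%:E)%E.
  rewrite -(segment_FTC xa _ dF2); last first.
    move=> y; apply: cvgM; last exact: ce.
    apply: cvgD; first exact: cvg_cst.
    by apply: cvgM; [exact: cvg_cst|apply: cvgB; [exact: cvg_cst|exact: cvg_id]].
  apply: eq_integral => y; rewrite mem_setE in_itv/= => /andP[xy yxa].
  have ya : - a <= x - y.
    by rewrite -subr_ge0 (_ : x - y - - a = x + a - y) ?subr_ge0//; ring.
  rewrite /post_claim ltNge ya/=.
  have -> : Num.max 0 (- (x - y)) = - (x - y).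
    by apply/max_idPr; rewrite oppr_ge0 subr_le0.
  have -> : Num.min b (x - y) = x - y.
    by apply/min_idPr; rewrite (le_trans _ b0)// subr_le0.
  have -> : Num.max 0 (x - y) = 0 by apply/max_idPl; rewrite subr_le0.
  by rewrite mulrN opprK.
(* claims beyond x + a: bankruptcy *)
have dF3 (y : R) : is_derive y 1 (fun y => pen * E y) (- pen * e y).
  by apply: derive_eq (derive_Z pen (dE y)) _; rewrite mulrN mulNr.
have I3 : (\int[leb]_(y in `[(x + a)%R, +oo[) (post (x - y) * e y)%:E =
    (0 - pen * E (x + a))%:E)%E.
  have [_ <-] : leb.-integrable `[(x + a)%R, +oo[ (EFin \o (fun y => - pen * e y)) /\
      (\int[leb]_(y in `[(x + a)%R, +oo[) (- pen * e y)%:E = (0 - pen * E (x + a))%:E)%E.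
    apply: (@halfline_FTC _ _ (fun y => pen * E y) _ (`|pen| * mu) mu) => //.
    - by move=> y _; rewrite /e !normrM normrN (gtr0_norm mu0) (ger0_norm (expR_ge0 _)) mulrA.
    - by apply: continuous_halflineW => y; apply: cvgM; [exact: cvg_cst|exact: ce].
    - rewrite -[X in _ --> X](mulr0 pen); apply: cvgM; first exact: cvg_cst.
      exact: cvg_expRNM.
    - apply: cvg_at_right_filter; apply: cvgM; first exact: cvg_cst.
      exact: continuous_expRNM.
  rewrite -integral_itv_obnd_cbnd; last first.
    by apply/measurable_EFinP; exact: measurable_funTS.
  rewrite -[RHS]integral_itv_obnd_cbnd; last first.
    apply/measurable_EFinP; apply: measurable_funTS; apply: measurable_funM => //.
    exact: continuous_measurable_fun.
  apply: eq_integral => y; rewrite mem_setE in_itv/= andbT => xay.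
  have ya : x - y < - a.
    by rewrite -subr_gt0 (_ : - a - (x - y) = y - (x + a)) ?subr_gt0//; ring.
  by rewrite /post_claim ya.
rewrite I1 I2 I3 -!EFinD; congr EFin.
rewrite /F1 /F2 /E /pre_claim /value'.
have G r : expR (r * x) * expR (- ((mu + r) * x)) = expR (- (mu * x)).
  by rewrite -expRD; congr expR; ring.
rewrite !G !mulr0 !oppr0 !expR0 !mulr1.
have -> : expR (- (mu * (x + a))) = expR (- (mu * x)) * expR (- (mu * a)).
  by rewrite mulrDr opprD expRD.
have P : (lam + q) * value x - c * (A1 * (r1 * expR (r1 * x)) + A2 * (r2 * expR (r2 * x))) =
    A1 * (lam + q - c * r1) * expR (r1 * x) + A2 * (lam + q - c * r2) * expR (r2 * x).
  by rewrite /value; ring.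
rewrite P -root1 -root2.
have -> : x - (x + a) = - a by ring.
rewrite subrr mulr0 addr0.
transitivity (A1 * (mu / (mu + r1)) * expR (r1 * x) + A2 * (mu / (mu + r2)) * expR (r2 * x)
  + expR (- (mu * x)) * (K - (A1 * (mu / (mu + r1)) + A2 * (mu / (mu + r2))))).
  by rewrite KE; field; rewrite !gt_eqF.
by rewrite fluctuation0 subrr mulr0 addr0; field; rewrite !gt_eqF.
Qed.

(** Before the barrier is reached the integrand is the derivative of
- e^(-(lam+q)t) v(r + c t).  At the barrier the claim strikes at b, and
v'(b) = 1 makes the dividends, at rate c, equal to the missing term c v'(b). *)
Lemma period_expectation (r : R) : 0 <= r <= b ->
  (\int[leb]_(t in `[0%R, +oo[) ((period_dividends c q b r t +
      expR (- (q * t)) * pre_claim (Num.min b (r + c * t))) * (lam * expR (- (lam * t))))%:E =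
   (value r)%:E)%E.
Proof.
move=> /andP[rp rb].
pose u := (b - r) / c.
have u0 : 0 <= u by rewrite divr_ge0 ?subr_ge0// ltW.
have cu : c * u = b - r by rewrite /u; field; rewrite gt_eqF.
pose f (t : R) : R := (period_dividends c q b r t +
      expR (- (q * t)) * pre_claim (Num.min b (r + c * t))) * (lam * expR (- (lam * t))).
have mf : measurable_fun [set: measurableTypeR R] f.
  apply: continuous_measurable_fun; rewrite /f => t; apply: cvgM; last first.
    by apply: cvgM; [exact: cvg_cst|exact: continuous_expRNM].
  apply: cvgD.
    apply: cvgM; first exact: cvg_cst.
    apply: cvgB; first exact: cvg_cst.
    apply: (@continuous_comp _ _ _ (fun t => Num.max u t) (fun t => expR (- (q * t)))).
      by apply: (@continuous_max R R (cst u) id t); [exact: cst_continuous|exact: cvg_id].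
    exact: continuous_expRNM.
  apply: cvgM; first exact: continuous_expRNM.
  apply: (@continuous_comp _ _ _ (fun t => Num.min b (r + c * t)) pre_claim); last first.
    exact: continuous_pre_claim.
  apply: (@continuous_min R R (cst b) (fun t => r + c * t) t); first exact: cst_continuous.
  by apply: cvgD; [exact: cvg_cst|apply: cvgM; [exact: cvg_cst|exact: cvg_id]].
rewrite (integral_split u0 _ mf)//.
have eD t : expR (- ((lam + q) * t)) = expR (- (q * t)) * expR (- (lam * t)).
  by rewrite -expRD; congr expR; ring.
(* gaps ending before the barrier is reached *)
pose F1 (t : R) : R := - (expR (- ((lam + q) * t)) * value (r + c * t)).
pose f1 (t : R) : R := expR (- ((lam + q) * t)) *
  ((lam + q) * value (r + c * t) - c * value' (r + c * t)).
have dF1 (t : R) : is_derive t 1 F1 (f1 t).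
  have dv : is_derive t 1 (fun t => value (r + c * t)) (value' (r + c * t) * c).
    apply: derive_comp (is_derive_value _) _.
    by apply: derive_eq (derive_D (derive_cst r t) (derive_Z c (derive_id1 t))) _;
      rewrite add0r mulr1.
  apply: derive_eq (derive_N (derive_M (is_derive_expRNM _ _) dv)) _.
  by rewrite /f1; ring.
have cf1 : continuous f1.
  have cr (g : R -> R) : continuous g -> continuous (fun t => g (r + c * t)).
    move=> cg t; apply: (@continuous_comp _ _ _ (fun t => r + c * t) g); last exact: cg.
    by apply: cvgD; [exact: cvg_cst|apply: cvgM; [exact: cvg_cst|exact: cvg_id]].
  move=> t; apply: cvgM; first exact: continuous_expRNM.
  apply: cvgB; apply: cvgM; try exact: cvg_cst.
    exact: (cr _ continuous_value).
  exact: (cr _ continuous_value').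
have I1 : (\int[leb]_(t in `[0%R, u]) (f t)%:E = (F1 u - F1 0)%:E)%E.
  rewrite -(segment_FTC u0 cf1 dF1); apply: eq_integral => t.
  rewrite mem_setE in_itv/= => /andP[t0 tu]; congr EFin.
  rewrite /f /period_dividends -/u (max_idPl tu) subrr mulr0 add0r.
  rewrite (min_idPr _); last first.
    by rewrite addrC -lerBrDr -cu ler_wpM2l// ltW.
  rewrite /f1 /pre_claim eD.
  by field; rewrite gt_eqF.
(* gaps ending at the barrier *)
pose B := value b - c / (lam + q).
have lq0 : 0 < lam + q by rewrite addr_gt0.
pose F2 (t : R) : R := - (c / q * expR (- (q * u))) * expR (- (lam * t))
  + (c / q * (lam / (lam + q)) - B) * expR (- ((lam + q) * t)).
pose f2 (t : R) : R := (c / q * expR (- (q * u)) * lam) * expR (- (lam * t))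
  + (- (c / q * lam) + (lam + q) * B) * expR (- ((lam + q) * t)).
have dF2 (t : R) : is_derive t 1 F2 (f2 t).
  apply: derive_eq (derive_D (derive_Z _ (is_derive_expRNM _ _))
    (derive_Z _ (is_derive_expRNM _ _))) _.
  by rewrite /f2; field; rewrite !gt_eqF.
have cF2 (t : R) : {for t, continuous F2}.
  by apply/differentiable_continuous/derivable1_diffP; exact: ex_derive.
have I2 : (\int[leb]_(t in `[u, +oo[) (f t)%:E = (0 - F2 u)%:E)%E.
  have [_ <-] : leb.-integrable `[u, +oo[ (EFin \o f2) /\
      (\int[leb]_(t in `[u, +oo[) (f2 t)%:E = (0 - F2 u)%:E)%E.
    apply: (@halfline_FTC _ f2 F2 u
      (`|c / q * expR (- (q * u)) * lam| + `|- (c / q * lam) + (lam + q) * B|) lam) => //.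
    - move=> t ut; rewrite /f2 (le_trans (ler_normD _ _))// [leRHS]mulrDl.
      rewrite (normrM _ (expR (- (lam * t)))) (normrM _ (expR (- ((lam + q) * t)))).
      rewrite (ger0_norm (expR_ge0 (- (lam * t)))) (ger0_norm (expR_ge0 (- ((lam + q) * t)))).
      rewrite lerD2l ler_wpM2l//.
      by rewrite ler_expR lerN2 ler_wpM2r ?(le_trans u0)// lerDl ltW.
    - by apply: continuous_halflineW => t; apply: cvgD; apply: cvgM;
        [exact: cvg_cst|exact: continuous_expRNM|exact: cvg_cst|exact: continuous_expRNM].
    - rewrite -[X in _ --> X](addr0 0); apply: cvgD.
        by rewrite -[X in _ --> X](mulr0 (- (c / q * expR (- (q * u))))); apply: cvgM;
          [exact: cvg_cst|exact: cvg_expRNM].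
      by rewrite -[X in _ --> X](mulr0 (c / q * (lam / (lam + q)) - B)); apply: cvgM;
          [exact: cvg_cst|exact: cvg_expRNM].
    - exact/cvg_at_right_filter/cF2.
  apply: eq_integral => t; rewrite mem_setE in_itv/= andbT => ut; congr EFin.
  rewrite /f /period_dividends -/u (max_idPr ut) (min_idPl _); last first.
    by rewrite addrC -lerBlDr -cu ler_wpM2l// ltW.
  rewrite /pre_claim slope1 /f2 /B eD.
  by field; rewrite !gt_eqF.
rewrite I1 I2 -EFinD; congr EFin.
rewrite /F1 /F2 cu mulr0 !mulr0 oppr0 expR0 addr0 mul1r [r + _]addrC subrK.
by rewrite /B eD; field; rewrite !gt_eqF.
Qed.

End one_period.

(** * The controlled chain along the claim dates *)

Section null_sets.
Context d (T : measurableType d) (R : realType).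
Variable nu : {measure set T -> \bar R}.
Local Open Scope ereal_scope.

Import HBNNSimple.

Let ge0_integral_off_null_set (D : set T) (f : T -> \bar R) : measurable D ->
  nu (~` D) = 0 -> (forall x, 0 <= f x) -> \int[nu]_x f x = \int[nu]_(x in D) f x.
Proof.
move=> mD D0 f0; rewrite ge0_integralTE// [RHS]ge0_integralE//.
have restr_le x : (f \_ D) x <= f x by rewrite patchE; case: ifP.
apply/eqP; rewrite eq_le; apply/andP; split; last first.
  by apply: ereal_sup_le => _ [h hf <-]; exists h => // x; exact: le_trans (hf x) _.
apply: ereal_sup_le => _ [h hf <-].
exists (proj_nnsfun h mD) => [x|].
  rewrite -(mrestrict h mD) !patchE; case: ifP => // _; exact: hf.
rewrite -mrestrict -integral_nnsfun// -integralT_nnsfun.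
rewrite (@ge0_negligible_integral _ _ _ nu setT (~` D)) ?setTD ?setCK//.
- exact: measurableC.
- exact/measurable_EFinP.
- by move=> x _; rewrite lee_fin.
Qed.

(** For an arbitrary f, measurable or not: the integral is a supremum over
simple functions below f, and these may be cut off outside D. *)
Lemma integral_off_null_set (D : set T) (f : T -> \bar R) : measurable D ->
  nu (~` D) = 0 -> \int[nu]_x f x = \int[nu]_(x in D) f x.
Proof.
move=> mD D0; rewrite integralE [RHS]integralE.
by congr (_ - _); apply: ge0_integral_off_null_set.
Qed.

End null_sets.

Section expectations.
Context d (T : measurableType d) (R : realType).

Lemma expectation_affine (P : probability T R) (f : T -> R) (A B e M : R) :
  measurable_fun setT f -> (forall x, `|f x| <= M) ->
  (\int[P]_x (f x)%:E = e%:E)%E ->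
  (\int[P]_x (A + B * f x)%:E = (A + B * e)%:E)%E.
Proof.
move=> mf fM fe.
have fi : P.-integrable setT (EFin \o f) by exact: (@bounded_integrable_prob _ _ _ P f M mf fM).
under eq_integral do rewrite EFinD EFinM.
rewrite integralD//=; last 2 first.
- by apply: (@bounded_integrable_prob _ _ _ P (cst A) `|A|).
- exact: integrableZl.
by rewrite integralZl// fe integral_cst//= probability_setT mule1.
Qed.

End expectations.

Section controlled_chain.
Context {d : measure_display} {T : measurableType d} {R : realType}.
Variable Pr : probability T R.
Variables (tau xi : nat -> {RV Pr >-> R}).
Variables (c lam mu q k pen a b : R) (v g : R -> R).
Hypotheses (c0 : 0 < c) (lam0 : 0 < lam) (mu0 : 0 < mu) (q0 : 0 < q) (k0 : 0 <= k).
Hypotheses (a0 : 0 <= a) (b0 : 0 <= b).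
Hypothesis gap0 : forall n w, 0 < tau n w.
Hypothesis gap_exp : forall n A, measurable A ->
  distribution Pr (tau n) A = exponential_prob lam A.
Hypothesis claim_exp : forall n A, measurable A ->
  distribution Pr (xi n) A = exponential_prob mu A.
Hypothesis indep : mutually_independent Pr (gaps_and_claims tau xi).
Hypotheses (cv : continuous v) (cg : continuous g).
Local Notation leb := (@lebesgue_measure R).
Local Notation post := (post_claim k pen a b v).
Local Notation period_div := (period_dividends c q b).
(* The dynamic programming equations: g is the value just before a claim,
   v the value just after one. *)
Hypothesis claim_step : forall x, 0 <= x <= b ->
  (\int[leb]_(y in `[0%R, +oo[) (post (x - y) * (mu * expR (- (mu * y))))%:E = (g x)%:E)%E.
Hypothesis gap_step : forall r, 0 <= r <= b ->
  (\int[leb]_(t in `[0%R, +oo[) ((period_div r t +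
      expR (- (q * t)) * g (Num.min b (r + c * t))) * (lam * expR (- (lam * t))))%:E =
   (v r)%:E)%E.

Definition inputs (i : nat + nat) : {RV Pr >-> R} :=
  match i with inl n => tau n | inr n => xi n end.

Let inputsE : gaps_and_claims tau xi = fun i => inputs i.
Proof. by apply/funext => -[]. Qed.

Let indep_inputs : mutually_independent Pr (fun i => inputs i : T -> R).
Proof. by rewrite -inputsE. Qed.

(** The gaps and claims that the state after n claims does not involve. *)
Definition from (n : nat) : pred (nat + nat) :=
  fun i => match i with inl m => (n <= m)%N | inr m => (n <= m)%N end.

Let independent_next n d' (X : measurableType d') (Z : T -> X) d'' (X' : measurableType d'')
    (f : (X * R) * R -> X') : measurable_fun setT f ->
  independent_of inputs (from n) Z ->
  independent_of inputs (from n.+1) (fun w => f ((Z w, tau n w), xi n w)).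
Proof.
move=> mf iZ.
have i1 := independent_adjoin iZ (leqnn n : from n (inl n)).
have jn : (fun i => from n i && (i != inl n)) (inr n) by rewrite /= leqnn.
have i2 := independent_adjoin i1 jn.
apply: (independent_comp mf); apply: independent_sub i2 => i.
rewrite !unfold_in /=; case: i => m /= nm.
  rewrite (ltnW nm)/= andbT; apply/eqP => -[mn].
  by rewrite mn ltnn in nm.
rewrite (ltnW nm)/=; apply/eqP => -[mn].
by rewrite mn ltnn in nm.
Qed.

(* On the states that occur the clamps do nothing; they give functions that
   are bounded everywhere, as the use of Fubini's theorem requires. *)
Let clamp (r : R) : R := Num.max 0 (Num.min b r).
Let clamp1 (z : R) : R := Num.max 0 (Num.min 1 z).

Let clamp_itv r : 0 <= clamp r <= b.
Proof. by rewrite /clamp le_max lexx/= ge_max b0 ge_min lexx. Qed.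

Let clamp_id r : 0 <= r <= b -> clamp r = r.
Proof.
move=> /andP[r0 rb]; rewrite /clamp.
by rewrite (min_idPr rb) (max_idPr r0).
Qed.

Let clamp1_itv r : 0 <= clamp1 r <= 1.
Proof. by rewrite /clamp1 le_max lexx/= ge_max ler01 ge_min lexx. Qed.

Let clamp1_id r : 0 <= r <= 1 -> clamp1 r = r.
Proof.
move=> /andP[r0 rb]; rewrite /clamp1.
by rewrite (min_idPr rb) (max_idPr r0).
Qed.

Let level (r t x : R) : R := period_level c b r t x.

Let next (p : ((R * R) * R) * R) : R * R :=
  (if level p.1.1.2 p.1.2 p.2 < - a then 0 else p.1.1.1 * expR (- (q * p.1.2)),
   clamp (level p.1.1.2 p.1.2 p.2)).

Let m1 : measurable_fun setT (fun p : ((R * R) * R) * R => p.1.1.1).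
Proof. by apply: measurableT_comp => //; exact: measurableT_comp. Qed.

Let m2 : measurable_fun setT (fun p : ((R * R) * R) * R => p.1.1.2).
Proof. by apply: (measurableT_comp measurable_snd); exact: measurableT_comp. Qed.

Let m3 : measurable_fun setT (fun p : ((R * R) * R) * R => p.1.2).
Proof. exact: (measurableT_comp measurable_snd). Qed.

Let m4 : measurable_fun setT (fun p : ((R * R) * R) * R => p.2).
Proof. exact: measurable_snd. Qed.

Let measurable_clamp d' (X : measurableType d') (f : X -> R) : measurable_fun setT f ->
  measurable_fun setT (fun x => clamp (f x)).
Proof. by move=> mf; apply: measurable_maxr => //; exact: measurable_minr. Qed.

Let measurable_clamp1 d' (X : measurableType d') (f : X -> R) : measurable_fun setT f ->
  measurable_fun setT (fun x => clamp1 (f x)).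
Proof. by move=> mf; apply: measurable_maxr => //; exact: measurable_minr. Qed.

Let measurable_top d' (X : measurableType d') (r t : X -> R) :
  measurable_fun setT r -> measurable_fun setT t ->
  measurable_fun setT (fun x => Num.min b (r x + c * t x)).
Proof.
move=> mr mt; apply: measurable_minr => //; apply: measurable_funD => //.
exact: measurable_funM.
Qed.

Let measurable_gap_factor d' (X : measurableType d') (t : X -> R) :
  measurable_fun setT t -> measurable_fun setT (fun x => expR (- (q * t x))).
Proof.
have me : measurable_fun [set: R] (fun x : R => expR (- (q * x))).
  exact: measurable_expRNM.
by move=> mt; exact: (measurableT_comp me mt).
Qed.

Let measurable_level d' (X : measurableType d') (r t x : X -> R) :
  measurable_fun setT r -> measurable_fun setT t -> measurable_fun setT x ->
  measurable_fun setT (fun y => level (r y) (t y) (x y)).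
Proof.
by move=> mr mt mx; apply: measurable_funB => //; exact: measurable_top.
Qed.

Let measurable_div d' (X : measurableType d') (r t : X -> R) :
  measurable_fun setT r -> measurable_fun setT t ->
  measurable_fun setT (fun y => period_div (r y) (t y)).
Proof.
move=> mr mt; apply: measurable_funM => //; apply: measurable_funB.
  by apply: measurable_gap_factor; apply: measurable_funM => //; exact: measurable_funB.
apply: measurable_gap_factor; apply: measurable_maxr => //.
by apply: measurable_funM => //; exact: measurable_funB.
Qed.

Let measurable_next : measurable_fun setT next.
Proof.
apply: measurable_fun_pair; last by apply: measurable_clamp; exact: measurable_level.
apply: measurable_fun_ifT => //.
  by apply: measurable_fun_ltr => //; exact: measurable_level.
by apply: measurable_funM => //; exact: measurable_gap_factor.
Qed.

(** The first component is the discount factor, 0 after bankruptcy. *)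
Fixpoint state (n : nat) (w : T) : R * R :=
  if n is m.+1 then next ((state m w, tau m w), xi m w) else (1, 0).

Let state_itv n w : (0 <= (state n w).1 <= 1) /\ (0 <= (state n w).2 <= b).
Proof.
elim: n => [|n [/andP[z0 z1] _]] /=; first by rewrite ler01 !lexx b0.
case: (state n w) z0 z1 => z r /= z0 z1; split; last exact: clamp_itv.
case: ifP => _; first by rewrite lexx ler01.
rewrite mulr_ge0 ?expR_ge0//= mulr_ile1 ?expR_ge0//.
by rewrite expR_le1 oppr_le0 mulr_ge0// ltW.
Qed.

Let independent_state n : independent_of inputs (from n) (state n).
Proof.
elim: n => [|n IH]; first exact: (independent_cst indep_inputs).
exact: (independent_next measurable_next IH).
Qed.

Let measurable_state n : measurable_fun setT (state n).
Proof. by case: (independent_state n). Qed.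

(* The claim is averaged out in gap_value, and not in full_value. *)
Let gap_value (r t : R) : R :=
  period_div r t + expR (- (q * t)) * g (Num.min b (r + c * t)).

Let full_value (r t x : R) : R :=
  period_div r t + expR (- (q * t)) * post (level r t x).

Let V := sval (cid (continuous_itv_bounded b0 cv)).
Let G := sval (cid (continuous_itv_bounded b0 cg)).

Let vV x : 0 <= x <= b -> `|v x| <= V.
Proof. exact: (svalP (cid (continuous_itv_bounded b0 cv))). Qed.

Let gG x : 0 <= x <= b -> `|g x| <= G.
Proof. exact: (svalP (cid (continuous_itv_bounded b0 cg))). Qed.

Let M := `|pen| + V + k * a.

Let postM z : `|post z| <= M.
Proof. exact: post_claim_bounded. Qed.

Let top_itv r t : 0 <= r <= b -> 0 <= t -> 0 <= Num.min b (r + c * t) <= b.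
Proof.
move=> /andP[r0 rb] t0; rewrite le_min b0 ge_min lexx/= andbT.
by rewrite addr_ge0// mulr_ge0// ltW.
Qed.

Let clampt (t : R) : R := Num.max 0 t.

Let clampt_ge0 t : 0 <= clampt t. Proof. by rewrite /clampt le_max lexx. Qed.

Let gap_factor_le1 t : 0 <= t -> `|expR (- (q * t))| <= 1.
Proof.
move=> t0; rewrite ger0_norm ?expR_ge0// expR_le1 oppr_le0 mulr_ge0//.
exact: ltW.
Qed.

Let div_bounded r t : 0 <= r <= b -> 0 <= t -> `|period_div r t| <= c / q.
Proof.
move=> rb t0; have /andP[p0 p1] := period_dividends_itv c0 q0 rb t0.
by rewrite ger0_norm.
Qed.

Let expectation_claim n (x : R) : 0 <= x <= b ->
  (\int[distribution Pr (xi n)]_y (post (x - y))%:E = (g x)%:E)%E.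
Proof.
move=> xb; rewrite -(claim_step xb).
apply: (integral_exponential mu0 (claim_exp n)) => //.
apply: measurableT_comp; first exact: (measurable_post_claim k pen a b cv).
exact: measurable_funB.
Qed.

Let expectation_gap n (r : R) : 0 <= r <= b ->
  (\int[distribution Pr (tau n)]_t (gap_value r (clampt t))%:E = (v r)%:E)%E.
Proof.
move=> rb; rewrite -(gap_step rb).
rewrite (integral_exponential (K := c / q + G) lam0 (gap_exp n)).
- apply: eq_integral => t; rewrite mem_setE in_itv/= andbT => t0.
  by rewrite /clampt (max_idPr t0).
- apply: measurable_funD.
    by apply: measurable_div => //; exact: measurable_maxr.
  apply: measurable_funM.
    by apply: measurable_gap_factor; exact: measurable_maxr.
  apply: measurableT_comp; first exact: (continuous_measurable_fun cg).
  by apply: measurable_top => //; exact: measurable_maxr.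
- move=> t; rewrite /gap_value (le_trans (ler_normD _ _))// lerD ?div_bounded//.
  rewrite normrM -[leRHS]mul1r ler_pM// ?gap_factor_le1// gG//.
  exact: top_itv.
Qed.

(* The claim n is integrated first, given the state and the gap, then the
   gap, given the state. *)
Let one_period n :
  (\int[Pr]_w ((state n w).1 * full_value (state n w).2 (tau n w) (xi n w))%:E =
   \int[Pr]_w ((state n w).1 * v (state n w).2)%:E)%E.
Proof.
pose f (p : ((R * R) * R) * R) : R := clamp1 p.1.1.1 *
  full_value (clamp p.1.1.2) (clampt p.1.2) p.2.
pose f1 (p : (R * R) * R) : R := clamp1 p.1.1 * gap_value (clamp p.1.2) (clampt p.2).
have clampt_id w : clampt (tau n w) = tau n w by apply/max_idPr/ltW.
have clamp1_le z : `|clamp1 z| <= 1.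
  by have /andP[z0 z1] := clamp1_itv z; rewrite ger0_norm.
have mt : measurable_fun setT (fun p : ((R * R) * R) * R => clampt p.1.2).
  exact: measurable_maxr.
have mf : measurable_fun setT f.
  apply: measurable_funM; first exact: measurable_clamp1.
  apply: measurable_funD.
    by apply: measurable_div => //; exact: measurable_clamp.
  apply: measurable_funM; first exact: measurable_gap_factor.
  apply: measurableT_comp; first exact: (measurable_post_claim k pen a b cv).
  by apply: measurable_level => //; exact: measurable_clamp.
have fM p : `|f p| <= c / q + M.
  rewrite /f normrM -[leRHS]mul1r ler_pM//.
  rewrite /full_value (le_trans (ler_normD _ _))// lerD ?div_bounded//.
  by rewrite normrM -[leRHS]mul1r ler_pM// gap_factor_le1.
have mf1 : measurable_fun setT f1.
  have mz : measurable_fun setT (fun p : (R * R) * R => p.1.1) by exact: measurableT_comp.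
  have mr : measurable_fun setT (fun p : (R * R) * R => p.1.2).
    exact: (measurableT_comp measurable_snd).
  have mt1 : measurable_fun setT (fun p : (R * R) * R => clampt p.2).
    exact: measurable_maxr.
  apply: measurable_funM; first exact: measurable_clamp1.
  apply: measurable_funD.
    by apply: measurable_div => //; exact: measurable_clamp.
  apply: measurable_funM; first exact: measurable_gap_factor.
  apply: measurableT_comp; first exact: (continuous_measurable_fun cg).
  by apply: measurable_top => //; exact: measurable_clamp.
have gM r t : `|gap_value (clamp r) (clampt t)| <= c / q + G.
  rewrite /gap_value (le_trans (ler_normD _ _))// lerD ?div_bounded//.
  rewrite normrM -[leRHS]mul1r ler_pM// ?gap_factor_le1// gG//.
  exact: top_itv.
have f1M p : `|f1 p| <= c / q + G.
  by rewrite /f1 normrM -[leRHS]mul1r ler_pM.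
have istate := independent_state n.
have igap := independent_adjoin istate (leqnn n : from n (inl n)).
have jn : (fun i => from n i && (i != inl n)) (inr n) by rewrite /= leqnn.
transitivity (\int[Pr]_w (f ((state n w, tau n w), xi n w))%:E)%E.
  apply: eq_integral => w _; have [z01 rb] := state_itv n w.
  by rewrite /f /= clamp1_id// clamp_id// clampt_id.
rewrite (integral_adjoin igap jn mf fM).
transitivity (\int[Pr]_w (f1 (state n w, tau n w))%:E)%E.
  apply: eq_integral => w _.
  have [z01 rb] := state_itv n w.
  have x0b := top_itv rb (ltW (gap0 n w)).
  pose z := (state n w).1; pose r := (state n w).2.
  transitivity (\int[distribution Pr (xi n)]_y
     (z * period_div r (tau n w) + z * expR (- (q * tau n w)) *
      post (Num.min b (r + c * tau n w) - y))%:E)%E.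
    apply: eq_integral => y _; congr EFin.
    rewrite /f /= clamp1_id// clamp_id// clampt_id /full_value /level /period_level.
    by rewrite -/z -/r; ring.
  rewrite (expectation_affine _ _ _ (fun y => postM _) (expectation_claim n x0b)).
    congr EFin; rewrite /f1 /= clamp1_id// clamp_id// clampt_id /gap_value.
    by rewrite -/z -/r; ring.
  apply: measurableT_comp; first exact: (measurable_post_claim k pen a b cv).
  exact: measurable_funB.
rewrite (integral_adjoin istate (leqnn n : from n (inl n)) mf1 f1M).
apply: eq_integral => w _; have [z01 rb] := state_itv n w.
pose z := (state n w).1; pose r := (state n w).2.
transitivity (\int[distribution Pr (tau n)]_t (0 + z * gap_value (clamp r) (clampt t))%:E)%E.
  by apply: eq_integral => t _; rewrite /f1 /= clamp1_id// add0r.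
have e := expectation_gap n rb; rewrite -{1}(clamp_id rb) in e.
rewrite (expectation_affine _ _ _ (gM r) e) ?add0r//.
apply: measurable_funD.
  by apply: measurable_div => //; exact: measurable_maxr.
apply: measurable_funM.
  by apply: measurable_gap_factor; exact: measurable_maxr.
apply: measurableT_comp; first exact: (continuous_measurable_fun cg).
by apply: measurable_top => //; exact: measurable_maxr.
Qed.

Let reward n w : R := (state n w).1 *
  period_reward c q k pen a b (state n w).2 (tau n w) (xi n w).

Let full_valueE n w :
  (state n w).1 * full_value (state n w).2 (tau n w) (xi n w) =
  reward n w + (state n.+1 w).1 * v (state n.+1 w).2.
Proof.
rewrite /reward /full_value /period_reward /post_claim /= -!/(level _ _ _).
by case: ifP => _; rewrite /clamp; ring.
Qed.


Let measurable_state1 n : measurable_fun setT (fun w => (state n w).1).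
Proof. exact: measurableT_comp. Qed.

Let measurable_state2 n : measurable_fun setT (fun w => (state n w).2).
Proof. exact: (measurableT_comp measurable_snd). Qed.

Let measurable_gap n : measurable_fun setT (tau n : T -> R).
Proof. exact: measurable_funP. Qed.

Let measurable_claim n : measurable_fun setT (xi n : T -> R).
Proof. exact: measurable_funP. Qed.

Let measurable_reward n : measurable_fun setT (reward n).
Proof.
apply: measurable_funM => //; apply: measurable_funB; first exact: measurable_div.
apply: measurable_funM; first exact: measurable_gap_factor.
apply: measurable_fun_ifT => //.
  by apply: measurable_fun_ltr => //; exact: measurable_level.
apply: measurable_funM => //; apply: measurable_maxr => //.
by apply: measurable_funN; exact: measurable_level.
Qed.

Let Mr := c / q + (`|pen| + k * a).

Let Mr0 : 0 <= Mr.
Proof. by rewrite /Mr addr_ge0 ?(ltW (divr_gt0 c0 q0))// addr_ge0 ?mulr_ge0. Qed.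

Let reward_le n w : `|reward n w| <= Mr * (state n w).1.
Proof.
have [/andP[z0 z1] rb] := state_itv n w.
rewrite /reward normrM mulrC (ger0_norm z0) ler_wpM2r//.
rewrite /period_reward (le_trans (ler_normB _ _))// lerD ?div_bounded ?(ltW (gap0 n w))//.
rewrite normrM -[leRHS]mul1r ler_pM// ?gap_factor_le1 ?(ltW (gap0 n w))//.
case: ifPn => [_|]; first by rewrite lerDl mulr_ge0.
rewrite -leNgt => la; rewrite normrM (ger0_norm k0) -[leLHS]add0r lerD// ler_wpM2l//.
by rewrite ger0_norm ?le_max ?lexx// ge_max a0 lerNl.
Qed.

Let rewardM n w : `|reward n w| <= Mr.
Proof.
have [/andP[z0 z1] _] := state_itv n w.
by rewrite (le_trans (reward_le n w))// ler_piMr.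
Qed.

Let integrable_reward n : Pr.-integrable setT (EFin \o reward n).
Proof. exact: (@bounded_integrable_prob _ _ _ Pr _ Mr). Qed.

Let valueS n w : R := (state n w).1 * v (state n w).2.

Let measurable_valueS n : measurable_fun setT (valueS n).
Proof.
apply: measurable_funM => //; apply: measurableT_comp => //.
exact: continuous_measurable_fun.
Qed.

Let valueS_le n w : `|valueS n w| <= V * (state n w).1.
Proof.
have [/andP[z0 z1] rb] := state_itv n w.
by rewrite /valueS normrM mulrC (ger0_norm z0) ler_wpM2r// vV.
Qed.

Let V0 : 0 <= V.
Proof. by rewrite (le_trans _ (vV (x := 0) _))// lexx. Qed.

Let valueSM n w : `|valueS n w| <= V.
Proof.
have [/andP[z0 z1] _] := state_itv n w.
by rewrite (le_trans (valueS_le n w))// ler_piMr.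
Qed.

Let integrable_valueS n : Pr.-integrable setT (EFin \o valueS n).
Proof. exact: (@bounded_integrable_prob _ _ _ Pr _ V). Qed.

Let rewards m w : R := \sum_(n < m) reward n w.

Let integrable_rewards m : Pr.-integrable setT (EFin \o rewards m).
Proof.
rewrite (_ : _ \o _ = fun w => \sum_(n < m) (EFin \o reward n) w)%E; last first.
  by apply/funext => w; rewrite /rewards /= sumEFin.
exact: integrable_sum.
Qed.

(* One period trades the value at claim m for one reward and the value at
   claim m + 1. *)
Let telescoping m : (\int[Pr]_w (rewards m w)%:E + \int[Pr]_w (valueS m w)%:E = (v 0)%:E)%E.
Proof.
elim: m => [|m <-].
  rewrite integral0_eq ?add0e => [|w _]; last by rewrite /rewards big_ord0.
  rewrite (eq_integral (fun=> (v 0)%:E)) => [|w _]; last by rewrite /valueS /= mul1r.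
  by rewrite integral_cst//= probability_setT mule1.
have step : (\int[Pr]_w (valueS m w)%:E =
    \int[Pr]_w (reward m w)%:E + \int[Pr]_w (valueS m.+1 w)%:E)%E.
  rewrite -(integralD measurableT (integrable_reward m) (integrable_valueS m.+1)).
  by rewrite -one_period; apply: eq_integral => w _; rewrite full_valueE EFinD.
have sumS : (\int[Pr]_w (rewards m.+1 w)%:E =
    \int[Pr]_w (rewards m w)%:E + \int[Pr]_w (reward m w)%:E)%E.
  rewrite -(integralD measurableT (integrable_rewards m) (integrable_reward m)).
  by apply: eq_integral => w _; rewrite /rewards big_ord_recr.
by rewrite step sumS addeA.
Qed.

Let disc n w : R := expR (- (q * arrival tau n w)).

Let disc0 w : disc 0 w = 1.
Proof. by rewrite /disc /arrival big_ord0 mulr0 oppr0 expR0. Qed.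

Let discS n w : disc n.+1 w = disc n w * expR (- (q * tau n w)).
Proof. by rewrite /disc /arrival big_ord_recr/= mulrDr opprD expRD. Qed.

Let disc_itv n w : 0 <= disc n w <= 1.
Proof.
rewrite expR_ge0/= expR_le1 oppr_le0 mulr_ge0 ?(ltW q0)//.
by apply: sumr_ge0 => i _; exact: ltW.
Qed.

Let state_le_disc n w : (state n w).1 <= disc n w.
Proof.
elim: n => [|n IH]; first by rewrite disc0.
rewrite discS /=; case: ifP => _; first by rewrite mulr_ge0 ?expR_ge0.
by rewrite ler_wpM2r ?expR_ge0.
Qed.

Let independent_disc n : independent_of inputs (from n) (disc n).
Proof.
elim: n => [|n IH].
  rewrite (_ : disc 0 = fun=> 1); last by apply/funext => w; rewrite disc0.
  exact: (independent_cst indep_inputs).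
rewrite (_ : disc n.+1 = (fun w => (disc n w) * expR (- (q * tau n w)))); last first.
  by apply/funext => w; rewrite discS.
have mf : measurable_fun setT (fun p : (R * R) * R => p.1.1 * expR (- (q * p.1.2))).
  apply: measurable_funM; first exact: measurableT_comp.
  by apply: measurable_gap_factor; exact: (measurableT_comp measurable_snd).
exact: (independent_next mf IH).
Qed.

Let measurable_discn n : measurable_fun setT (disc n).
Proof. by case: (independent_disc n). Qed.

Let rho := lam / (lam + q).

Let laplace_gap n : (\int[distribution Pr (tau n)]_t (expR (- (q * clampt t)))%:E = rho%:E)%E.
Proof.
rewrite (integral_exponential (K := 1) lam0 (gap_exp n)); last 2 first.
- by apply: measurable_gap_factor; exact: measurable_maxr.
- by move=> t; exact: gap_factor_le1.
have lq0 : 0 < lam + q by rewrite addr_gt0.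
transitivity (\int[leb]_(t in `[0%R, +oo[) (lam * expR (- ((lam + q) * t)))%:E)%E.
  apply: eq_integral => t; rewrite mem_setE in_itv/= andbT => t0.
  rewrite /clampt (max_idPr t0) mulrCA -expRD; congr (_ * expR _)%:E; ring.
pose F (t : R) := - rho * expR (- ((lam + q) * t)).
have dF (t : R) : is_derive t 1 F (lam * expR (- ((lam + q) * t))).
  apply: derive_eq (derive_Z _ (is_derive_expRNM _ _)) _.
  by rewrite /rho; field; rewrite gt_eqF.
have cF : continuous F.
  by move=> t; apply: cvgM; [exact: cvg_cst|exact: continuous_expRNM].
have Foo : F x @[x --> +oo] --> (0 : R).
  by rewrite -(mulr0 (- rho)); apply: cvgM; [exact: cvg_cst|exact: cvg_expRNM].
have bd (t : R) : 0 <= t -> `|lam * expR (- ((lam + q) * t))| <= lam * expR (- ((lam + q) * t)).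
  by move=> _; rewrite ger0_norm// mulr_ge0 ?expR_ge0// ltW.
have cf : {within `[0, +oo[, continuous (fun t => lam * expR (- ((lam + q) * t)))}.
  apply: continuous_halflineW => t.
  by apply: cvgM; [exact: cvg_cst|exact: continuous_expRNM].
have [_ ->] := halfline_FTC lq0 bd cf Foo (fun t _ => dF t) (cvg_at_right_filter (cF 0)).
by rewrite /F mulr0 oppr0 expR0 mulr1 sub0r opprK.
Qed.

(* The factors e^(-q tau) are independent, with expectation
   lam / (lam + q). *)
Let expectation_disc n : (\int[Pr]_w (disc n w)%:E = (rho ^+ n)%:E)%E.
Proof.
elim: n => [|n IH].
  under eq_integral do rewrite disc0.
  by rewrite integral_cst//= probability_setT mule1 expr0.
pose f (p : R * R) : R := clamp1 p.1 * expR (- (q * clampt p.2)).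
have mf : measurable_fun setT f.
  apply: measurable_funM; first exact: measurable_clamp1.
  by apply: measurable_gap_factor; exact: measurable_maxr.
have fM p : `|f p| <= 1.
  have /andP[z0 z1] := clamp1_itv p.1.
  by rewrite /f normrM -[leRHS]mul1r ler_pM// ?gap_factor_le1// ger0_norm.
transitivity (\int[Pr]_w (f (disc n w, tau n w))%:E)%E.
  apply: eq_integral => w _; rewrite discS /f /= clamp1_id//.
  by rewrite /clampt (max_idPr (ltW (gap0 n w))).
rewrite (integral_adjoin (independent_disc n) (leqnn n : from n (inl n)) mf fM).
transitivity (\int[Pr]_w (0 + rho * disc n w)%:E)%E.
  apply: eq_integral => w _.
  transitivity (\int[distribution Pr (tau n)]_t (0 + disc n w * expR (- (q * clampt t)))%:E)%E.
    by apply: eq_integral => t _; rewrite /f /= clamp1_id// add0r.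
  rewrite (expectation_affine (M := 1) _ _ _ _ (laplace_gap n)) 1?mulrC//.
    by apply: measurable_gap_factor; exact: measurable_maxr.
  by move=> t; exact: gap_factor_le1.
rewrite (expectation_affine (M := 1) _ _ _ _ IH) ?add0r ?exprS//.
by move=> w; have /andP[d0 d1] := disc_itv n w; rewrite ger0_norm.
Qed.

Let rho_itv : 0 < rho < 1.
Proof.
have lq0 : 0 < lam + q by rewrite addr_gt0.
by rewrite /rho divr_gt0// ltr_pdivrMr// mul1r ltrDl.
Qed.

Let cvg_valueS : (\int[Pr]_w (valueS m w)%:E)%E @[m --> \oo] --> 0%E.
Proof.
have /andP[rho0 rho1] := rho_itv.
have rhon : (V * rho ^+ n)%:E @[n --> \oo] --> (0 : \bar R)%E.
  apply/cvg_EFin; first exact: nearW.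
  by rewrite -(mulr0 V); apply: cvgM; [exact: cvg_cst|apply: cvg_expr; rewrite ger0_norm// ltW].
apply/cvg_abse0P; apply: (@squeeze_cvge _ _ _ _ (cst 0%E) _ (fun n => (V * rho ^+ n)%:E)).
- apply: nearW => n; rewrite abse_ge0/=.
  have mval := measurable_valueS n.
  rewrite (le_trans (le_abse_integral _ _ _))//; first exact/measurable_EFinP.
  rewrite EFinM -(expectation_disc n) -ge0_integralZl//.
  + apply: ge0_le_integral => //.
    * by do 2! apply: measurableT_comp => //.
    * apply: measurable_funeM; exact/measurable_EFinP.
    * move=> w _; rewrite /= lee_fin (le_trans (valueS_le n w))// ler_wpM2l//.
  + exact/measurable_EFinP.
  + by move=> w _; rewrite lee_fin; case/andP: (disc_itv n w).
- exact: cvg_cst.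
- exact: rhon.
Qed.

Local Notation total_disc w := (\sum_(n <oo) (disc n w)%:E)%E.

Let disc_ge0 n w : (0 <= (disc n w)%:E)%E.
Proof. by rewrite lee_fin; case/andP: (disc_itv n w). Qed.

Let measurable_total : measurable_fun setT (fun w => total_disc w).
Proof.
by apply: ge0_emeasurable_sum => // n _; exact/measurable_EFinP.
Qed.

Let total_fin : (\int[Pr]_w total_disc w < +oo)%E.
Proof.
rewrite integral_nneseries//; last by move=> n; exact/measurable_EFinP.
rewrite (eq_eseriesr (fun n _ => expectation_disc n)).
have /andP[rho0 rho1] := rho_itv.
rewrite (_ : limn _ = ((1 / (1 - rho))%:E)) ?ltry//.
apply: cvg_lim => //.
rewrite (_ : (fun n => _) = EFin \o series (geometric 1 rho)); last first.
  apply/funext => m /=; rewrite sumEFin /series /=.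
  by congr EFin; apply: eq_bigr => i _; rewrite mul1r.
apply/cvg_EFin; first exact: nearW.
by apply: cvg_geometric_series; rewrite ger0_norm// ltW.
Qed.

(* The good paths: nonnegative claims, which the law of the claims grants
   only almost surely, and summable discount factors. *)
Let Omega0 : set T := [set w | forall n, 0 <= xi n w] `&` [set w | (total_disc w < +oo)%E].

Let claims_ge0E : [set w | forall n, 0 <= xi n w] = \bigcap_n (xi n @^-1` `[0, +oo[).
Proof.
apply/seteqP; split=> w /= h n; first by move=> _; rewrite /= in_itv/= andbT.
by have := h n I; rewrite /= in_itv/= andbT.
Qed.

Let measurable_claim_ge0 n : measurable (xi n @^-1` `[0, +oo[).
Proof. by rewrite -[_ @^-1` _]setTI; exact: measurable_funP. Qed.

Let measurable_total_fin : measurable [set w | (total_disc w < +oo)%E].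
Proof.
rewrite -[X in measurable X]setTI; apply: emeasurable_fun_infty_o => //.
Qed.

Let measurable_Omega0 : measurable Omega0.
Proof.
apply: measurableI => //; rewrite claims_ge0E.
exact: bigcapT_measurable.
Qed.

Let null_Omega0 : Pr (~` Omega0) = 0%E.
Proof.
apply/negligibleP; first exact: measurableC.
rewrite setCI; apply: negligibleU.
  rewrite claims_ge0E setC_bigcap; apply: negligible_bigcup => n.
  apply/negligibleP; first exact: measurableC.
  rewrite preimage_setC setCitvr.
  transitivity (exponential_prob mu `]-oo, (0 : R)[).
    exact: (claim_exp n (measurable_itv `]-oo, (0 : R)[)).
  apply: integral0_eq => x; rewrite /= in_itv/= => x0.
  by rewrite lt0_exponential_pdf.
have tot : Pr.-integrable setT (fun w => total_disc w).
  apply/integrableP; split => //.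
  under eq_integral do rewrite gee0_abs ?nneseries_ge0//.
  exact: total_fin.
have [B [mB B0 hB]] := integrable_ae measurableT tot.
exists B; split => //; apply: subset_trans hB => w /= hw h; apply: hw.
by have := h I; rewrite ge0_fin_numE ?nneseries_ge0.
Qed.

Variable N : R -> T -> nat.
Hypothesis NE : forall t w n, 0 <= t -> (n <= N t w)%N = (arrival tau n w <= t).

(* Nonnegative claims keep the level below b, so the upper clamp does
   nothing. *)
Let stateE n w : (forall n, 0 <= xi n w) ->
  state n w = (weight tau xi c q a b w n, reserve_after c tau xi b n w).
Proof.
move=> claim0; elim: n => [|n IH].
  by rewrite /weight /= arrival0 mulr0 oppr0 expR0 mulr1.
rewrite /= IH /next /weight /=; congr pair.
  rewrite arrivalS mulrDr opprD expRD /bankrupting.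
  rewrite -/(level_at_claim c tau xi b n w).
  have -> : level (reserve_after c tau xi b n w) (tau n w) (xi n w) =
    level_at_claim c tau xi b n w by [].
  by case: ifP => _; rewrite ?andbF ?andbT ?mulr0// mulrAC.
rewrite /clamp; congr Num.max; apply/min_idPr.
by rewrite /level /period_level lerBlDr ge_min lerDl claim0.
Qed.

(** The value part of the constant expectation v(0) vanishes in the limit;
on good paths the rewards converge to the payoff, dominated by a multiple of
the sum of the discount factors.  There the payoff is a limit of measurable
functions, so its own measurability comes for free. *)
Theorem policy_value_fixpoint : policy_value_ereal c tau xi N q k pen a b = (v 0)%:E.
Proof.
rewrite /policy_value_ereal (integral_off_null_set _ measurable_Omega0 null_Omega0).
have cvg_rewards : (\int[Pr]_(w in Omega0) (rewards m w)%:E)%E @[m --> \oo] -->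
    (\int[Pr]_(w in Omega0) payoff c tau xi N q k pen a b w)%E.
  have tot_fin w : Omega0 w -> total_disc w \is a fin_num.
    by move=> [_ h]; rewrite ge0_fin_numE ?nneseries_ge0.
  apply: (@dominated_cvg _ _ _ Pr Omega0 measurable_Omega0 _ _
    (fun w => Mr%:E * total_disc w)%E).
  - move=> m; apply: measurable_funS measurableT _ _ => //.
    exact: (measurable_int Pr (integrable_rewards m)).
  - move=> w [claim0 fin].
    have := @cvg_payoff _ _ _ _ tau xi N c q k pen a b w c0 q0 a0 b0 (gap0^~ w) (NE^~ w)
      claim0 fin.
    apply: cvg_trans; apply: near_eq_cvg; apply: nearW => m /=.
    congr EFin; apply: eq_bigr => n _.
    by rewrite /reward stateE.
  - by move=> w w0; rewrite fin_numM// tot_fin.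
  - apply: integrableZl => //; apply: (integrableS measurableT) => //.
    apply/integrableP; split=> //.
    by under eq_integral do rewrite gee0_abs ?nneseries_ge0//.
  - move=> m w w0; rewrite /rewards -sumEFin.
    rewrite (le_trans (lee_abs_sum _ _ _))//.
    rewrite -nneseriesZl//.
    apply: le_trans (nneseries_lim_ge m _); last first.
      by move=> n _ _; rewrite -EFinM lee_fin mulr_ge0//; case/andP: (disc_itv n w).
    rewrite big_mkord; apply: lee_sum => n _; rewrite -EFinM lee_fin.
    by rewrite (le_trans (reward_le n w))// ler_wpM2l.
apply: (cvg_unique _ cvg_rewards) => //.
have : ((v 0)%:E - \int[Pr]_w (valueS m w)%:E)%E @[m --> \oo] --> ((v 0)%:E - 0)%E.
  by apply: cvgeB cvg_valueS => //; exact: cvg_cst.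
rewrite sube0; apply: cvg_trans; apply: near_eq_cvg; apply: nearW => m.
rewrite -(integral_off_null_set _ measurable_Omega0 null_Omega0) -(telescoping m) addeK//.
exact: integrable_fin_num (integrable_valueS m).
Qed.

End controlled_chain.

(** * The Lambert function on the positive half line *)

Section lambert.
Context {R : realType}.
Implicit Types y z : R.

Let mul_expR_inj z1 z2 : 0 < z1 -> 0 < z2 -> z1 * expR z1 = z2 * expR z2 -> z1 = z2.
Proof.
have lt_mul (u v : R) : 0 < u -> u < v -> u * expR u < v * expR v.
  by move=> u0 uv; rewrite ltr_pM ?expR_ge0 ?ltr_expR// ltW.
by move=> z10 z20 e; case: (ltgtP z1 z2) => // h;
  [have := lt_mul _ _ z10 h|have := lt_mul _ _ z20 h]; rewrite e ltxx.
Qed.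

(** For y > 0 every real solution of z e^z = y is positive, and z e^z is
increasing there: the restriction to z >= -1 is automatic. *)
Lemma lambertW0P y z : 0 < y -> z * expR z = y <-> z = lambertW0 y.
Proof.
move=> y0.
have pos u : u * expR u = y -> 0 < u.
  by move=> uy; move: y0; rewrite -uy pmulr_lgt0// expR_gt0.
have [u _ uy] : exists2 u, u \in `[0, y] & u * expR u = y.
  apply: (@IVT R (fun u => u * expR u)); first exact: ltW.
  - apply: continuous_subspaceT => u; apply: cvgM; first exact: cvg_id.
    exact: continuous_expR.
  - rewrite mul0r minElt maxElt.
    have yy : y <= y * expR y by rewrite ler_peMr ?(ltW y0)// -expR0 ler_expR ltW.
    by rewrite (lt_le_trans y0 yy) (ltW y0).
have : [set z | -1 <= z /\ z * expR z = y] (lambertW0 y).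
  apply: (@xgetI _ _ _ u); split => //.
  by rewrite (le_trans _ (ltW (pos _ uy)))// lerN10.
move=> /= [_ Ly]; split => [zy|->//].
by apply: mul_expR_inj; rewrite ?pos// zy Ly.
Qed.

End lambert.

(** * The value as a function of a, b and P *)

Section value_algebra.
Context {R : realType}.
Variables (mu q k : R).
Hypotheses (mu0 : 0 < mu) (q0 : 0 < q) (k0 : 0 < k).
Implicit Types (gam th P a j : R).

Local Notation E a := (expR (- (mu * a))).

(** Here gam and th stand for gamma(b) and theta(b). *)
Definition policy_numerator P gam a : R :=
  gam - k * ((1 - E a) / mu - a * E a) - P * E a.

Definition policy_ratio P gam th a : R := policy_numerator P gam a / (q * th + E a).

Definition eta_num P gam th a : R :=
  gam / th - k / (mu * th) * (1 - E a) - q * (k * a - P).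

Definition h_num P gam th : R := 1 / (q * th) - mu / k * (gam / (q * th) + P).

Let neq0 (x : R) : 0 < x -> x != 0. Proof. by move=> x0; rewrite gt_eqF. Qed.

Lemma policy_denominator_gt0 th a : 0 < th -> 0 < q * th + E a.
Proof. by move=> th0; rewrite addr_gt0 ?mulr_gt0 ?expR_gt0. Qed.

(** This identity is behind all the statements on critical points in a: it
makes the vanishing of J - (k a - P) and that of eta the same. *)
Lemma policy_ratio_eta P gam th a : 0 < th ->
  policy_ratio P gam th a - (k * a - P) = th * eta_num P gam th a / (q * th + E a).
Proof.
move=> th0; rewrite /policy_ratio /eta_num /policy_numerator; field.
by rewrite !neq0// policy_denominator_gt0.
Qed.

Lemma policy_ratio_critical P gam th a : 0 < th ->
  policy_ratio P gam th a = k * a - P <-> eta_num P gam th a = 0.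
Proof.
move=> th0; have D0 := neq0 (policy_denominator_gt0 a th0).
have e := policy_ratio_eta P gam a th0.
split => [h|h]; last by apply/eqP; rewrite -subr_eq0 e h mulr0 mul0r.
move/eqP: e; rewrite h subrr eq_sym mulf_eq0 invr_eq0 (negbTE D0) orbF.
by rewrite mulf_eq0 (negbTE (neq0 th0)) => /eqP.
Qed.

Lemma is_derive_policy_ratio P gam th a : 0 < th ->
  is_derive a 1 (policy_ratio P gam th)
    (mu * E a * (policy_ratio P gam th a - (k * a - P)) / (q * th + E a)).
Proof.
move=> th0; have D0 := neq0 (policy_denominator_gt0 a th0).
have dE (c : R) : is_derive a 1 (fun x : R => c * E x) (c * (- (mu * E a))).
  by have h := derive_Z c (is_derive_expRNM mu a); exact: h.
rewrite /policy_ratio /policy_numerator.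
have dN : is_derive a 1 (fun x : R => gam - k * ((1 - E x) / mu - x * E x) - P * E x)
    (mu * E a * (P - k * a)).
  have -> : (fun x : R => gam - k * ((1 - E x) / mu - x * E x) - P * E x) =
    (fun x : R => (gam - k / mu) + (k / mu - P) * E x + k * (x * E x)).
    by apply/funext => x; field; exact: neq0.
  have d1 := derive_D (derive_cst (gam - k / mu) a) (dE (k / mu - P)).
  have d2 := derive_Z k (derive_M (derive_id1 a) (is_derive_expRNM mu a)).
  apply: derive_eq (derive_D d1 d2) _.
  by field; exact: neq0.
have dD : is_derive a 1 (fun x : R => q * th + E x) (- (mu * E a)).
  by apply: derive_eq (derive_D (derive_cst (q * th) a) (is_derive_expRNM mu a)) (add0r _).
apply: derive_eq (derive_div dN dD D0) _.
by field; rewrite D0 neq0.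
Qed.

Lemma is_derive_ratio (gam th : R -> R) (m e : R) (b g t : R) :
  q * th b + e != 0 -> is_derive b 1 gam g -> is_derive b 1 th t ->
  is_derive b 1 (fun b => (gam b - m) / (q * th b + e))
    ((g - (gam b - m) / (q * th b + e) * (q * t)) / (q * th b + e)).
Proof.
move=> D0 dg dt.
have dN := derive_B dg (derive_cst m b).
have dD := derive_D (derive_Z q dt) (derive_cst e b).
apply: derive_eq (derive_div dN dD D0) _.
by field.
Qed.

Lemma eta_num_decreasing P gam th a a' : 0 < th -> a < a' ->
  eta_num P gam th a' < eta_num P gam th a.
Proof.
move=> th0 aa'; rewrite /eta_num ler_ltB//.
  rewrite lerD2l lerN2 ler_wpM2l//; first by rewrite ltW// divr_gt0// mulr_gt0.
  by rewrite lerD2l lerN2 ler_expR lerN2 ler_wpM2l// ltW.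
by rewrite ltr_pM2l// ltrD2r ltr_pM2l.
Qed.

(** Multiplied by mu / (q k), eta becomes E / (q th) - z with z = mu a + h and
E = e^(-mu a) = e^(h - z). *)
Lemma eta_num_lambert P gam th a : 0 < th ->
  eta_num P gam th a = 0 <->
  a = mu^-1 * (- h_num P gam th + lambertW0 (expR (h_num P gam th) / (q * th))).
Proof.
move=> th0; set h := h_num P gam th.
have qth := mulr_gt0 q0 th0.
have y0 : 0 < expR h / (q * th) by rewrite divr_gt0 ?expR_gt0.
have etaE : eta_num P gam th a * (mu / (q * k)) = E a / (q * th) - (mu * a + h).
  by rewrite /eta_num /h /h_num; field; rewrite !neq0.
have zE : (mu * a + h) * expR (mu * a + h) = expR h / (q * th) <-> eta_num P gam th a = 0.
  have e : expR h / (q * th) - (mu * a + h) * expR (mu * a + h) =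
      expR (mu * a + h) * (mu / (q * k)) * eta_num P gam th a.
    rewrite -mulrA [_ * eta_num _ _ _ _]mulrC etaE mulrBr [_ * (mu * a + h)]mulrC.
    congr (_ - _); rewrite mulrA -expRD; congr (expR _ / _); ring.
  have p0 : expR (mu * a + h) * (mu / (q * k)) != 0.
    by rewrite neq0// mulr_gt0 ?expR_gt0// divr_gt0// mulr_gt0.
  split => [h1|h1]; last by apply/eqP; rewrite eq_sym -subr_eq0 e h1 mulr0.
  move/eqP: e; rewrite h1 subrr eq_sym mulf_eq0 (negbTE p0) => /eqP; exact.
rewrite -zE (lambertW0P _ y0).
split => [<-|->]; first by rewrite addrC addrK mulrA mulVf ?mul1r// neq0.
by rewrite mulrA mulfV ?neq0// mul1r addrC addrA subrr add0r.
Qed.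

Lemma eta_num_gt0 P gam th : 0 < th -> 0 < eta_num P gam th 0 <-> - (gam / (q * th)) < P.
Proof.
move=> th0; have -> : eta_num P gam th 0 = q * (P - - (gam / (q * th))).
  by rewrite /eta_num mulr0 oppr0 expR0; field; rewrite !neq0.
by rewrite pmulr_rgt0// subr_gt0.
Qed.

Lemma eta_num_root_gt0 P gam th a : 0 < th -> eta_num P gam th a = 0 ->
  0 < a <-> 0 < eta_num P gam th 0.
Proof.
move=> th0 ea; split => [a0|e0]; first by have := eta_num_decreasing P gam th0 a0; rewrite ea.
rewrite ltNge le_eqVlt; apply/negP => /predU1P[a0|a0].
  by move: e0; rewrite -[X in eta_num _ _ _ X]a0 ea ltxx.
by have := eta_num_decreasing P gam th0 a0; rewrite ea ltNge (ltW e0).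
Qed.

(** Up to a positive factor, eta at s = (j + P) / k is e^(-mu s) - X. *)
Lemma eta_num_penalty P gam th j : 0 < th ->
  let X := 1 + (q * th * j - gam) / (k / mu) in
  eta_num P gam th ((j + P) / k) = 0 <-> 0 < X /\ P = - (k / mu) * ln X - j.
Proof.
move=> th0 X; pose s := (j + P) / k.
have e : eta_num P gam th s * (mu * th / k) = E s - X.
  by rewrite /eta_num /X /s; field; rewrite !neq0.
have p0 : mu * th / k != 0 by rewrite neq0// divr_gt0// mulr_gt0.
have eE : eta_num P gam th s = 0 <-> X = E s.
  split => [h|h]; last first.
    by move/eqP: e; rewrite h subrr mulf_eq0 (negbTE p0) orbF => /eqP.
  by move/eqP: e; rewrite h mul0r eq_sym subr_eq0 => /eqP.
rewrite -/s eE; split => [->|[X0 PE]].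
  split; first exact: expR_gt0.
  by rewrite expRK /s; field; rewrite !neq0.
rewrite -[LHS]lnK//; congr expR.
by rewrite /s [in RHS]PE; field; rewrite !neq0.
Qed.

End value_algebra.

(** * The value of the policy *)

Section policy_value_formula.
Context {d : measure_display} {T : measurableType d} {R : realType}.
Variable Pr : probability T R.
Variables (c lam mu q k pen : R) (tau xi : nat -> {RV Pr >-> R}) (N : R -> T -> nat).
Hypotheses (c0 : 0 < c) (lam0 : 0 < lam) (mu0 : 0 < mu) (q0 : 0 < q) (k0 : 0 < k).
Hypothesis model : cramer_lundberg lam mu tau xi N.
Variables r1 r2 : R.
Hypothesis hr : is_root_pair c lam mu q r1 r2.

(** The value function x |-> c J W(x) - K C(x) has coefficients A1 and A2 on
e^(r1 x) and e^(r2 x). *)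
Theorem policy_value_sol (a b : R) : 0 <= a -> 0 <= b ->
  policy_value_ereal c tau xi N q k pen a b =
  (policy_ratio mu q k pen (gamma_sol c lam r1 r2 b) (theta_sol c lam mu r1 r2 b) a)%:E.
Proof.
move=> a0 b0; have [mr2 r20 r10 rD rM] := hr.
have {}mr2 : 0 < mu + r2 by rewrite -ltrBlDl sub0r.
have mr1 : 0 < mu + r1 by rewrite addr_gt0.
have r12 : 0 < r1 - r2 by rewrite subr_gt0 (lt_trans r20).
have neq0 (x : R) : 0 < x -> x != 0 by move=> x0; rewrite gt_eqF.
have mr12 : c * (mu + r1) * (mu + r2) = lam * mu.
  have -> : c * (mu + r1) * (mu + r2) = c * mu ^+ 2 + mu * (c * (r1 + r2)) + c * (r1 * r2) by ring.
  by rewrite rD rM; ring.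
have lqE : lam + q = c * (r1 + r2) + c * mu by rewrite rD subrK.
have root1 : lam * mu / (mu + r1) = lam + q - c * r1.
  by rewrite -mr12 lqE; field; exact: neq0.
have root2 : lam * mu / (mu + r2) = lam + q - c * r2.
  by rewrite -mr12 lqE; field; exact: neq0.
pose E := expR (- (mu * a)).
have E0 : 0 < E by exact: expR_gt0.
pose C1 := C_sol' c lam r1 r2 b; pose w := scale_sol c mu r1 r2 b.
have C10 : 0 < C1 by exact: (C_sol'_gt0 c0 lam0 hr).
have w0 : 0 < w by exact: (scale_sol_gt0 c0 mu0 hr b0).
pose m := (1 - E) / mu - a * E.
pose J := policy_ratio mu q k pen (gamma_sol c lam r1 r2 b) (theta_sol c lam mu r1 r2 b) a.
have DJ : J * (E * C1 + q * w) = 1 - C1 * (k * m + pen * E).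
  rewrite /J /policy_ratio /policy_numerator -/E -/m /gamma_sol /theta_sol -/C1 -/w.
  by field; rewrite !neq0// addr_gt0// mulr_gt0.
pose K := (1 - E) * J - k * m - pen * E.
pose A1 := (c * J * (mu + r1) - K * lam) / (c * (r1 - r2)).
pose A2 := - ((c * J * (mu + r2) - K * lam) / (c * (r1 - r2))).
have v0 : value r1 r2 A1 A2 0 = J.
  rewrite /value !mulr0 expR0 !mulr1 /A1 /A2.
  by field; rewrite !neq0.
have fluctuation0 : A1 * (mu / (mu + r1)) + A2 * (mu / (mu + r2)) = K.
  apply: (mulIf (neq0 _ (mulr_gt0 lam0 mu0))); rewrite -{1}mr12.
  by rewrite /A1 /A2; field; rewrite !neq0.
have KE : K = (1 - expR (- (mu * a))) * value r1 r2 A1 A2 0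
  - k * ((1 - expR (- (mu * a))) / mu - a * expR (- (mu * a))) - pen * expR (- (mu * a)).
  by rewrite v0.
have slope1 : value' r1 r2 A1 A2 b = 1.
  pose e1 := expR (r1 * b); pose e2 := expR (r2 * b).
  pose w' := ((mu + r1) * (r1 * e1) - (mu + r2) * (r2 * e2)) / (c * (r1 - r2)).
  (* c W' = C' + q W, the derivative of C = c W - Z *)
  have cw' : c * w' = C1 + q * w.
    have h r : c * r ^+ 2 - (c * (r1 + r2)) * r + c * (r1 * r2) = 0 ->
        (lam + q) * r + q * mu = c * (mu + r) * r.
      by rewrite rD rM => h; apply/eqP; rewrite -subr_eq0 -oppr_eq0 -[X in _ == X]h; apply/eqP; ring.
    have h1 := h r1 _; have h2 := h r2 _.
    have E1 : lam * r1 + q * (mu + r1) = c * (mu + r1) * r1 by rewrite -h1; ring.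
    have E2 : lam * r2 + q * (mu + r2) = c * (mu + r2) * r2 by rewrite -h2; ring.
    transitivity (((lam * r1 + q * (mu + r1)) * e1 - (lam * r2 + q * (mu + r2)) * e2) / (c * (r1 - r2))).
      by rewrite E1 E2 /w'; ring.
    by rewrite /C1 /w /C_sol' /scale_sol -/e1 -/e2; ring.
  have -> : value' r1 r2 A1 A2 b = J * (c * w') - K * C1.
    by rewrite /value' /A1 /A2 /w' /C1 /C_sol' -/e1 -/e2; ring.
  have -> : J * (c * w') - K * C1 = J * (E * C1 + q * w) + C1 * (k * m + pen * E).
    by rewrite cw' /K; ring.
  by rewrite DJ subrK.
have [[gap0 gap_exp _ NE] claim_exp indep] := model.
rewrite -/J -v0.
apply: (policy_value_fixpoint (g := pre_claim c lam q r1 r2 A1 A2) c0 lam0 mu0 q0 (ltW k0) a0 b0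
  gap0 gap_exp claim_exp indep) => //.
- exact: continuous_value.
- exact: continuous_pre_claim.
- by move=> x xb; exact: (claim_expectation lam0 mu0 a0 b0 mr1 mr2 root1 root2 fluctuation0 KE).
- by move=> r rb; exact: period_expectation.
Qed.

End policy_value_formula.

(** * The optimality equations *)

Theorem proposition3 (R : realType) (d : measure_display)
    (T : measurableType d) (Pr : probability T R)
    (c lam mu q k P : R)
    (tau xi : nat -> {RV Pr >-> R}) (N : R -> T -> nat) (W : R -> R)
    (hc : 0 < c) (hlam : 0 < lam) (hmu : 0 < mu) (hq : 0 < q) (hk : 1 <= k)
    (hP : - (c / q) <= P)
    (hmodel : cramer_lundberg lam mu tau xi N)
    (hW : is_scale_function c lam mu q W) :
  let EJ := policy_value_ereal c tau xi N q k P in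
  let J := policy_value c tau xi N q k P in
  let C' := hderiv (Cfun lam mu W) in
  let gamma := gammaf lam mu W in
  let theta := thetaf lam mu W in
  let j := jf lam mu q W in
  let F := Fexp mu in
  let Fbar := Fbar mu in
  let m := partial_mean mu in
  let eta := etaf lam mu q W k P in
  let h := hfun lam mu q W k P in
  let s := threshold lam mu q W k P in
  let L0 := @lambertW0 R in
  (- (c / q) < P ->
    (* (1) *)
    (forall a b : R, 0 <= a -> 0 <= b ->
       EJ a b = ((1 - C' b * (k * m a + P * Fbar a))
                 / (Fbar a * C' b + q * W b))%:E
       /\ (1 - C' b * (k * m a + P * Fbar a)) / (Fbar a * C' b + q * W b)
          = (gamma b - k * m a - P * Fbar a) / (q * theta b + Fbar a))
    /\
    (* (2) *)
    (forall a b : R, 0 <= a -> 0 <= b ->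
       is_hderiv (fun b => J a b) b 0 <-> J a b = j b)
    /\
    (* (3) *)
    (forall a b : R, 0 <= a -> 0 <= b -> a <> 0 ->
       is_hderiv (fun a => J a b) a 0 ->
       J a b - (k * a - P) = 0 /\ eta b a = 0))
  /\
  (* (4) *)
  (forall b : R, 0 <= b ->
     let ab := mu^-1 * (- h b + L0 (expR (h b) / (q * theta b))) in
     (forall a : R, eta b a = 0 <-> a = ab)
     /\ (0 < ab <-> - (gamma b / (q * theta b)) < P)
     /\ (0 <= ab ->
           EJ ab b
           = (k / mu * (- h b + L0 (1 / (q * theta b) * expR (h b))) - P)%:E))
  /\
  (- (c / q) < P ->
    (* (5) *)
    (let ct := c + q * P in
     let delta a := ct - k * (a * q + lam / mu * (1 - expR (- (mu * a)))) in
     let g := lam / q - mu / (k * q) * ct in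
     0 < ct
     /\ (forall a : R, eta 0 a = delta a)
     /\ h 0 = g
     /\ (forall a : R, delta a = 0 <-> mu * a = - g + L0 (lam / q * expR g))
     /\ 0 < - g + L0 (lam / q * expR g))
    /\
    (* (6) *)
    (forall b : R, 0 <= b ->
       eta b (s b)
       = gamma b / theta b - q * j b
         - k / (mu * theta b) * F ((j b + P) / k))
    /\
    (forall a b : R, 0 < a -> 0 < b ->
       is_hderiv (fun a => J a b) a 0 -> is_hderiv (fun b => J a b) b 0 ->
       J a b = j b /\ j b = k * a - P /\ a = s b /\ eta b (s b) = 0)
    /\
    (* (7) *)
    (forall b : R, 0 <= b ->
       eta b (s b) = 0 <->
       0 < 1 + (q * theta b * j b - gamma b) / (k / mu)
       /\ P = - (k / mu) * ln (1 + (q * theta b * j b - gamma b) / (k / mu))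
              - j b)).
Proof.
move=> EJ J C' gamma theta j F Fbar' m eta h s L0.
have k0 : 0 < k by exact: lt_le_trans hk.
have neq0 (x : R) : 0 < x -> x != 0 by move=> x0; rewrite gt_eqF.
have [r1 [r2 hr]] := root_pair_exists hc hlam hmu hq.
have WE x : 0 <= x -> W x = scale_sol c mu r1 r2 x.
  exact: (scale_function_unique hc hmu hr hW).
have CE x : 0 <= x -> C' x = C_sol' c lam r1 r2 x.
  move=> x0; apply: hderiv_val => //.
  apply: is_hderiv_derive (is_derive_C_sol _ _ _ _ _) => //.
  exact: Cfun_sol.
have C'0 x : 0 <= x -> 0 < C' x by move=> x0; rewrite CE// (C_sol'_gt0 hc hlam hr).
have W0 x : 0 <= x -> 0 < W x by move=> x0; rewrite WE// (scale_sol_gt0 hc hmu hr).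
have gammaE x : 0 <= x -> gamma x = gamma_sol c lam r1 r2 x.
  by move=> x0; rewrite /gamma /gammaf -/C' CE.
have thetaE x : 0 <= x -> theta x = theta_sol c lam mu r1 r2 x.
  by move=> x0; rewrite /theta /thetaf -/C' CE// WE.
have theta0 x : 0 <= x -> 0 < theta x.
  by move=> x0; rewrite thetaE// (theta_sol_gt0 hc hlam hmu hr).
have mE a : 0 <= a -> m a = (1 - expR (- (mu * a))) / mu - a * expR (- (mu * a)).
  move=> a0; pose f (y : R) : R := y * (mu * expR (- (mu * y))).
  pose G (y : R) : R := - (mu^-1 * expR (- (mu * y)) + y * expR (- (mu * y))).
  have cf : continuous f.
    move=> y; apply: cvgM; first exact: cvg_id.
    by apply: cvgM; [exact: cvg_cst|exact: continuous_expRNM].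
  have dG (y : R) : is_derive y 1 G (f y).
    have d1 := derive_Z mu^-1 (is_derive_expRNM mu y).
    have d2 := derive_M (derive_id1 y) (is_derive_expRNM mu y).
    by apply: derive_eq (derive_N (derive_D d1 d2)) _; rewrite /f; field; exact: neq0.
  rewrite /m /partial_mean (Rsegment_FTC a0 cf dG) /G mulr0 oppr0 expR0.
  by field; exact: neq0.
have FbarE a : Fbar' a = expR (- (mu * a)).
  by rewrite /Fbar' /Fbar /Fexp opprB addrC subrK.
have EJE a b : 0 <= a -> 0 <= b -> EJ a b = (policy_ratio mu q k P (gamma b) (theta b) a)%:E.
  move=> a0 b0; rewrite gammaE// thetaE//.
  exact: (policy_value_sol P hc hlam hmu hq k0 hmodel hr).
have JE a b : 0 <= a -> 0 <= b -> J a b = policy_ratio mu q k P (gamma b) (theta b) a.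
  by move=> a0 b0; rewrite /J /policy_value -/(EJ a b) EJE.
have etaE b a : eta b a = eta_num mu q k P (gamma b) (theta b) a by [].
(* dJ/db = (gamma' - J q theta') / (q theta + E), and theta' > 0 *)
have critical_b a b : 0 <= a -> 0 <= b -> is_hderiv (fun b => J a b) b 0 <-> J a b = j b.
  move=> a0 b0.
  have dg := is_derive_gamma_sol hc hlam hr b.
  have [t t0 dt] := is_derive_theta_sol hc hlam hmu hr b.
  have D0 : q * theta_sol c lam mu r1 r2 b + expR (- (mu * a)) != 0.
    by rewrite neq0// policy_denominator_gt0// -thetaE// theta0.
  set g := (X in is_derive _ _ _ X) in dg.
  have jE : j b = g / (q * t).
    rewrite /j /jf; congr (_ / (_ * _)); apply: hderiv_val => //.
      exact: is_hderiv_derive dg.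
    exact: is_hderiv_derive dt.
  pose n := k * ((1 - expR (- (mu * a))) / mu - a * expR (- (mu * a))) + P * expR (- (mu * a)).
  have JbE y : 0 <= y -> J a y =
    (gamma_sol c lam r1 r2 y - n) / (q * theta_sol c lam mu r1 r2 y + expR (- (mu * a))).
    by move=> y0; rewrite JE// gammaE// thetaE// /policy_ratio /policy_numerator /n opprD addrA.
  have dJ := is_hderiv_derive b0 JbE (is_derive_ratio n D0 dg dt).
  rewrite -JbE// in dJ.
  have dJ0 : (g - J a b * (q * t)) / (q * theta_sol c lam mu r1 r2 b + expR (- (mu * a))) = 0
      <-> J a b = j b.
    rewrite jE; split=> [/eqP|->].
      rewrite mulf_eq0 invr_eq0 (negbTE D0) orbF subr_eq0 => /eqP ->.
      by rewrite mulfK// neq0// mulr_gt0.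
    by rewrite divfK ?subrr ?mul0r// neq0// mulr_gt0.
  rewrite -dJ0; split => [d0|<-//].
  by rewrite -(hderiv_val b0 dJ) (hderiv_val b0 d0).
(* dJ/da has the sign of J - (k a - P) *)
have critical_a a b : 0 <= a -> 0 <= b -> is_hderiv (fun a => J a b) a 0 ->
    J a b = k * a - P /\ eta b a = 0.
  move=> a0 b0 d0.
  have dJ := is_hderiv_derive a0 (fun y y0 => JE y b y0 b0)
    (is_derive_policy_ratio k hmu hq P (gamma b) a (theta0 b b0)).
  have D0 := neq0 _ (policy_denominator_gt0 mu hq a (theta0 b b0)).
  have Jk : J a b = k * a - P.
    apply/eqP; rewrite -subr_eq0 JE//; have := hderiv_val a0 dJ; rewrite (hderiv_val a0 d0).
    move=> /esym/eqP; rewrite mulf_eq0 invr_eq0 (negbTE D0) orbF mulf_eq0.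
    by rewrite (negbTE (neq0 _ (mulr_gt0 hmu (expR_gt0 _)))).
  split => //; rewrite etaE; apply/(policy_ratio_critical k hmu hq P (gamma b) a (theta0 b b0)).
  by rewrite -JE.
have lambert b a : 0 <= b -> eta b a = 0 <->
    a = mu^-1 * (- h b + L0 (expR (h b) / (q * theta b))).
  by move=> b0; apply: eta_num_lambert => //; exact: theta0.
have gamma0 : gamma 0 / theta 0 = c /\ theta 0 = lam^-1.
  have [_ r20 r10 _ _] := hr.
  have r12 : 0 < r1 - r2 by rewrite subr_gt0 (lt_trans r20).
  rewrite gammaE// thetaE// /gamma_sol /theta_sol /C_sol' /scale_sol !mulr0 expR0 !mulr1.
  have -> : mu + r1 - (mu + r2) = r1 - r2 by ring.
  by split; field; rewrite !neq0.
split; [move=> hP'; split; [|split] | split; [|move=> hP'; split; [|split; [|split]]]].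
- move=> a b a0 b0; have E0 := expR_gt0 (- (mu * a)); rewrite EJE//.
  have e : (1 - C' b * (k * m a + P * Fbar' a)) / (Fbar' a * C' b + q * W b)
    = (gamma b - k * m a - P * Fbar' a) / (q * theta b + Fbar' a).
    rewrite FbarE /gamma /theta /gammaf /thetaf -/C'.
    field; have := C'0 b b0; have := W0 b b0 => w0 c'0.
    by rewrite !neq0// addr_gt0// mulr_gt0.
  by rewrite e; split => //; rewrite /policy_ratio /policy_numerator FbarE mE.
- exact: critical_b.
- by move=> a b a0 b0 _ /(critical_a a b a0 b0)[-> ?]; rewrite subrr.
- move=> b b0 ab; have eab : eta b ab = 0 by apply/lambert.
  split; first by move=> a; exact: lambert.
  split.
    apply: iff_trans (eta_num_root_gt0 hmu hq k0 (theta0 b b0) eab) _.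
    by apply: eta_num_gt0 => //; exact: theta0.
  move=> ab0; rewrite EJE//; congr EFin.
  rewrite ((policy_ratio_critical k hmu hq P (gamma b) ab (theta0 b b0)).2 eab) /ab.
  by rewrite [1 / _ * _]mulrC mul1r mulrA.
- move=> ct delta g.
  have ct0 : 0 < ct by rewrite /ct -ltrBlDl sub0r mulrC -ltr_pdivrMr// mulNr.
  have [cE thE] := gamma0.
  have dE a : eta 0 a = delta a.
    by rewrite /eta /etaf -/gamma -/theta cE thE /delta /ct /Fexp; field; rewrite !neq0.
  have gE : h 0 = g.
    rewrite /h /hfun -/gamma -/theta.
    have -> : gamma 0 / (q * theta 0) = c / q by rewrite -cE; field; rewrite !neq0// theta0.
    by rewrite thE /g /ct; field; rewrite !neq0.
  have yE : expR (h 0) / (q * theta 0) = lam / q * expR g.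
    by rewrite gE thE; field; rewrite !neq0.
  have root a : delta a = 0 <-> mu * a = - g + L0 (lam / q * expR g).
    rewrite -dE lambert// yE gE.
    by split=> [->|<-]; rewrite mulrA (mulfV, mulVf) ?mul1r// neq0.
  do 4! split => //.
  pose a := mu^-1 * (- g + L0 (lam / q * expR g)).
  have mua : mu * a = - g + L0 (lam / q * expR g) by rewrite mulrA mulfV ?mul1r// neq0.
  rewrite -mua mulr_gt0//.
  have ea : eta 0 a = 0 by rewrite dE root.
  apply/(eta_num_root_gt0 hmu hq k0 (theta0 0 (lexx _)) ea).
  rewrite -etaE dE /delta mulr0 oppr0 expR0 subrr mulr0 mul0r addr0 mulr0 subr0.
  exact: ct0.
- move=> b b0; rewrite [RHS]addrAC.
  have -> : j b = k * s b - P by rewrite /s /threshold -/j mulrC divfK ?addrK// neq0.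
  by have -> : (k * s b - P + P) / k = s b by rewrite subrK mulrC mulKf// neq0.
- move=> a b a0 b0 da db.
  have [Jk ea] := critical_a a b (ltW a0) (ltW b0) da.
  have Jj := (critical_b a b (ltW a0) (ltW b0)).1 db.
  have jk : j b = k * a - P by rewrite -Jj.
  have as_ : a = s b by rewrite /s /threshold -/j jk subrK mulrC mulKf// neq0.
  by rewrite -as_.
- by move=> b b0; apply: eta_num_penalty => //; exact: theta0.
Qed.
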